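(* Let $(X_\infty,\omega_\infty)$ be the translation surface, and $\psi_\infty,\rho_\infty\in\mathrm{Aff}(X_\infty,\omega_\infty)$ the affine homeomorphisms, described in the context. Then the group $\mathrm{Aff}(X_\infty,\omega_\infty)$ is generated by $\psi_\infty$ and $\rho_\infty$, and it is isomorphic to $\mathbb{Z}\times\mathbb{Z}/2\mathbb{Z}$.
   Context: A translation surface is a pair $(X,\omega)$ with $X$ a Riemann surface (not assumed compact) and $\omega\neq 0$ a holomorphic 1-form on $X$. A homeomorphism $\phi:X\to X$ is affine if it is (real-)affine in the canonical charts of $\omega$ (charts in which $\omega=\mathrm{d}z$); orientation-reversing maps are allowed. $\mathrm{Aff}(X,\omega)$ is the group of affine homeomorphisms of $X$. The surface $(X_\infty,\omega_\infty)$: let $D=([0,1]\times[1/2,1])\cup([-1/2,1/2]\times[0,1/2])\subset\mathbb{R}^2=\mathbb{C}$. For $n\ge 1$ put $s_n=\sum_{0\le j<n/2}2^{-(n-2j)}$ (so $s_1=\frac12$, $s_2=\frac14$, $s_3=\frac58$, $s_4=\frac5{16}$, ...). Identify the following open edges of $D$ in pairs by translations: (i) $(x,1/2)\sim(x+1,1/2)$ for $-1/2<x<0$; (ii) for each $n\ge1$: $(x,1)\sim(x-\frac12+2^{-n-1},0)$ for $1-2^{1-n}<x<1-3\cdot2^{-n-1}$ (edge $C'_n$), and $(x,1)\sim(x-\frac12-2^{-n-1},0)$ for $1-3\cdot2^{-n-1}<x<1-2^{-n}$ (edge $C''_n$); (iii) for each $n\ge1$: $(1,y)\sim(e,y-s_n)$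 for $1-2^{-n}<y<1-2^{-n-1}$ (edge $A_n$), where $e=-\frac12$ if $n$ is odd and $e=0$ if $n$ is even; (iv) for each $n\ge1$: $(\frac12,y)\sim(e',y+s_n)$ for $2^{-n-1}<y<2^{-n}$ (edge $B_n$), where $e'=0$ if $n$ is odd and $e'=-\frac12$ if $n$ is even. All boundary points of $D$ not lying on one of these open edges are removed. The quotient is $X_\infty$, and $\omega_\infty$ is the 1-form induced by $\mathrm{d}z$. The maps: $\rho_\infty$ is induced by $(x,y)\mapsto(x-\frac12,1-y)$ on $[0,1]\times[\frac12,1]$ and $(x,y)\mapsto(x+\frac12,1-y)$ on $[-\frac12,\frac12]\times[0,\frac12]$. The map $\psi_\infty$ is induced by $(x,y)\mapsto(2x-\frac12,\frac y2)$ on $[0,\frac12]\times[0,1]$, by $(x,y)\mapsto(2x+1,\frac y2+\frac12)$ on $[-\frac12,0]\times[0,\frac12]$, and by $(x,y)\mapsto(2x-1,\frac y2+\frac12)$ on $[\frac12,1]\times[\frac12,1]$. Both are well-defined affine homeomorphisms of $(X_\infty,\omega_\infty)$. *)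

(* Defs.v *)
From HB Require Import structures.
From Stdlib Require Import Relation_Operators.
From mathcomp Require Import all_boot all_order all_algebra.
From mathcomp Require Import generic_quotient.
From mathcomp Require Import all_classical all_reals all_analysis.

Set Implicit Arguments.
Unset Strict Implicit.
Unset Printing Implicit Defensive.


Import Order.TTheory GRing.Theory Num.Theory.
Import numFieldNormedType.Exports.

Local Open Scope classical_set_scope.
Local Open Scope quotient_scope.
Local Open Scope ring_scope.

Notation plane R := (R * R)%type.

Section Homeomorphisms.
Variable T : topologicalType.

Definition homeomorphism (f : T -> T) : Prop :=
  exists g : T -> T,
    [/\ cancel f g, cancel g f, continuous f & continuous g].

Definition homeo : Type := {f : T -> T | `[< homeomorphism f >]}.
HB.instance Definition _ := Choice.on homeo.

Definition homeo_fun (f : homeo) : T -> T := val f.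

Lemma homeo_inj (f g : homeo) : homeo_fun f =1 homeo_fun g -> f = g.
Proof. by move=> fg; apply/val_inj/funext. Qed.

Lemma homeo_subproof1 : `[< homeomorphism (@idfun T) >].
Proof. by apply/asboolP; exists idfun; split=> // x; exact: cvg_id. Qed.

Lemma homeo_subproofM (f g : homeo) :
  `[< homeomorphism (homeo_fun f \o homeo_fun g) >].
Proof.
have /asboolP[f' [fK f'K cf cf']] := valP f.
have /asboolP[g' [gK g'K cg cg']] := valP g.
apply/asboolP; exists (g' \o f'); split; [exact: can_comp|exact: can_comp| |].
- by move=> x; apply: continuous_comp; [exact: cg|exact: cf].
- by move=> x; apply: continuous_comp; [exact: cf'|exact: cg'].
Qed.

Definition homeo_inv_fun (f : homeo) : T -> T :=
  sval (cid (asboolW (valP f))).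

Lemma homeo_inv_funP (f : homeo) :
  [/\ cancel (homeo_fun f) (homeo_inv_fun f),
      cancel (homeo_inv_fun f) (homeo_fun f),
      continuous (homeo_fun f) & continuous (homeo_inv_fun f)].
Proof. by rewrite /homeo_inv_fun; case: cid. Qed.

Lemma homeo_subproofV (f : homeo) : `[< homeomorphism (homeo_inv_fun f) >].
Proof.
by have [? ? ? ?] := homeo_inv_funP f; apply/asboolP; exists (homeo_fun f).
Qed.

Definition Homeo (f : T -> T) (h : `[< homeomorphism f >]) : homeo :=
  exist (fun f => `[< homeomorphism f >]) f h.

Definition homeo1 : homeo := Homeo homeo_subproof1.
Definition homeoM (f g : homeo) : homeo := Homeo (homeo_subproofM f g).
Definition homeoV (f : homeo) : homeo := Homeo (homeo_subproofV f).

Lemma homeoMA : associative homeoM.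
Proof. by move=> f g h; exact: homeo_inj. Qed.
Lemma homeo1M : left_id homeo1 homeoM.
Proof. by move=> f; exact: homeo_inj. Qed.
Lemma homeoM1 : right_id homeo1 homeoM.
Proof. by move=> f; exact: homeo_inj. Qed.
Lemma homeoVM : left_inverse homeo1 homeoV homeoM.
Proof.
by move=> f; have [fK _ _ _] := homeo_inv_funP f; exact: homeo_inj.
Qed.
Lemma homeoMV : right_inverse homeo1 homeoV homeoM.
Proof.
by move=> f; have [_ fK _ _] := homeo_inv_funP f; exact: homeo_inj.
Qed.

HB.instance Definition _ :=
  isGroup.Build homeo homeoMA homeo1M homeoM1 homeoVM homeoMV.

End Homeomorphisms.

Coercion homeo_fun : homeo >-> Funclass.

Definition generated_subgroup (G : groupType) (A : set G) : set G :=
  smallest (fun H : set G => group_closed (mem H)) A.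

(* An isomorphism from the additive group V onto the subgroup H of G. *)
Definition isomorphic_subgroup (V : zmodType) (G : groupType) (H : set G) :
    Prop :=
  exists f : V -> G,
    [/\ {morph f : a b / a + b >-> (a * b)%g}, injective f & range f = H].

Section AffineGroup.
Variables (R : realType) (T : topologicalType).

(* A domain together with a total map, of which only the restriction to the   *)
(* domain matters.                                                            *)
Definition chart : Type := set T * (T -> plane R).

Definition is_planar_chart (c : chart) : Prop :=
  [/\ open c.1,
      {in c.1, continuous c.2},
      {in c.1 &, injective c.2} &
      forall V : set T, open V -> V `<=` c.1 -> open (c.2 @` V)].

(* No invertibility or orientation requirement: for the affine expression of  *)
(* a homeomorphism the linear part is automatically in GL(2).                 *)
Definition affine_map (g : plane R -> plane R) : Prop :=
  exists a b c d e f : R,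
    forall v, g v = (a * v.1 + b * v.2 + e, c * v.1 + d * v.2 + f).

Definition affine_homeos (atlas : set chart) : set (homeo T) :=
  [set phi | forall p : T, exists c d : chart,
    [/\ atlas c, atlas d, c.1 p, d.1 (phi p) &
        exists2 g, affine_map g & \forall q \near p, d.2 (phi q) = g (c.2 q)]].

End AffineGroup.

Section Surface.
Variable R : realType.

Definition box (a b c d : R) : set (plane R) :=
  [set p | a <= p.1 <= b /\ c <= p.2 <= d].

Definition D : set (plane R) := box 0 1 2^-1 1 `|` box (- 2^-1) 2^-1 0 2^-1.

Definition s_shift (n : nat) : R :=
  \sum_(0 <= j < n | (j.*2 < n)%N) 2 ^- (n - j.*2).

Inductive edge_glue : plane R -> plane R -> Prop :=
| glue_horizontal (x : R) of - 2^-1 < x < 0 :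
    edge_glue (x, 2^-1) (x + 1, 2^-1)
| glue_C' (n : nat) (x : R) of (1 <= n)%N &
    1 - 2 ^- n.-1 < x < 1 - 3 * 2 ^- n.+1 :
    edge_glue (x, 1) (x - 2^-1 + 2 ^- n.+1, 0)
| glue_C'' (n : nat) (x : R) of (1 <= n)%N &
    1 - 3 * 2 ^- n.+1 < x < 1 - 2 ^- n :
    edge_glue (x, 1) (x - 2^-1 - 2 ^- n.+1, 0)
| glue_A (n : nat) (y : R) of (1 <= n)%N &
    1 - 2 ^- n < y < 1 - 2 ^- n.+1 :
    edge_glue (1, y) (if odd n then - 2^-1 else 0, y - s_shift n)
| glue_B (n : nat) (y : R) of (1 <= n)%N &
    2 ^- n.+1 < y < 2 ^- n :
    edge_glue (2^-1, y) (if odd n then 0 else - 2^-1, y + s_shift n).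

(* D without the boundary points lying on no open edge. *)
Definition Dstar : set (plane R) :=
  interior D `|` [set p | exists q, edge_glue p q \/ edge_glue q p].

Definition glue_eq : rel Dstar := fun p q =>
  `[< clos_refl_sym_trans _
    (fun p' q' : Dstar => edge_glue (val p') (val q')) p q >].

Lemma glue_eq_refl : reflexive glue_eq.
Proof. by move=> p; apply/asboolP; exact: rst_refl. Qed.
Lemma glue_eq_sym : symmetric glue_eq.
Proof.
by move=> p q; apply/idP/idP => /asboolP h; apply/asboolP; exact: rst_sym.
Qed.
Lemma glue_eq_trans : transitive glue_eq.
Proof.
move=> q p r /asboolP pq /asboolP qr; apply/asboolP.
exact: rst_trans pq qr.
Qed.

Canonical glue_equiv := EquivRel glue_eq glue_eq_refl glue_eq_sym glue_eq_trans.

Definition Xinf : topologicalType := quotient_topology {eq_quot glue_equiv}.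

Definition Xproj (p : Dstar) : Xinf := \pi_{eq_quot glue_equiv} p.

(* The charts z with dz = omega_inf: since omega_inf is induced by the form   *)
(* dz of the plane, these are the charts which, read on D, are locally the    *)
(* identity up to an additive constant.                                       *)
Definition canonical_charts : set (chart R Xinf) :=
  [set c | is_planar_chart c /\
    forall p : Dstar, c.1 (Xproj p) ->
      exists k : plane R, \forall q \near p, c.2 (Xproj q) = val q + k].

(* Any two canonical charts differ locally by a translation, hence            *)
(* membership in affine_homeos canonical_charts does not depend on the charts *)
(* chosen at each point.                                                      *)
Lemma canonical_charts_translation (c d : chart R Xinf) (p : Xinf) :
  canonical_charts c -> canonical_charts d -> c.1 p -> d.1 p ->
  exists k : plane R, \forall q \near p, d.2 q = c.2 q + k.
Proof.
move=> [[oc _ _ _] cP] [[od _ _ _] dP] cp dp.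
exists (d.2 p - c.2 p).
pose S := [set q : Xinf | [/\ c.1 q, d.1 q & d.2 q = c.2 q + (d.2 p - c.2 p)]].
have oS : open S.
  rewrite /open /= /quotient_open openE => x [cx dx dcx] /=.
  have [k1 hk1] := cP x cx; have [k2 hk2] := dP x dx.
  have e : d.2 p - c.2 p = k2 - k1.
    move: dcx (nbhs_singleton hk1) (nbhs_singleton hk2); rewrite /Xproj => -> -> h.
    apply: (addrI (val x + k1)); rewrite h.
    by rewrite -addrA [k1 + _]addrC subrK.
  have nc : \forall q \near x, c.1 (Xproj q).
    exact: (open_nbhs_nbhs (conj (oc : open (Xproj @^-1` c.1)) cx)).
  have nd : \forall q \near x, d.1 (Xproj q).
    exact: (open_nbhs_nbhs (conj (od : open (Xproj @^-1` d.1)) dx)).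
  rewrite /interior /=; near=> q; split.
  - by near: q.
  - by near: q.
  - rewrite e (_ : d.2 _ = val q + k2); last by near: q.
    rewrite (_ : c.2 _ = val q + k1); last by near: q.
    by rewrite -addrA [k1 + _]addrC subrK.
have Sp : S p by split=> //; rewrite [RHS]addrC subrK.
by apply: filterS (open_nbhs_nbhs (conj oS Sp)) => q [].
Unshelve. all: by end_near.
Qed.

Definition Aff : set (homeo Xinf) := affine_homeos canonical_charts.

(* The requirement val q = f (val p) with q in Dstar includes that f maps the  *)
(* points of Dstar in A to points that have not been removed.                 *)
Definition induced_on (phi : Xinf -> Xinf) (A : set (plane R))
    (f : plane R -> plane R) : Prop :=
  forall p : Dstar, A (val p) ->
    exists2 q : Dstar, val q = f (val p) & phi (Xproj p) = Xproj q.

(* In is_rho and is_psi the regions cover D, so these determine the map.      *)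
Definition is_rho (phi : Xinf -> Xinf) : Prop :=
  induced_on phi (box 0 1 2^-1 1) (fun p => (p.1 - 2^-1, 1 - p.2)) /\
  induced_on phi (box (- 2^-1) 2^-1 0 2^-1) (fun p => (p.1 + 2^-1, 1 - p.2)).

Definition is_psi (phi : Xinf -> Xinf) : Prop :=
  [/\ induced_on phi (box 0 2^-1 0 1) (fun p => (2 * p.1 - 2^-1, p.2 / 2)),
      induced_on phi (box (- 2^-1) 0 0 2^-1)
        (fun p => (2 * p.1 + 1, p.2 / 2 + 2^-1)) &
      induced_on phi (box 2^-1 1 2^-1 1)
        (fun p => (2 * p.1 - 1, p.2 / 2 + 2^-1))].

End Surface.

Arguments Aff R : clear implicits.

(* Main.v *)
(* The removed points (0, 2/3 + (1/3)(-1/2)^k) accumulate at q0 = (0, 2/3), an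
   end of the surface that the upper square meets in a half disc; rho maps
   (-1/2, 1/3) to q0, and sigma = rho o psi fixes q0 with matrix diag(2, -1/2).

   Let phi be affine with matrix A.  It sends a geodesic leaving q0 into the
   upper square, run backwards, to a geodesic which dies at a removed point, and
   the surface near that point must again miss points arbitrarily close to it in
   the direction of the image of the vertical.  Choosing the geodesic so that its
   image is vertical, and tracing where vertical geodesics of D die, excludes
   A.2.1 <> 0 (the columns of A being A.1 and A.2); choosing it so that its image
   is horizontal shows that phi or rho o phi fixes q0, with matrix columns (a, c),
   (0, d) and a > 0.

   Such a phi permutes the germ of removed points at q0, so d is a power of -1/2,
   and multiplying phi by a power of sigma gives d = 1.  Conjugation by sigma
   multiplies the shear c by -1/4, so it may be assumed small and of the sign
   that contradicts the removed point (1/4, 1); hence c = 0, then a = 1 and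
   phi = 1.  Thus the affine group is generated by psi and rho, which commute;
   rho has order 2 and psi has infinite order because its matrix is diag(2, 1/2). *)

(* No end of the surface is ever constructed. Whether a point of the plane has been removed is
   transported by continuity alone: when straight segments correspond under a homeomorphism and the
   starting point of one is on the surface, so is that of the other ([limit_Dstar], applied to the
   map or to its inverse).

   At [q0] removed points accumulate from above and from below, so of the two vertical directions
   one can always choose the one whose image falls into a prescribed half plane. This absorbs all
   questions of sign and orientation.

   The case analysis stays finite because rays of length at most 1/8 suffice. Beyond a glued edge a
   perpendicular geodesic has at least that much room, so it cannot die after crossing the edge; it
   has to die before, at a removed point that is seen directly in [D]. Next to each such point the
   surface is regular on a suitable side. The only exceptions are the horizontal geodesics running
   left into [q0] and (-1/2, 1/3), and these produce the local normal form [fixes_q0] on which the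
   rest of the proof computes. *)
Require Import Defs.
From Stdlib Require Import Relation_Operators.
From mathcomp Require Import all_boot all_order all_algebra ring lra zify.
From mathcomp Require Import all_classical all_reals all_analysis.
Import Order.TTheory GRing.Theory Num.Theory.
Import numFieldNormedType.Exports.
Set Implicit Arguments.
Unset Strict Implicit.
Unset Printing Implicit Defensive.
Local Open Scope classical_set_scope.
Local Open Scope ring_scope.

(** * Powers of one half *)

(* [lra] takes time quadratic in the number of hypotheses of the context, but
   linear in the number of premises of the goal. *)
Ltac lin :=
  repeat match goal with
  | H : is_true (_ <= _)%R |- _ => revert H
  | H : is_true (_ < _)%R |- _ => revert H
  | H : is_true (_ && _) |- _ => revert H
  | H : _ = _ :> Real.sort _ |- _ => revert H
  end; lra.

(* These let a single call of [lin] discharge several premises. *)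
Lemma uncurry2 (A B C : Prop) : (A -> B -> C) -> A /\ B -> C.
Proof. by move=> f []. Qed.

Lemma uncurry4 (A B C D E : Prop) : (A -> B -> C -> D -> E) -> A /\ B /\ C /\ D -> E.
Proof. by move=> f [? [? []]]; exact: f. Qed.

Section Dyadic.
Variable R : realType.
Implicit Types (e : R) (n : nat).

(** The exponent is hidden because the arguments mostly need only its parity and inequalities
    between the values, which linear arithmetic settles. *)
Definition dyadic (b : bool) e := exists2 n, odd n = b /\ (0 < n)%N & e = 2 ^- n.

Lemma exprNS n : 2 ^- n.+1 = 2 ^- n / 2 :> R.
Proof. by rewrite exprSr invfM. Qed.

Lemma dyadic_gt0 b e : dyadic b e -> 0 < e.
Proof. by move=> [n _ ->]; rewrite invr_gt0 exprn_gt0. Qed.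

Lemma dyadic_le b e : dyadic b e -> e <= 2^-1.
Proof.
move=> [n [_ n0] ->]; case: n n0 => // n _; rewrite exprNS.
have : 2 ^- n <= 1 :> R by rewrite invf_le1 ?exprn_gt0// exprn_ege1// ler1n.
lin.
Qed.

Lemma dyadicT : dyadic true (2^-1 : R).
Proof. by exists 1%N; rewrite ?expr1. Qed.

Lemma dyadic_half b e : dyadic b e -> dyadic (~~ b) (e / 2).
Proof. by move=> [n [<- n0] ->]; exists n.+1; rewrite ?exprNS. Qed.

Lemma dyadic_double b e : dyadic b e -> (b /\ e = 2^-1) \/ dyadic (~~ b) (2 * e).
Proof.
move=> [n [<-]]; case: n => // -[|n] _ ->; first by left; rewrite expr1.
right; exists n.+1; first by split=> //=; rewrite negbK.
by rewrite (exprNS n.+1); lin.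
Qed.

Lemma dyadicF_double e : dyadic false e -> dyadic true (2 * e).
Proof. by move=> /dyadic_double[[]|]. Qed.

Lemma dyadicF_le e : dyadic false e -> e <= 4^-1.
Proof. by move=> /dyadicF_double/dyadic_le; lin. Qed.

Lemma exprN_half_le n m : (n < m)%N -> 2 * 2 ^- m <= 2 ^- n :> R.
Proof.
move=> nm; have -> : 2 * 2 ^- m = 2 ^- m.-1 :> R.
  by case: m nm => // m _; rewrite exprNS/=; lin.
rewrite lef_pV2 ?posrE ?exprn_gt0// ler_weXn2l ?ler1n//; lia.
Qed.

(** Distinct powers of two differ by a factor of at least two. *)
Lemma dyadic_eq b b' e e' : dyadic b e -> dyadic b' e' ->
  e < 2 * e' -> e' < 2 * e -> e = e' /\ b = b'.
Proof.
move=> [n [<- _] ->] [m [<- _] ->].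
by case: (ltngtP n m) => [/exprN_half_le|/exprN_half_le|->//]; lin.
Qed.

(** Within one parity class ratios are powers of four. If the ratio were near two, halving the
    larger value would give an equality between values of opposite parities. *)
Lemma dyadic_eq4 b e e' : dyadic b e -> dyadic b e' ->
  e < 4 * e' -> e' < 4 * e -> e = e'.
Proof.
move=> de de' ee' e'e.
have [?|?] := ltP e (2 * e').
  have [?|?] := ltP e' (2 * e); first by have [] := dyadic_eq de de'.
  have d2 := dyadic_half de'.
  by have [] := dyadic_eq d2 de; try lin; case: (b).
have d2 := dyadic_half de.
by have [] := dyadic_eq d2 de'; try lin; case: (b).
Qed.

(** The endpoint [e / 2] is kept apart because on the sides of [D] it marks a removed point between
    two consecutive edges. *)
Lemma dyadic_bracket t : 0 < t -> t < 2^-1 ->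
  exists b e, dyadic b e /\ (e / 2 < t < e \/ t = e / 2).
Proof.
move=> t0 t1.
have [n nt] : exists n, 2 ^- n <= t.
  have [n /ltW tn] := ltr_add_invr (y := 0) (x := t) t0.
  exists n.+1; move: tn; rewrite add0r; apply: le_trans.
  rewrite lef_pV2 ?posrE ?exprn_gt0// -natrX ler_nat.
  exact/ltnW/ltn_expl.
(* The least [m] with [2 ^- m <= t] is at least 2 because [t < 2^-1], so [m - 1] is a positive
   exponent for the upper bound. *)
case: (ex_minnP (ex_intro (fun n => 2 ^- n <= t) n nt)) => m mt min.
case: m mt min => [|[|m]] mt min; move: mt; rewrite ?expr0 ?expr1 ?invr1; try lin.
move=> mt; have tm : t < 2 ^- m.+1.
  by rewrite ltNge; apply/negP => /min; rewrite ltnn.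
exists (odd m.+1), (2 ^- m.+1); split; first by exists m.+1.
rewrite exprNS in mt; move: mt; rewrite le_eqVlt => /orP[/eqP|]; lin.
Qed.

End Dyadic.

(** * The glued edges *)

(** Adds the bounds of each dyadic value; an upper bound already in the context marks the value as
    done. *)
Ltac dyb := repeat match goal with
  | H : dyadic false ?e |- _ =>
    lazymatch goal with
    | _ : is_true (e <= 4^-1) |- _ => fail
    | _ => pose proof (dyadicF_le H); pose proof (dyadic_gt0 H)
    end
  | H : dyadic _ ?e |- _ =>
    lazymatch goal with
    | _ : is_true (e <= 2^-1) |- _ => fail
    | _ : is_true (e <= 4^-1) |- _ => fail
    | _ => pose proof (dyadic_le H); pose proof (dyadic_gt0 H)
    end
  end.

Section Edges.
Variable R : realType.
Implicit Types (e : R) (p q w : plane R).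

Lemma s_shiftSS n : s_shift R n.+2 = 2 ^- n.+2 + s_shift R n.
Proof.
rewrite /s_shift big_mkcond/= big_nat_recl// subn0; congr (_ + _).
rewrite big_nat_recr//= ltnS doubleS !ltnS.
have -> : (n.*2 < n)%N = false by apply/negP; lia.
by rewrite addr0 [RHS]big_mkcond/=; apply: eq_bigr => i _; rewrite doubleS !ltnS !subSS.
Qed.

(** A geometric sum of ratio 1/4. Its limits, 2/3 for odd and 1/3 for even [n], are the origin of
    the two special points: the edges [A_n] shrink to (1, 1) and the edges [B_n] to (1/2, 0), so
    their partners accumulate at (0, 2/3) and (-1/2, 1/3). *)
Lemma s_shiftE n :
  s_shift R n = if odd n then (2 - 2 ^- n) / 3 else (1 - 2 ^- n) / 3.
Proof.
suff : s_shift R n = (if odd n then (2 - 2 ^- n) / 3 else (1 - 2 ^- n) / 3) /\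
    s_shift R n.+1 = (if odd n.+1 then (2 - 2 ^- n.+1) / 3 else (1 - 2 ^- n.+1) / 3).
  by case.
elim: n => [|n [IH1 IH2]].
  rewrite /s_shift big_geq// big_mkcond big_nat1/= subn0 expr0 expr1 invr1.
  by split; lin.
split=> //; rewrite s_shiftSS IH1 /= negbK !exprNS.
by case: (odd n); lin.
Qed.

(* [e] stands for [2 ^- n], and [dyadic b e] records the parity [b] of [n]. *)
Inductive side p q : Prop :=
| side_H of - 2^-1 < p.1 < 0 & p.2 = 2^-1 & q.1 = p.1 + 1 & q.2 = 2^-1
| side_C' b e of dyadic b e & 1 - 2 * e < p.1 < 1 - 3 / 2 * e & p.2 = 1 &
    q.1 = p.1 - 2^-1 + e / 2 & q.2 = 0
| side_C'' b e of dyadic b e & 1 - 3 / 2 * e < p.1 < 1 - e & p.2 = 1 &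
    q.1 = p.1 - 2^-1 - e / 2 & q.2 = 0
| side_Ao e of dyadic true e & p.1 = 1 & 1 - e < p.2 < 1 - e / 2 &
    q.1 = - 2^-1 & q.2 = p.2 - (2 - e) / 3
| side_Ae e of dyadic false e & p.1 = 1 & 1 - e < p.2 < 1 - e / 2 &
    q.1 = 0 & q.2 = p.2 - (1 - e) / 3
| side_Bo e of dyadic true e & p.1 = 2^-1 & e / 2 < p.2 < e &
    q.1 = 0 & q.2 = p.2 + (2 - e) / 3
| side_Be e of dyadic false e & p.1 = 2^-1 & e / 2 < p.2 < e &
    q.1 = - 2^-1 & q.2 = p.2 + (1 - e) / 3.

Lemma edge_glueP p q : edge_glue p q <-> side p q.
Proof.
split.
- case=> [x ?|[//|n] x _ nx|[//|n] x _ nx|n y n0 ny|n y n0 ny].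
  + exact: side_H.
  + apply: (@side_C' _ _ (odd n.+1) (2 ^- n.+1)) => //=; first by exists n.+1.
      by move: nx; rewrite !exprNS/=; lin.
    by rewrite !exprNS; lin.
  + apply: (@side_C'' _ _ (odd n.+1) (2 ^- n.+1)) => //=; first by exists n.+1.
      by move: nx; rewrite !exprNS/=; lin.
    by rewrite !exprNS; lin.
  + rewrite s_shiftE exprNS in ny *; have dn : dyadic (odd n) (2 ^- n : R) by exists n.
    by case: ifP dn => on dn; [apply: side_Ao dn _ _ _ _|apply: side_Ae dn _ _ _ _] => /=; lin.
  + rewrite s_shiftE exprNS in ny *; have dn : dyadic (odd n) (2 ^- n : R) by exists n.
    by case: ifP dn => on dn; [apply: side_Bo dn _ _ _ _|apply: side_Be dn _ _ _ _] => /=; lin.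
- case=> [px e1 e2 e3|b e [[|n] [_ n0] ->] px e1 e2 e3|
   b e [[|n] [_ n0] ->] px e1 e2 e3|e [n [on n0] ->] e1 py e2 e3|
   e [n [on n0] ->] e1 py e2 e3|e [n [on n0] ->] e1 py e2 e3|
   e [n [on n0] ->] e1 py e2 e3] //; rewrite [p]surjective_pairing [q]surjective_pairing e1 e2 e3.
  + exact: glue_horizontal.
  + rewrite (_ : _ + _ / 2 = p.1 - 2^-1 + 2 ^- n.+2); last by rewrite (exprNS _ n.+1).
    by apply: glue_C' => //; move: px; rewrite !exprNS/=; lin.
  + rewrite (_ : _ - _ / 2 = p.1 - 2^-1 - 2 ^- n.+2); last by rewrite (exprNS _ n.+1).
    by apply: glue_C'' => //; move: px; rewrite !exprNS/=; lin.
  + by have := @glue_A R n p.2 n0; rewrite s_shiftE on !exprNS; exact.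
  + by have := @glue_A R n p.2 n0; rewrite s_shiftE on !exprNS; exact.
  + by have := @glue_B R n p.2 n0; rewrite s_shiftE on !exprNS; apply; lin.
  + by have := @glue_B R n p.2 n0; rewrite s_shiftE on !exprNS; apply; lin.
Qed.

(** The interior of [D] as a union of three convex pieces; the third contributes the open segment
    along which the two squares meet. *)
Definition inD p := [\/ 0 < p.1 < 1 /\ 2^-1 < p.2 < 1,
  - 2^-1 < p.1 < 2^-1 /\ 0 < p.2 < 2^-1 | 0 < p.1 < 2^-1 /\ 0 < p.2 < 1].

Lemma side_left p q : side p q ->
  [\/ - 2^-1 < p.1 < 0 /\ p.2 = 2^-1, 0 < p.1 < 1 /\ p.2 = 1,
      p.1 = 1 /\ 2^-1 < p.2 < 1 | p.1 = 2^-1 /\ 0 < p.2 < 2^-1].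
Proof.
by case; intros; dyb; [apply: Or41|apply: Or42|apply: Or42|apply: Or43|apply: Or43
  |apply: Or44|apply: Or44]; split=> //; clear dependent q; lin.
Qed.

Lemma side_right p q : side p q ->
  [\/ 2^-1 < q.1 < 1 /\ q.2 = 2^-1, - 2^-1 < q.1 < 2^-1 /\ q.2 = 0,
      q.1 = - 2^-1 /\ 0 < q.2 < 2^-1 | q.1 = 0 /\ 2^-1 < q.2 < 1].
Proof.
by case; intros; dyb; [apply: Or41|apply: Or42|apply: Or42|apply: Or43|apply: Or44
  |apply: Or44|apply: Or43]; split=> //; lin.
Qed.

Lemma side_D p q : side p q -> D p /\ D q.
Proof.
by rewrite /D /box /= => s; split; [case: (side_left s)|case: (side_right s)];
  clear s => -[? ?]; by [left; split; lin|right; split; lin].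
Qed.

Lemma side_inDl p q : side p q -> ~ inD p.
Proof. by move=> /side_left s [] [] *; case: s => -[]; lin. Qed.

Lemma side_inDr p q : side p q -> ~ inD q.
Proof. by move=> /side_right s [] [] *; case: s => -[]; lin. Qed.

Lemma inD_D p : inD p -> D p.
Proof.
rewrite /D /box /=; case; intros [H1 H2];
  try by [left; split; lin|right; split; lin].
by have [?|?] := leP p.2 2^-1; [right|left]; split; lin.
Qed.

(** Identifies the parameters of two edges through a common point. On the left sides the edges of
    one parity fill intervals of ratio 4, which is why [dyadic_eq4] is tried as well. *)
Ltac dyu tac := match goal with H : dyadic _ ?e, H1 : dyadic _ ?e1 |- _ =>
  first [ constr_eq e e1; fail 1
  | have [? ?] := uncurry2 (dyadic_eq H H1) ltac:(tac); try discriminate; subst e1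
  | have ? := uncurry2 (dyadic_eq4 H H1) ltac:(tac); subst e1] end.

Lemma side_fun p q q' : side p q -> side p q' -> q = q'.
Proof.
move=> s s'; rewrite [q]surjective_pairing [q']surjective_pairing.
destruct s; (destruct s'; dyb; try (exfalso; clear dependent q; clear dependent q'; lin)).
all: try dyu ltac:(clear dependent q; clear dependent q'; lin).
all: apply/pair_equal_spec; lin.
Qed.

Lemma side_inj p p' q : side p q -> side p' q -> p = p'.
Proof.
move=> s s'; rewrite [p]surjective_pairing [p']surjective_pairing.
destruct s; dyb; (destruct s'; dyb; try (exfalso; lin)).
all: try dyu lin.
all: apply/pair_equal_spec; lin.
Qed.

(** Left members lie on upper or right sides of the two squares, right members on lower or left
    ones. Hence gluing never chains, and with [side_fun] and [side_inj] a class has at most two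
    points. *)
Lemma side_chain p q r : side p q -> ~ side q r.
Proof. by move=> /side_right s /side_left; case: s => -[? ?] [] []; lin. Qed.

End Edges.

(** * Neighbourhoods in D of interior points and of glued pairs *)

Section Local.
Variable R : realType.
Implicit Types (e : R) (p q w : plane R).

Definition square (r : R) : set (plane R) := [set w | - r < w.1 < r /\ - r < w.2 < r].

Lemma nbhs_planeP p (A : set (plane R)) :
  nbhs p A <-> exists2 r, 0 < r & forall w, square r w -> A (p + w).
Proof.
split.
  move=> /nbhs_ballP[r /= r0 rA]; exists r => // w [w1 w2]; apply: rA.
  split; rewrite /ball/= /ball_/= opprD addNKr normrN ltr_norml//.
move=> [r r0 rA]; apply/nbhs_ballP; exists r => //= q [].
rewrite /ball/= /ball_/= distrC => q1; rewrite distrC => q2.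
rewrite -[q](subrK p) addrC; apply: rA.
by rewrite /square/= -!ltr_norml; split.
Qed.

(** The cap 1/8 bounds the displacement perpendicular to an edge, so that it does not reach the
    opposite side of [D]. *)
Lemma interval_room (l t u : R) : l < t < u ->
  exists2 r, 0 < r <= 8^-1 & forall s, - r < s < r -> l < t + s < u.
Proof.
move=> ltu; exists (Num.min (Num.min (t - l) (u - t)) 8^-1).
  by rewrite ge_min lexx orbT !lt_min; lin.
by move=> s; rewrite ltrNl !lt_min; lin.
Qed.

(* Along a glued pair the domain lies on the negative side of [p] and on the
   positive side of [q], so the two half neighbourhoods match up. *)
Lemma side_local p q : side p q ->
  exists (pr : plane R -> R) r, [/\ pr = fst \/ pr = snd, 0 < r & forall w, square r w ->
    [/\ pr w < 0 -> inD (p + w) /\ ~ D (q + w),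
        0 < pr w -> inD (q + w) /\ ~ D (p + w) &
        pr w = 0 -> side (p + w) (q + w)]].
Proof.
rewrite /D /box.
case=> [px e1 e2 e3|b e d px e1 e2 e3|b e d px e1 e2 e3|e d e1 py e2 e3|
        e d e1 py e2 e3|e d e1 py e2 e3|e d e1 py e2 e3];
  [have [r r0 rP] := interval_room px; have {}rP w (wr : square r w) := rP _ wr.1; exists snd, r|
   have [r r0 rP] := interval_room px; have {}rP w (wr : square r w) := rP _ wr.1; exists snd, r|
   have [r r0 rP] := interval_room px; have {}rP w (wr : square r w) := rP _ wr.1; exists snd, r|
   have [r r0 rP] := interval_room py; have {}rP w (wr : square r w) := rP _ wr.2; exists fst, r|
   have [r r0 rP] := interval_room py; have {}rP w (wr : square r w) := rP _ wr.2; exists fst, r|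
   have [r r0 rP] := interval_room py; have {}rP w (wr : square r w) := rP _ wr.2; exists fst, r|
   have [r r0 rP] := interval_room py; have {}rP w (wr : square r w) := rP _ wr.2; exists fst, r];
  (split; [by [left|right]|lin|move=> w wr]); have := rP w wr; case: wr; dyb => w1 w2 {}rP;
  split=> sw /=.
all: try (split; [|clear dependent r; try clear px; try clear py; try clear dependent q;
  by case=> -[/= ? ?]; lin]).
- by apply: Or32 => /=; lin.
- by apply: Or31 => /=; lin.
- by apply: (uncurry4 (@side_H _ _ _)) => /=; lin.
- by apply: Or31 => /=; lin.
- by apply: Or32 => /=; lin.
- by apply: (uncurry4 (side_C' d)) => /=; lin.
- by apply: Or31 => /=; lin.
- by apply: Or32 => /=; lin.
- by apply: (uncurry4 (side_C'' d)) => /=; lin.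
- by apply: Or31 => /=; lin.
- by apply: Or32 => /=; lin.
- by apply: (uncurry4 (side_Ao d)) => /=; lin.
- by apply: Or31 => /=; lin.
- by apply: Or31 => /=; lin.
- by apply: (uncurry4 (side_Ae d)) => /=; lin.
- by apply: Or32 => /=; lin.
- by apply: Or31 => /=; lin.
- by apply: (uncurry4 (side_Bo d)) => /=; lin.
- by apply: Or32 => /=; lin.
- by apply: Or32 => /=; lin.
- by apply: (uncurry4 (side_Be d)) => /=; lin.
Qed.

Lemma inD_open p : inD p -> exists2 r, 0 < r & forall w, square r w -> inD (p + w).
Proof.
case=> -[/interval_room[r r0 rP] /interval_room[s s0 sP]].
all: exists (Num.min r s); rewrite ?lt_min; first lin.
all: have [mr ms] : Num.min r s <= r /\ Num.min r s <= s by rewrite !ge_min !lexx orbT.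
all: move=> w [w1 w2].
all: have {}rP : _ := rP w.1 ltac:(lin).
all: have {}sP : _ := sP w.2 ltac:(lin).
- by apply: Or31.
- by apply: Or32.
- by apply: Or33.
Qed.

Lemma interiorD p : interior (@D R) p <-> inD p.
Proof.
split; last first.
  by move=> /inD_open[r r0 rP]; apply/nbhs_planeP; exists r => // w /rP/inD_D.
move=> /nbhs_planeP[r r0 rP].
have [s s0 sr] : exists2 s, 0 < s <= 8^-1 & s < r.
  exists (Num.min (r / 2) 8^-1); first by rewrite ge_min lexx orbT !lt_min; lin.
  by rewrite gt_min; lin.
have Dlow q : D q -> q.2 < 2^-1 -> - 2^-1 <= q.1 <= 2^-1 /\ 0 <= q.2.
  by move=> [][] /= *; lin.
have Dup q : D q -> 2^-1 < q.2 -> 0 <= q.1 <= 1 /\ q.2 <= 1.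
  by move=> [][] /= *; lin.
(* The four corners of a small square are enough: the two lower ones for a point in the lower half,
   the two upper ones in the upper half, and one antidiagonal pair on the line [p.2 = 2^-1]. *)
have {rP} [Q1 Q2 Q3 Q4] : [/\ D (p + (s, s)), D (p + (- s, s)), D (p + (s, - s)) &
    D (p + (- s, - s))].
  by split; apply: rP; split => /=; lin.
have [p2|p2|p2] := ltgtP p.2 2^-1.
- apply: Or32; have /= := Dlow _ Q3; have /= := Dlow _ Q4; lin.
- apply: Or31; have /= := Dup _ Q1; have /= := Dup _ Q2; lin.
- apply: Or33; have /= := Dlow _ Q3; have /= := Dup _ Q2; lin.
Qed.

Lemma DstarP p : Dstar p <-> [\/ inD p, exists q, side p q | exists q, side q p].
Proof.
rewrite /Dstar/= interiorD; split.
  by move=> [?|[q [/edge_glueP|/edge_glueP]]];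
    [apply: Or31|move=> ?; apply: Or32; exists q|move=> ?; apply: Or33; exists q].
by case=> [?|[q /edge_glueP]|[q /edge_glueP]]; [left|right; exists q; left|right; exists q; right].
Qed.

Lemma Dstar_D p : Dstar p -> D p.
Proof. by move=> /DstarP[/inD_D//|[q /side_D[]]|[q /side_D[]]]. Qed.

Lemma inD_Dstar p : inD p -> Dstar p. Proof. by move=> ?; apply/DstarP/Or31. Qed.
Lemma sidel_Dstar p q : side p q -> Dstar p.
Proof. by move=> ?; apply/DstarP/Or32; exists q. Qed.
Lemma sider_Dstar p q : side p q -> Dstar q.
Proof. by move=> ?; apply/DstarP/Or33; exists p. Qed.

(** As gluing does not chain, this relation is already transitive; it is the generated equivalence
    ([Xp_eqP]). *)
Definition twin p q := [\/ p = q, side p q | side q p].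

Lemma twin_sym p q : twin p q -> twin q p.
Proof. by case=> [->|?|?]; [apply: Or31|apply: Or33|apply: Or32]. Qed.

Lemma twin_trans p q r : twin p q -> twin q r -> twin p r.
Proof.
case=> [->//|pq|qp] [<-|qr|rq]; try by [apply: Or32|apply: Or33].
- by case: (side_chain pq qr).
- by rewrite (side_inj pq rq); apply: Or31.
- by rewrite (side_fun qp qr); apply: Or31.
- by case: (side_chain rq qp).
Qed.

End Local.

(** * The topology of the surface *)

Section Topology.
Variable R : realType.
Notation X := (Xinf R).
Implicit Types (e r s : R) (p q w v z : plane R).

Lemma pt0_subproof : (4^-1, 4^-1) \in @Dstar R.
Proof. by apply/mem_set/inD_Dstar/Or32 => /=; lin. Qed.

Definition pt0 : @Dstar R := Sub (4^-1, 4^-1) pt0_subproof.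

(** Makes the projection total on the plane: removed points are sent to the arbitrary point [pt0],
    so statements about [Xp p] come with [Dstar p]. *)
Definition Dpt p : @Dstar R := insubd pt0 p.

Definition Xp p : X := Xproj (Dpt p).

Lemma XpE (p : @Dstar R) : Xproj p = Xp (val p).
Proof. by rewrite /Xp /Dpt valKd. Qed.

Lemma Dstar_val (p : @Dstar R) : Dstar (val p).
Proof. exact: set_mem (valP p). Qed.

Lemma val_Dpt p : Dstar p -> val (Dpt p) = p.
Proof. by move=> /mem_set Dp; rewrite /Dpt insubdK. Qed.

Lemma Xp_surj (x : X) : exists2 p, Dstar p & x = Xp p.
Proof.
exists (val (repr x)); first exact: Dstar_val.
by rewrite -XpE /Xproj reprK.
Qed.

Lemma Xp_eqP p q : Dstar p -> Dstar q -> Xp p = Xp q <-> twin p q.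
Proof.
move=> Dp Dq; rewrite /Xp /Xproj.
have pE := val_Dpt Dp; have qE := val_Dpt Dq.
split.
  move=> /eqmodP/asboolP; rewrite -{2}pE -{2}qE.
  elim=> [a b /edge_glueP|a|a b _|a b c _ + _]; first exact: Or32.
  - exact: Or31.
  - exact: twin_sym.
  - exact: twin_trans.
move=> pq; apply/eqmodP/asboolP; case: pq => [->|s|s]; first exact: rst_refl.
- by apply: rst_step; rewrite pE qE; exact/edge_glueP.
- by apply: rst_sym; apply: rst_step; rewrite pE qE; exact/edge_glueP.
Qed.

Lemma nbhs_DstarP (p : @Dstar R) (A : set (@Dstar R)) :
  nbhs p A <-> exists2 r, 0 < r & forall q : @Dstar R, square r (val q - val p) -> A q.
Proof.
split.
  rewrite nbhsE => -[B [[C oC <-] /= Cp] BA].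
  have /nbhs_planeP[r r0 rC] : nbhs (val p) C by exact: open_nbhs_nbhs.
  exists r => // q /rC; rewrite addrC subrK => Cq; exact: BA.
move=> [r r0 rA].
have : nbhs (val p) [set q | square r (q - val p)].
  by apply/nbhs_planeP; exists r => // w; rewrite /= addrC addKr.
move=> /(@initial_continuous _ _ (set_val : @Dstar R -> plane R) p) nP.
have : nbhs p [set q : @Dstar R | square r (val q - val p)] by exact: nP.
by apply: filterS => q /=; exact: rA.
Qed.

Lemma near_Dstar p (P : plane R -> Prop) : Dstar p ->
  nbhs (Dpt p) [set q | P (val q)] <->
  exists2 r, 0 < r & forall w, square r w -> Dstar (p + w) -> P (p + w).
Proof.
move=> Dp; split.
  move=> /nbhs_DstarP[r r0 rP]; exists r => // w wr Dw.
  by have /= := rP (Dpt (p + w)); rewrite !val_Dpt// [X in square r X]addrC addKr; exact.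
move=> [r r0 rP]; apply/nbhs_DstarP; exists r => // q; rewrite val_Dpt// => qr.
have := rP _ qr; rewrite addrC subrK; apply; exact: Dstar_val.
Qed.

Lemma open_XP (A : set X) : open A <-> forall p, Dstar p -> A (Xp p) ->
  exists2 r, 0 < r & forall w, square r w -> Dstar (p + w) -> A (Xp (p + w)).
Proof.
rewrite /open/= /quotient_open openE; split=> H.
  move=> p Dp Ap; apply/(near_Dstar (fun q => A (Xp q)) Dp).
  have /(_ Ap) := H (Dpt p); rewrite /interior.
  by apply: filterS => q Aq; change (A (Xp (val q))); rewrite -XpE.
move=> p Ap; have Ap' : A (Xp (val p)) by rewrite -XpE; exact: Ap.
have /(near_Dstar (fun q => A (Xp q)) (Dstar_val p)) := H _ (Dstar_val p) Ap'.
rewrite /Dpt valKd /interior; apply: filterS => q.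
by rewrite /= -[Xp _]XpE.
Qed.

Lemma nbhs_Xp p (A : set X) : Dstar p -> nbhs (Xp p) A ->
  exists2 r, 0 < r & forall w, square r w -> Dstar (p + w) -> A (Xp (p + w)).
Proof.
move=> Dp; rewrite nbhsE => -[B [/open_XP oB Bp] BA].
by have [r r0 rB] := oB _ Dp Bp; exists r => // w wr /(rB _ wr)/BA.
Qed.

(** Glued points are at least 1/2 apart, so their squares of radius at most 1/8 are disjoint. *)
Lemma side_far p q : side p q ->
  [\/ p.1 + 2^-1 <= q.1, q.1 + 2^-1 <= p.1 | q.2 + 2^-1 <= p.2].
Proof.
case=> *; try by [apply: Or31; lin|apply: Or32; lin|apply: Or33; lin].
Qed.

Lemma twin_inD p q : inD p -> twin p q -> q = p.
Proof. by move=> Dp [//|/side_inDl|/side_inDr]. Qed.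

(** What is needed for the displacements [w] to parametrize a neighbourhood: the point at [w] is
    read as [z + w] or as [z' + w], whichever was not removed, and consistently when both are
    present. The fourth clause gives injectivity; the last one, stability of absence, gives
    continuity. For an interior point [z' = z]. *)
Definition half_local r z z' := forall w, square r w ->
  [/\ Dstar (z + w) \/ Dstar (z' + w),
      forall q, Dstar (z + w) -> twin (z + w) q -> q = z + w \/ q = z' + w,
      Dstar (z + w) -> Dstar (z' + w) -> twin (z + w) (z' + w),
      forall w', square r w' -> z + w = z' + w' -> w = w' &
      ~ Dstar (z + w) -> exists2 s, 0 < s & forall v, square s v -> ~ Dstar (z + w + v)].

Definition local_model r z z' := half_local r z z' /\ half_local r z' z.

Lemma square_le r s w : r <= s -> square r w -> square s w.
Proof. by move=> rs [? ?]; split; lin. Qed.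

Lemma local_model_side p q : side p q -> exists2 r, 0 < r & local_model r p q.
Proof.
move=> s; have [pr [r0 [prE r00 rP]]] := side_local s.
have [r [r_gt0 r8 rr0]] : exists r, [/\ 0 < r, r <= 8^-1 & r <= r0].
  exists (Num.min r0 8^-1); split; rewrite ?ge_min ?lexx ?orbT// lt_min; lin.
have {r00} r0P w : square r w -> _ := fun wr => rP w (square_le rr0 wr).
(* The sign of the normal coordinate [pr] is stable under small displacements; this proves the last
   clause of [half_local]. *)
have pr_open w : square r w -> pr w != 0 -> exists2 s, 0 < s & forall v, square s v ->
    square r (w + v) /\ (0 < pr w -> 0 < pr (w + v)) /\ (pr w < 0 -> pr (w + v) < 0).
  move=> [w1 w2] w0.
  have [s1 s10 sP1] := interval_room w1; have [s2 s20 sP2] := interval_room w2.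
  have [s3 s30 sP3] : exists2 s3, 0 < s3 & forall t, - s3 < t < s3 ->
      (0 < pr w -> 0 < pr w + t) /\ (pr w < 0 -> pr w + t < 0).
    case/lt_total/orP: w0 => w0; [exists (- pr w)|exists (pr w)]; rewrite ?oppr_gt0//.
      by move=> t ?; split=> ?; lin.
    by move=> t ?; split=> ?; lin.
  exists (Num.min (Num.min s1 s2) s3); first by rewrite !lt_min; lin.
  have [ms1 ms2 ms3] : [/\ Num.min (Num.min s1 s2) s3 <= s1, Num.min (Num.min s1 s2) s3 <= s2
     & Num.min (Num.min s1 s2) s3 <= s3] by rewrite !ge_min !lexx !orbT.
  move=> v [v1 v2]; split.
    by split; [apply: sP1|apply: sP2]; lin.
  by case: prE sP3 => -> sP3; apply: sP3 => /=; lin.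
have sep w w' : square r w -> square r w' -> p + w = q + w' -> False.
  move=> [? ?] [? ?] /(f_equal (fun t => (t.1, t.2)))/=[e1 e2].
  by case: (side_far s); lin.
have Dn t : ~ D t -> ~ @Dstar R t by move=> nD /Dstar_D.
exists r => //; split=> w wr; have [neg pos null] := r0P w wr.
- have [prw|prw|prw] := ltgtP (pr w) 0.
  + have [/[dup] iD /inD_Dstar Dp /Dn nq] := neg prw; split=> //.
    * by left.
    * by move=> t _ /(twin_inD iD) ->; left.
    * by move=> w' wr' e; case: (sep _ _ wr wr' e).
  + have [/[dup] iD /inD_Dstar Dq /Dn np] := pos prw; split=> //.
    * by right.
    * by move=> w' wr' e; case: (sep _ _ wr wr' e).
    * move=> _; have [e e0 eP] := pr_open w wr (lt0r_neq0 prw).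
      exists e => // v /eP[wvr [/(_ prw) prwv _]]; rewrite -addrA.
      by have [_ /(_ prwv)[_ nDv] _] := r0P _ wvr; exact: Dn.
  + have sw := null prw; split=> //.
    * by left; exact: sidel_Dstar sw.
    * move=> t _ [->|st|st]; first by left.
        by right; exact: side_fun st sw.
      by case: (side_chain st sw).
    * by move=> *; exact: Or32.
    * by move=> w' wr' e; case: (sep _ _ wr wr' e).
    * by have := sidel_Dstar sw.
- have [prw|prw|prw] := ltgtP (pr w) 0.
  + have [/[dup] iD /inD_Dstar Dp /Dn nq] := neg prw; split=> //.
    * by right.
    * by move=> w' wr' e; case: (sep _ _ wr' wr (esym e)).
    * move=> _; have [e e0 eP] := pr_open w wr (ltr0_neq0 prw).
      exists e => // v /eP[wvr [_ /(_ prw) prwv]]; rewrite -addrA.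
      by have [/(_ prwv)[_ nDv] _ _] := r0P _ wvr; exact: Dn.
  + have [/[dup] iD /inD_Dstar Dq /Dn np] := pos prw; split=> //.
    * by left.
    * by move=> t _ /(twin_inD iD) ->; left.
    * by move=> w' wr' e; case: (sep _ _ wr' wr (esym e)).
  + have sw := null prw; split=> //.
    * by left; exact: sider_Dstar sw.
    * move=> t _ [->|st|st]; first by left.
        by case: (side_chain sw st).
      by right; exact: side_inj st sw.
    * by move=> *; exact: Or33.
    * by move=> w' wr' e; case: (sep _ _ wr' wr (esym e)).
    * by have := sider_Dstar sw.
Qed.

Lemma local_model_exists z : Dstar z ->
  exists z' r, [/\ 0 < r, twin z z' & local_model r z z'].
Proof.
move=> /DstarP[zD|[q zq]|[q qz]].
- have [r r0 rP] := inD_open zD; exists z, r; split=> //; first exact: Or31.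
  suff ? : half_local r z z by [].
  move=> w /rP iD; have Dw := inD_Dstar iD; split=> //; first by left.
  + by move=> q _ /(twin_inD iD) ->; left.
  + by move=> _ _; apply: Or31.
  + by move=> w' _ /addrI.
- by have [r r0 rP] := local_model_side zq; exists q, r; split=> //; exact: Or32.
- have [r r0 [rP rP']] := local_model_side qz; exists q, r; split=> //; exact: Or33.
Qed.

End Topology.

(** * Canonical charts around every point *)

Section Patch.
Variable R : realType.
Notation X := (Xinf R).
Implicit Types (e r s : R) (p q w v z : plane R).

Lemma square_room r w : square r w ->
  exists2 s, 0 < s & forall v, square s v -> square r (w + v).
Proof.
move=> [w1 w2]; have [s s0 sP] := interval_room w1.
have [t t0 tP] := interval_room w2; exists (Num.min s t); first by rewrite lt_min; lin.
have [ms mt] : Num.min s t <= s /\ Num.min s t <= t by rewrite !ge_min !lexx orbT.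
by move=> v [v1 v2]; split; [apply: sP|apply: tP]; lin.
Qed.

Section OnePatch.
Variables (z z' : plane R) (r : R).
Hypothesis r_gt0 : 0 < r.
Hypothesis zz' : local_model r z z'.

(** Inverse of the chart to be built. Where both readings exist they are twins, so preferring the
    first loses nothing ([germ_mapr]). *)
Definition germ_map w : X := if pselect (Dstar (z + w)) then Xp (z + w) else Xp (z' + w).

Lemma germ_mapP w : square r w ->
  exists2 a, Dstar a /\ (a = z + w \/ a = z' + w) & germ_map w = Xp a.
Proof.
move=> wr; rewrite /germ_map; have [cov _ _ _ _] := zz'.1 _ wr.
case: pselect => D1; first by exists (z + w); split=> //; left.
by exists (z' + w); [split; [case: cov|right]|].
Qed.

Lemma germ_mapl w : square r w -> Dstar (z + w) -> germ_map w = Xp (z + w).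
Proof. by move=> wr Dw; rewrite /germ_map; case: pselect. Qed.

Lemma germ_mapr w : square r w -> Dstar (z' + w) -> germ_map w = Xp (z' + w).
Proof.
move=> wr Dw; rewrite /germ_map; case: pselect => // D1.
by apply/Xp_eqP => //; have [_ _ + _ _] := zz'.1 _ wr; exact.
Qed.

Lemma germ_map_eq w p : square r w -> Dstar p -> Xp p = germ_map w ->
  p = z + w \/ p = z' + w.
Proof.
move=> wr Dp; have [a [Da aE] ->] := germ_mapP wr => /(Xp_eqP Dp Da)/twin_sym.
case: aE Da => -> Da; first by have [_ + _ _ _] := zz'.1 _ wr; exact.
by have [_ H _ _ _] := zz'.2 _ wr => /(H _ Da)[]; [right|left].
Qed.

Lemma germ_map_inj w w' : square r w -> square r w' -> germ_map w = germ_map w' -> w = w'.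
Proof.
move=> wr wr'; have [a [Da aE] ->] := germ_mapP wr => /(germ_map_eq wr' Da).
have [_ _ _ sep _] := zz'.1 _ wr; have [_ _ _ sep' _] := zz'.2 _ wr.
case: aE => -> []; [exact: addrI|exact: sep|exact: sep'|exact: addrI].
Qed.

Lemma germ_map_open (W : set (plane R)) : W `<=` square r ->
  (forall w, W w -> exists2 s, 0 < s & forall v, square s v -> W (w + v)) ->
  open (germ_map @` W).
Proof.
move=> Wr oW; apply/open_XP => p Dp [w Ww /esym pw].
have [s s0 sW] := oW _ Ww; exists s => // v /sW Wwv Dpv; exists (w + v) => //.
have wvr := Wr _ Wwv.
case: (germ_map_eq (Wr _ Ww) Dp pw) Dpv => ->; rewrite -addrA => D1.
  exact: germ_mapl.
exact: germ_mapr.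
Qed.

Lemma germ_map_continuous w (A : set X) : square r w -> open A -> A (germ_map w) ->
  exists2 s, 0 < s & forall v, square s v -> square r (w + v) /\ A (germ_map (w + v)).
Proof.
move=> wr /open_XP oA Aw; have [_ _ _ _ cl] := zz'.1 _ wr.
have [_ _ _ _ cl'] := zz'.2 _ wr.
have [s1 s10 sP1] : exists2 s, 0 < s & forall v, square s v -> Dstar (z + w + v) ->
    A (Xp (z + w + v)).
  (* If [z + w] is removed, so are the points near it, and the condition is vacuous. *)
  have [D1|D1] := pselect (Dstar (z + w)); last first.
    by have [s s0 sP] := cl D1; exists s => // v /sP.
  by apply: oA => //; rewrite -germ_mapl.
have [s2 s20 sP2] : exists2 s, 0 < s & forall v, square s v -> Dstar (z' + w + v) ->
    A (Xp (z' + w + v)).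
  have [D1|D1] := pselect (Dstar (z' + w)); last first.
    by have [s s0 sP] := cl' D1; exists s => // v /sP.
  by apply: oA => //; rewrite -germ_mapr.
have [s3 s30 sP3] := square_room wr.
exists (Num.min (Num.min s1 s2) s3); first by rewrite !lt_min s10 s20 s30.
have [ms1 ms2 ms3] : [/\ Num.min (Num.min s1 s2) s3 <= s1, Num.min (Num.min s1 s2) s3 <= s2
     & Num.min (Num.min s1 s2) s3 <= s3] by rewrite !ge_min !lexx !orbT.
move=> v vs; have wvr := sP3 _ (square_le ms3 vs); split=> //.
have [a [Da aE] ->] := germ_mapP wvr.
by case: aE Da => ->; rewrite addrA; [apply: sP1|apply: sP2]; exact: square_le vs.
Qed.

(** A chart is a total map, so [germ_map] is inverted by choice; the value outside its image is
    irrelevant. *)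
Definition germ_chart : chart R X :=
  (germ_map @` square r, fun x => z + xget 0 [set w | square r w /\ germ_map w = x]).

Lemma germ_chartE w : square r w -> germ_chart.2 (germ_map w) = z + w.
Proof.
move=> wr; rewrite /=; congr (_ + _).
have [] : [set w' | square r w' /\ germ_map w' = germ_map w]
    (xget 0 [set w' | square r w' /\ germ_map w' = germ_map w]) by apply: xgetPex; exists w.
by move=> ? /germ_map_inj; apply.
Qed.

Lemma germ_canonical : canonical_charts germ_chart.
Proof.
have sq0 s w : 0 < s -> square s (0 : plane R) by move=> *; split => /=; lin.
split; first split.
- by apply: germ_map_open => // w /square_room.
- move=> x /set_mem[w wr <-] A /nbhs_planeP[s s0 sA].
  have [t t0 tP] := square_room wr.
  have [ms mt] : Num.min s t <= s /\ Num.min s t <= t by rewrite !ge_min !lexx orbT.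
  have mst : 0 < Num.min s t by rewrite lt_min s0 t0.
  pose W := [set w + v | v in square (Num.min s t)].
  have Wr : W `<=` square r by move=> _ [v vs <-]; exact/tP/(square_le mt).
  have oW : open (germ_map @` W).
    apply: germ_map_open => // _ [v [v1 v2] <-].
    have [s1 s10 sP1] := interval_room v1; have [s2 s20 sP2] := interval_room v2.
    exists (Num.min s1 s2) => [|u [u1 u2]]; first by rewrite lt_min; lin.
    have [m1 m2] : Num.min s1 s2 <= s1 /\ Num.min s1 s2 <= s2 by rewrite !ge_min !lexx orbT.
    by exists (v + u); rewrite ?addrA//; split; [apply: sP1|apply: sP2]; lin.
  have : nbhs (germ_map w) (germ_map @` W).
    apply: open_nbhs_nbhs; split=> //; exists w => //; exists 0; rewrite ?addr0//.
    exact: sq0.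
  apply: filterS => _ [_ [v vs <-] <-]; change (A (germ_chart.2 (germ_map (w + v)))).
  rewrite germ_chartE; last exact/tP/(square_le mt).
  by rewrite addrA -(germ_chartE wr); exact/sA/(square_le ms).
- move=> x y /set_mem[w wr <-] /set_mem[w' wr' <-]; rewrite !germ_chartE//.
  by move=> /addrI ->.
- move=> V oV Vr; rewrite openE => _ [x Vx <-]; have [w wr wx] := Vr _ Vx.
  rewrite -wx in Vx *; have [s s0 sP] := germ_map_continuous wr oV Vx.
  apply/nbhs_planeP; exists s => // v vs; have [wvr Vwv] := sP _ vs.
  by exists (germ_map (w + v)) => //; rewrite !germ_chartE// addrA.
- move=> p [w wr]; rewrite XpE => /esym pw.
  have [s s0 sP] := square_room wr.
  have near_p : \forall q \near p, square s (val q - val p).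
    by apply/nbhs_DstarP; exists s.
  case: (germ_map_eq wr (Dstar_val p) pw) => pE.
    exists 0; apply: filterS near_p => q qs; have wvr := sP _ qs.
    have qE : val q = z + (w + (val q - val p)) by rewrite pE addrA addrC subrK.
    rewrite XpE addr0 [in LHS]qE -germ_mapl// ?germ_chartE// -?qE//; exact: Dstar_val.
  (* Near the second member of the pair the chart still takes values near [z], so the additive
     constant is the translation of the gluing. *)
  exists (z - z'); apply: filterS near_p => q qs; have wvr := sP _ qs.
  have qE : val q = z' + (w + (val q - val p)) by rewrite pE addrA addrC subrK.
  rewrite XpE [in LHS]qE -germ_mapr// -?qE//; last exact: Dstar_val.
  by rewrite germ_chartE// [in RHS]qE (addrC z') -addrA (addrC z') subrK addrC.
Qed.

End OnePatch.
End Patch.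

(** * Hausdorff separation and limits along segments *)

Section Separation.
Variable R : realType.
Notation X := (Xinf R).
Implicit Types (e r s : R) (p q w v z : plane R).

Lemma square0 r : 0 < r -> square r (0 : plane R).
Proof. by move=> ?; split=> /=; lin. Qed.

Lemma chart_exists (x : X) : exists2 c : chart R X, canonical_charts c & c.1 x.
Proof.
have [p Dp ->] := Xp_surj x; have [z [r [r0 _ lm]]] := local_model_exists Dp.
exists (germ_chart p z r); first exact: germ_canonical.
exists 0; first exact: square0.
by rewrite (@germ_mapl _ _ _ r)// ?addr0//; exact: square0.
Qed.

(** Around a point of an edge, a small neighbourhood consists of one half square at each member of
    the pair. *)
Lemma Xp_nbhd z : Dstar z -> exists2 z', twin z z' & forall e, 0 < e ->
  exists A : set X, [/\ open A, A (Xp z) &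
    forall q, Dstar q -> A (Xp q) -> square e (q - z) \/ square e (q - z')].
Proof.
move=> Dz; have [z' [r [r0 zz' lm]]] := local_model_exists Dz.
exists z' => // e e0; pose m := Num.min e r.
have m0 : 0 < m by rewrite lt_min e0 r0.
have [me mr] : m <= e /\ m <= r by rewrite !ge_min !lexx orbT.
have sub : square m `<=` square r by move=> w; exact: square_le.
exists (germ_map z z' @` square m); split.
- by apply: (germ_map_open lm) => // w; exact: square_room.
- exists 0; first exact: square0.
  by rewrite (@germ_mapl _ _ _ r)// ?addr0//; exact: square0.
- move=> q Dq [w wm] /esym /(germ_map_eq lm (sub _ wm) Dq)[]->; [left|right];
  by rewrite addrC addKr; exact: square_le wm.
Qed.

Lemma plane_sep p q : p <> q ->
  exists2 e, 0 < e & forall t, square e (t - p) -> square e (t - q) -> False.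
Proof.
move=> pq; have : p.1 <> q.1 \/ p.2 <> q.2.
  have [e|?] := pselect (p.1 = q.1); [right => e'|by left].
  by apply: pq; rewrite [p]surjective_pairing [q]surjective_pairing e e'.
case=> /eqP/lt_total/orP[]lt; [exists ((q.1 - p.1) / 2)|exists ((p.1 - q.1) / 2)|
  exists ((q.2 - p.2) / 2)|exists ((p.2 - q.2) / 2)];
rewrite ?divr_gt0 ?subr_gt0//;
by clear pq; move=> t [/= ? ?] [/= ? ?]; lin.
Qed.

(** Each of the two points may have two representatives, so four pairs of points of the plane have
    to be separated at once. *)
Lemma X_sep (x y : X) : x <> y -> exists A B : set X,
  [/\ open A, open B, A x, B y & forall t, A t -> B t -> False].
Proof.
have [p Dp ->] := Xp_surj x; have [q Dq ->] := Xp_surj y => /(Xp_eqP Dp Dq) pq.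
have [p' pp' Hp] := Xp_nbhd Dp; have [q' qq' Hq] := Xp_nbhd Dq.
have n1 : p <> q by move=> e; apply: pq; rewrite e; apply: Or31.
have n2 : p <> q' by move=> e; apply: pq; rewrite e; exact: twin_sym.
have n3 : p' <> q by move=> e; apply: pq; rewrite -e.
have n4 : p' <> q' by move=> e; apply: pq; apply: twin_trans pp' _; rewrite e; exact: twin_sym.
have [e1 e10 H1] := plane_sep n1; have [e2 e20 H2] := plane_sep n2.
have [e3 e30 H3] := plane_sep n3; have [e4 e40 H4] := plane_sep n4.
pose m := Num.min (Num.min e1 e2) (Num.min e3 e4).
have [A [oA Ap AP]] := Hp m ltac:(by rewrite !lt_min e10 e20 e30 e40).
have [B [oB Bq BP]] := Hq m ltac:(by rewrite !lt_min e10 e20 e30 e40).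
have [[m1 m2] [m3 m4]] : (m <= e1 /\ m <= e2) /\ (m <= e3 /\ m <= e4).
  by rewrite !ge_min !lexx !orbT.
exists A, B; split=> // t; have [u Du ->] := Xp_surj t => /(AP _ Du) Au /(BP _ Du) Bu.
case: Au Bu => ? [?|?]; [apply: (H1 u)|apply: (H2 u)|apply: (H3 u)|apply: (H4 u)];
  by apply: square_le; eassumption.
Qed.

Definition sc (s : R) v : plane R := (s * v.1, s * v.2).

Lemma sc_small r v : 0 < r -> exists2 d, 0 < d & forall s, - d < s < d -> square r (sc s v).
Proof.
move=> r0; pose M := 1 + `|v.1| + `|v.2|.
have n1 := normr_ge0 v.1; have n2 := normr_ge0 v.2.
have M0 : 0 < M by rewrite /M; lin.
exists (r / M); first by rewrite divr_gt0.
move=> s; rewrite -ltr_norml ltr_pdivlMr// => sM.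
split; rewrite /= -ltr_norml normrM; apply: le_lt_trans sM; apply: ler_wpM2l => //;
  rewrite /M; lin.
Qed.

(** The point [phi (Xp q)] has at most two representatives [z], [z']. By continuity the points
    [q' + sc s v'] are near one of them for small [s], and they also tend to [q']; so [q'] is one of
    the two and was not removed. This is how an affine homeomorphism detects removed points. *)
Lemma limit_Dstar (phi : X -> X) q v q' v' e : continuous phi -> 0 < e -> Dstar q ->
  (forall s, 0 < s < e -> [/\ Dstar (q + sc s v), Dstar (q' + sc s v') &
     phi (Xp (q + sc s v)) = Xp (q' + sc s v')]) -> Dstar q'.
Proof.
move=> cphi e0 Dq H; have [z Dz zE] := Xp_surj (phi (Xp q)).
have [z' zz' zP] := Xp_nbhd Dz.
have Dz' : Dstar z' by case: zz' => [<-//|/sider_Dstar|/sidel_Dstar].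
apply: contrapT => nDq'.
have n1 : q' <> z by move=> e1; apply: nDq'; rewrite e1.
have n2 : q' <> z' by move=> e1; apply: nDq'; rewrite e1.
have [e1 e10 H1] := plane_sep n1; have [e2 e20 H2] := plane_sep n2.
have [A [oA Az AP]] := zP (Num.min e1 e2) ltac:(by rewrite lt_min e10 e20).
have : nbhs (Xp q) (phi @^-1` A) by apply: cphi; rewrite zE; exact: open_nbhs_nbhs.
move=> /(nbhs_Xp Dq)[r r0 rP].
have [d d0 dP] := sc_small v r0.
have [d' d'0 d'P] := @sc_small (Num.min e1 e2) v' ltac:(by rewrite lt_min e10 e20).
have [s [s0 sd sd' se]] : exists s, [/\ 0 < s, s < d, s < d' & s < e].
  exists (Num.min (Num.min d d') e / 2).
  have [md md' me] : [/\ Num.min (Num.min d d') e <= d, Num.min (Num.min d d') e <= d'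
     & Num.min (Num.min d d') e <= e] by rewrite !ge_min !lexx !orbT.
  have m0 : 0 < Num.min (Num.min d d') e by rewrite !lt_min d0 d'0 e0.
  by split; lin.
have [Ds Ds' Es] := H s ltac:(lin).
have /(AP _ Ds') : A (Xp (q' + sc s v')) by rewrite -Es; apply: rP => //; apply: dP; lin.
have sq : square (Num.min e1 e2) (q' + sc s v' - q').
  by rewrite addrC addKr; apply: d'P; lin.
have [m1 m2] : Num.min e1 e2 <= e1 /\ Num.min e1 e2 <= e2 by rewrite !ge_min !lexx orbT.
by case=> ?; [apply: (H1 (q' + sc s v'))|apply: (H2 (q' + sc s v'))]; apply: square_le; eassumption.
Qed.

(** Connectedness of the interval, in the form used to continue properties along segments. *)
Lemma locally_constant_segment (E : R -> Prop) (S : R) : 0 <= S ->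
  (forall s, 0 <= s <= S -> exists2 e, 0 < e &
     forall t, 0 <= t <= S -> s - e < t < s + e -> (E t <-> E s)) ->
  E 0 -> E S.
Proof.
move=> S0 loc E0; pose B := [set s | 0 <= s <= S /\ forall t, 0 <= t <= s -> E t].
have B0 : B 0 by split=> [|t t0]; [lin|have -> : t = 0 by lin].
have supB : has_sup B by split; [exists 0|exists S => s [? _]; lin].
have sup0 : 0 <= sup B by apply: sup_upper_bound.
have supS : sup B <= S by apply: sup_le_ub; [exists 0|move=> s [? _]; lin].
have [e e0 eP] := loc (sup B) ltac:(lin).
have [s [sS Es] se] := sup_adherent e0 supB.
have s_sup : s <= sup B by apply: sup_upper_bound.
have Esup : E (sup B) by apply/(eP s); [lin|lin|apply: Es; lin].
have Enear t : 0 <= t <= S -> t < sup B + e -> E t.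
  move=> tS te; have [ts|ts] := leP t s; first by apply: Es; lin.
  by apply/(eP t) => //; lin.
apply: (Enear S); first lin.
rewrite ltNge; apply/negP => eS.
have : B (sup B + e / 2) by split=> [|t ?]; [lin|apply: Enear; lin].
by move=> /(sup_upper_bound supB); lin.
Qed.

End Separation.

(** * Affine maps in the charts *)

Section AffineAt.
Variable R : realType.
Notation X := (Xinf R).
Notation matrix := (plane R * plane R)%type.
Implicit Types (e r s : R) (p q w v z h : plane R) (A B : matrix) (phi : X -> X).

(* A matrix is the pair of its columns. *)
Definition act A v : plane R :=
  (A.1.1 * v.1 + A.2.1 * v.2, A.1.2 * v.1 + A.2.2 * v.2).

Lemma actD A v w : act A (v + w) = act A v + act A w.
Proof. by rewrite [RHS]surjective_pairing /act /=; congr pair; ring. Qed.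

Lemma act_sc A s v : act A (sc s v) = sc s (act A v).
Proof. by rewrite /act /sc /=; congr pair; ring. Qed.

Lemma act0 A : act A 0 = 0.
Proof. by rewrite /act /= !mulr0 addr0. Qed.

Lemma scD s t v : sc (s + t) v = sc s v + sc t v.
Proof. by rewrite /sc /= !mulrDl. Qed.

Lemma sc0 v : sc 0 v = 0. Proof. by rewrite /sc !mul0r. Qed.

Lemma chart_local (c : chart R X) p : canonical_charts c -> Dstar p -> c.1 (Xp p) ->
  exists k, exists2 r, 0 < r & forall w, square r w -> Dstar (p + w) ->
    c.1 (Xp (p + w)) /\ c.2 (Xp (p + w)) = p + w + k.
Proof.
move=> [[oc _ _ _] cP] Dp cp; have [k kP] := cP (Dpt p) cp; exists k.
have /(near_Dstar (fun q => c.2 (Xp q) = q + k) Dp) [r1 r10 H1] :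
    nbhs (Dpt p) [set q | c.2 (Xp (val q)) = val q + k].
  by apply: filterS kP => q; rewrite XpE.
have /(nbhs_Xp Dp)[r2 r20 H2] : nbhs (Xp p) c.1 by exact: open_nbhs_nbhs.
exists (Num.min r1 r2); first by rewrite lt_min r10.
have [m1 m2] : Num.min r1 r2 <= r1 /\ Num.min r1 r2 <= r2 by rewrite !ge_min !lexx orbT.
move=> w wr Dw; split; first exact: (H2 _ (square_le m2 wr)).
exact: (H1 _ (square_le m1 wr)).
Qed.

Lemma open_preimage_Xp phi p (U : set X) : continuous phi -> Dstar p -> open U ->
  U (phi (Xp p)) ->
  exists2 r, 0 < r & forall w, square r w -> Dstar (p + w) -> U (phi (Xp (p + w))).
Proof.
move=> cphi Dp oU Up; apply: (@nbhs_Xp _ _ (phi @^-1` U) Dp).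
by apply: cphi; exact: open_nbhs_nbhs.
Qed.

(** The source is read in the coordinate of [D] and the target in any canonical chart; such charts
    differ by translations, so the linear part is well defined ([affine_at_uniq]). *)
Definition affine_at phi p A := exists (d : chart R X) k r,
  [/\ canonical_charts d, 0 < r & forall w, square r w ->
    d.1 (phi (Xp (p + w))) /\ d.2 (phi (Xp (p + w))) = k + act A w].

Lemma square_min r s w : square (Num.min r s) w -> square r w /\ square s w.
Proof.
have [m1 m2] : Num.min r s <= r /\ Num.min r s <= s by rewrite !ge_min !lexx orbT.
by move=> wm; split; exact: square_le wm.
Qed.

Lemma Aff_affine_at (phi : homeo X) p : Aff R phi -> inD p -> exists A, affine_at phi p A.
Proof.
move=> aff iD; have Dp := inD_Dstar iD.
have [c [d [cc cd cp dp [g [a [b [a' [b' [f [f' gE]]]]]]]]]] := aff (Xp p).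
move=> /(nbhs_Xp Dp)[r1 r10 H1]; have [k [r2 r20 H2]] := chart_local cc Dp cp.
have [r3 r30 H3] := inD_open iD.
have [_ _ cphi _] := homeo_inv_funP phi.
have [r4 r40 H4] : exists2 r, 0 < r & forall w, square r w -> Dstar (p + w) ->
    d.1 (phi (Xp (p + w))).
  by apply: open_preimage_Xp => //; have [[]] := cd.
exists ((a, a'), (b, b')), d, (g (p + k)), (Num.min (Num.min r1 r2) (Num.min r3 r4)).
split=> //; first by rewrite !lt_min r10 r20 r30.
move=> w /square_min[/square_min[w1 w2] /square_min[w3 w4]].
have Dw := inD_Dstar (H3 _ w3); split; first exact: H4.
have [_ e] := H2 _ w2 Dw.
by rewrite (H1 _ w1 Dw) e !gE [RHS]surjective_pairing /act /=; congr pair; ring.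
Qed.

Lemma affine_at_chart phi p A (d : chart R X) : continuous phi -> inD p ->
  affine_at phi p A -> canonical_charts d -> d.1 (phi (Xp p)) ->
  exists k, exists2 r, 0 < r & forall w, square r w ->
    d.1 (phi (Xp (p + w))) /\ d.2 (phi (Xp (p + w))) = k + act A w.
Proof.
move=> cphi iD [c [k [r [cc r0 H]]]] cd dp; have Dp := inD_Dstar iD.
have [cp cE] := H _ (square0 r0); rewrite addr0 in cp cE.
have [k' k'P] := canonical_charts_translation cc cd cp dp.
have /(nbhs_Xp Dp)[r1 r10 H1] := cphi (Xp p) _ k'P.
have [r2 r20 H2] : exists2 r, 0 < r & forall w, square r w -> Dstar (p + w) ->
    d.1 (phi (Xp (p + w))).
  by apply: open_preimage_Xp => //; have [[]] := cd.
have [r3 r30 H3] := inD_open iD.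
exists (k + k'), (Num.min (Num.min r r1) (Num.min r2 r3)); first by rewrite !lt_min r0 r10 r20.
move=> w /square_min[/square_min[w1 w2] /square_min[w3 w4]].
have Dw := inD_Dstar (H3 _ w4); split; first exact: H2.
by rewrite (H1 _ w2 Dw); have [_ ->] := H _ w1; rewrite addrAC.
Qed.

Lemma square_act_eq A B r : 0 < r -> (forall w, square r w -> act A w = act B w) -> A = B.
Proof.
move=> r0 H.
have /(f_equal (fun v => (v.1, v.2)))/= [e1 e2] := H (r / 2, 0) ltac:(split=> /=; lin).
have /(f_equal (fun v => (v.1, v.2)))/= [e3 e4] := H (0, r / 2) ltac:(split=> /=; lin).
have r2 : r / 2 != 0 by lin.
rewrite !mulr0 ?addr0 ?add0r in e1 e2 e3 e4.
move: A B e1 e2 e3 e4 {H} => [[a b] [c d]] [[a' b'] [c' d']] /=.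
by do 4!move=> /(mulIf r2) ->.
Qed.

Lemma affine_at_uniq phi p A B : continuous phi -> inD p ->
  affine_at phi p A -> affine_at phi p B -> A = B.
Proof.
move=> cphi iD aA [d [k [r [cd r0 H]]]].
have [dp dE] := H _ (square0 r0); rewrite addr0 act0 addr0 in dp dE.
have [k' [r' r'0 H']] := affine_at_chart cphi iD aA cd dp.
have [_ dE'] := H' _ (square0 r'0); rewrite addr0 act0 addr0 dE in dE'.
apply: (@square_act_eq _ _ (Num.min r r')); first by rewrite lt_min r0.
move=> w /square_min[w1 w2]; have [_ e1] := H _ w1; have [_ e2] := H' _ w2.
by apply: (addrI k); rewrite -e1 e2 dE'.
Qed.

Lemma affine_at_near phi p A : affine_at phi p A ->
  exists2 r, 0 < r & forall w, square r w -> affine_at phi (p + w) A.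
Proof.
move=> [d [k [r [cd r0 H]]]]; exists r => // w wr; have [s s0 sP] := square_room wr.
exists d, (k + act A w), s; split=> // v /sP/H[]; rewrite addrA => ? ->.
by rewrite actD addrA.
Qed.

(** The linear part is locally constant because it is unique at each point. *)
Lemma affine_at_segment (phi : homeo X) p h A : Aff R phi ->
  (forall s, 0 <= s <= 1 -> inD (p + sc s h)) ->
  affine_at phi p A -> affine_at phi (p + sc 1 h) A.
Proof.
move=> aff iD; have [_ _ cphi _] := homeo_inv_funP phi.
have {1}-> : p = p + sc 0 h by rewrite sc0 addr0.
apply: (@locally_constant_segment _ (fun s => affine_at phi (p + sc s h) A)); first exact: ler01.
move=> s s01; have [B aB] := Aff_affine_at aff (iD s s01).
have [r r0 rP] := affine_at_near aB; have [d d0 dP] := sc_small h r0.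
exists d => // t t01 ts.
have /rP : square r (sc (t - s) h) by apply: dP; lin.
rewrite -addrA -scD (addrC s) subrK => aBt.
split=> [aA|aA]; first by rewrite (affine_at_uniq cphi (iD t t01) aA aBt).
by rewrite (affine_at_uniq cphi (iD s s01) aA aB).
Qed.

(** Analytic continuation along a segment: the set of times at which the equation holds is open
    because charts are injective, and closed because the surface is Hausdorff. *)
Lemma path_image phi A p h z (S : R) : continuous phi -> 0 <= S ->
  (forall s, 0 <= s <= S -> [/\ inD (p + sc s h), affine_at phi (p + sc s h) A &
     Dstar (z + sc s (act A h))]) ->
  phi (Xp p) = Xp z -> phi (Xp (p + sc S h)) = Xp (z + sc S (act A h)).
Proof.
move=> cphi S0 H e0.
apply: (@locally_constant_segment _ (fun s => phi (Xp (p + sc s h)) = Xp (z + sc s (act A h)))) => //;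
  last by rewrite !sc0 !addr0.
move=> s sS; have [iD aA Dz] := H s sS; have Dp := inD_Dstar iD.
have split1 u v : p + sc u v = p + sc s v + sc (u - s) v by rewrite -addrA -scD (addrC s) subrK.
have split2 u v : z + sc u v = z + sc s v + sc (u - s) v by rewrite -addrA -scD (addrC s) subrK.
(* Where the equation holds, both sides have the same expression in one chart around the common
   image, so it persists nearby. *)
have [e|ne] := pselect (phi (Xp (p + sc s h)) = Xp (z + sc s (act A h))).
  have [d cd dx] := chart_exists (phi (Xp (p + sc s h))).
  have [k [r r0 rP]] := affine_at_chart cphi iD aA cd dx.
  have dx' := dx; rewrite e in dx'; have [k' [r' r'0 r'P]] := chart_local cd Dz dx'.
  have [d1 d10 d1P] := sc_small h r0; have [d2 d20 d2P] := sc_small (act A h) r'0.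
  have [m1 m2] : Num.min d1 d2 <= d1 /\ Num.min d1 d2 <= d2 by rewrite !ge_min !lexx orbT.
  have kk' : k = z + sc s (act A h) + k'.
    have [_] := rP _ (square0 r0); have [] := r'P _ (square0 r'0) ltac:(by rewrite addr0).
    by rewrite !addr0 act0 addr0 e => _ ->.
  exists (Num.min d1 d2); first by rewrite lt_min d10.
  move=> t tS st; split=> // _; have [_ _ Dt] := H t tS.
  have [|dt dtE] := rP (sc (t - s) h); first by apply: d1P; lin.
  have [||dt' dtE'] := r'P (sc (t - s) (act A h)); first by apply: d2P; lin.
    by rewrite -split2.
  rewrite (split1 t) (split2 t).
  have [[_ _ dinj _] _] := cd; apply: dinj; rewrite ?inE//.
  by rewrite dtE dtE' act_sc kk' addrAC.
(* Where the equation fails, disjoint neighbourhoods make it fail nearby. *)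
have [U [V [oU oV Ux Vy UV]]] := X_sep ne.
have [r r0 rP] : exists2 r, 0 < r & forall w, square r w -> Dstar (p + sc s h + w) ->
    U (phi (Xp (p + sc s h + w))).
  exact: (open_preimage_Xp cphi Dp oU Ux).
have [r' r'0 r'P] : exists2 r, 0 < r & forall w, square r w -> Dstar (z + sc s (act A h) + w) ->
    V (Xp (z + sc s (act A h) + w)).
  by have nV := open_nbhs_nbhs (conj oV Vy); exact: (nbhs_Xp Dz nV).
have [d1 d10 d1P] := sc_small h r0; have [d2 d20 d2P] := sc_small (act A h) r'0.
have [m1 m2] : Num.min d1 d2 <= d1 /\ Num.min d1 d2 <= d2 by rewrite !ge_min !lexx orbT.
exists (Num.min d1 d2); first by rewrite lt_min d10.
move=> t tS st; split=> // et; exfalso; have [iDt _ Dt] := H t tS.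
rewrite (split1 t) (split2 t) in et iDt Dt.
apply: (UV (phi (Xp (p + sc s h + sc (t - s) h)))).
  by apply: rP; [apply: d1P; lin|exact: inD_Dstar].
by rewrite et; apply: r'P => //; apply: d2P; lin.
Qed.

End AffineAt.

(** * Affine homeomorphisms defined piecewise on D *)

Section Piecewise.
Variable R : realType.
Notation X := (Xinf R).
Notation matrix := (plane R * plane R)%type.
Implicit Types (e r s : R) (p q w v z h : plane R) (A B : matrix).

Lemma act_small A r : 0 < r -> exists2 d, 0 < d & forall w, square d w -> square r (act A w).
Proof.
move=> r0; pose M := 1 + `|A.1.1| + `|A.1.2| + `|A.2.1| + `|A.2.2|.
have n1 := normr_ge0 A.1.1; have n2 := normr_ge0 A.1.2.
have n3 := normr_ge0 A.2.1; have n4 := normr_ge0 A.2.2.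
have M0 : 0 < M by rewrite /M; lin.
exists (r / M); first by rewrite divr_gt0.
move=> w [/=]; rewrite -!ltr_norml => w1 w2; have rM : 0 < r / M by rewrite divr_gt0.
have rE : r = r / M * (1 + `|A.1.1| + `|A.1.2| + `|A.2.1| + `|A.2.2|).
  by rewrite -/M divfK// gt_eqF.
have bd a x : `|x| < r / M -> `|a * x| <= r / M * `|a|.
  by move=> /ltW xM; rewrite normrM mulrC ler_wpM2r.
split; rewrite /= -ltr_norml; apply: le_lt_trans (ler_normD _ _) _.
  have := bd A.1.1 _ w1; have := bd A.2.1 _ w2.
  have := mulr_ge0 (ltW rM) n2; have := mulr_ge0 (ltW rM) n4.
  by move: rE; rewrite !mulrDr mulr1; lin.
have := bd A.1.2 _ w1; have := bd A.2.2 _ w2.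
have := mulr_ge0 (ltW rM) n1; have := mulr_ge0 (ltW rM) n3.
by move: rE; rewrite !mulrDr mulr1; lin.
Qed.

Lemma box_closed (a b c d : R) p : ~ box a b c d p -> nbhs p (~` box a b c d).
Proof.
move=> nb; have H (u v : R) : u < v -> exists2 r, 0 < r & forall s, - r < s < r -> u + s < v.
  by move=> uv; exists (v - u) => [|s ?]; lin.
have K (u v : R) : u < v -> exists2 r, 0 < r & forall s, - r < s < r -> u < v + s.
  by move=> uv; exists (v - u) => [|s ?]; lin.
have [?|pa] := ltP p.1 a.
  have [r r0 rP] := H _ _ ltac:(eassumption); apply/nbhs_planeP; exists r => // w [w1 w2] [/= b1 b2].
  by have := rP _ w1; lin.
have [?|pb] := ltP b p.1.
  have [r r0 rP] := K _ _ ltac:(eassumption); apply/nbhs_planeP; exists r => // w [w1 w2] [/= b1 b2].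
  by have := rP _ w1; lin.
have [?|pc] := ltP p.2 c.
  have [r r0 rP] := H _ _ ltac:(eassumption); apply/nbhs_planeP; exists r => // w [w1 w2] [/= b1 b2].
  by have := rP _ w2; lin.
have [?|pd] := ltP d p.2.
  have [r r0 rP] := K _ _ ltac:(eassumption); apply/nbhs_planeP; exists r => // w [w1 w2] [/= b1 b2].
  by have := rP _ w2; lin.
by case: nb; split; apply/andP.
Qed.

Lemma act_translate A p q t : act A q + t = act A p + t + act A (q - p).
Proof. by rewrite addrAC -actD addrCA subrr addr0. Qed.

Section OneMap.
Variables (I : finType) (P : I -> set (plane R)) (A : matrix) (t : I -> plane R).
Let f i p := act A p + t i.

Definition twinD p q := [/\ Dstar p, Dstar q & twin p q].

(** Hypotheses of the pasting lemma on a finite closed cover with one common matrix. Agreement is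
    required only up to gluing and only at interior points and glued pairs; the case [i = j] of
    [piece_inD] says that interior points are not sent to removed ones. *)
Record piecewise : Prop := Piecewise {
  piece_cover : forall p, D p -> exists i, P i p;
  piece_closed : forall i p, ~ P i p -> nbhs p (~` P i);
  piece_inD : forall i j p, inD p -> P i p -> P j p -> twinD (f i p) (f j p);
  piece_side : forall i j p q, side p q -> P i p -> P j q -> twinD (f i p) (f j q) }.

Hypothesis pw : piecewise.

Lemma piece_Dstar i p : Dstar p -> P i p -> Dstar (f i p).
Proof.
move=> /DstarP[iD|[q s]|[q s]] Pp; first by case: (piece_inD pw iD Pp Pp).
- have [j Pq] := piece_cover pw (side_D s).2.
  by case: (piece_side pw s Pp Pq).
- have [j Pq] := piece_cover pw (side_D s).1.
  by case: (piece_side pw s Pq Pp).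
Qed.

Lemma piece_twin i j p q : Dstar p -> P i p -> P j q -> twin p q -> twin (f i p) (f j q).
Proof.
move=> Dp Pp Pq [e|s|s]; first last.
- by have [_ _ /twin_sym] := piece_side pw s Pq Pp.
- by have [_ _] := piece_side pw s Pp Pq.
rewrite -e in Pq *; case/DstarP: Dp => [iD|[u s]|[u s]].
- by have [_ _] := piece_inD pw iD Pp Pq.
- have [k Pu] := piece_cover pw (side_D s).2.
  have [_ _ t1] := piece_side pw s Pp Pu; have [_ _ t2] := piece_side pw s Pq Pu.
  exact: twin_trans t1 (twin_sym t2).
- have [k Pu] := piece_cover pw (side_D s).1.
  have [_ _ t1] := piece_side pw s Pu Pp; have [_ _ t2] := piece_side pw s Pu Pq.
  exact: twin_trans (twin_sym t1) t2.
Qed.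

Definition induces (phi : X -> X) := forall i p, Dstar p -> P i p -> phi (Xp p) = Xp (f i p).

Lemma piecewise_map : exists2 phi, continuous phi & induces phi.
Proof.
have cov (x : X) : exists i, P i (val (repr x)).
  exact/(piece_cover pw)/Dstar_D/Dstar_val.
pose phi x := Xp (f (projT1 (cid (cov x))) (val (repr x))).
have phiE : induces phi.
  move=> i p Dp Pp; rewrite /phi; case: cid => j /= Pj.
  have Dr := Dstar_val (repr (Xp p)).
  apply/Xp_eqP; [exact: piece_Dstar|exact: piece_Dstar|].
  apply: piece_twin => //; apply/(Xp_eqP Dr Dp).
  by rewrite -XpE /Xproj reprK.
exists phi => //; apply/continuousP => U oU; apply/open_XP => p Dp Up.
suff /nbhs_planeP[r r0 rP] : nbhs p [set q | Dstar q -> U (phi (Xp q))].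
  by exists r.
(* There are finitely many pieces, so they can be treated one at a time; a piece that misses [p]
   also misses its neighbours. *)
have : \forall q \near p, forall i, (Dstar q -> P i q -> U (phi (Xp q)) : Prop).
  apply: (@filter_forall _ _ (fun i => [set q | Dstar q -> P i q -> U (phi (Xp q))])
    (nbhs p)) => i; have [Pp|nPp] := pselect (P i p); last first.
    by apply: filterS (piece_closed pw nPp) => q nP _ /nP.
  have Df := piece_Dstar Dp Pp.
  move/open_XP: oU => /(_ _ Df); rewrite -(phiE _ _ Dp Pp) => /(_ Up)[r r0 rP].
  have [d d0 dP] := act_small A r0.
  apply/nbhs_planeP; exists d => // w wd Dw Pw; rewrite (phiE i)// /f (act_translate _ p (p + w)).
  have := piece_Dstar Dw Pw; rewrite /f (act_translate _ p (p + w)).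
  by apply: rP; rewrite (addrC p) addrK; exact: dP.
apply: filterS => q qP Dq; have [i Pq] := piece_cover pw (Dstar_D Dq).
exact: qP Pq.
Qed.

Lemma piecewise_Aff (phi : homeo X) : induces phi -> Aff R phi.
Proof.
move=> phiE x; have [_ _ cphi _] := homeo_inv_funP phi.
have [c cc cx] := chart_exists x; have [d cd dx] := chart_exists (phi x).
exists c, d; split=> //.
pose g v : plane R := act A v + (d.2 (phi x) - act A (c.2 x)).
exists g.
  exists A.1.1, A.2.1, A.1.2, A.2.2, (d.2 (phi x) - act A (c.2 x)).1,
    (d.2 (phi x) - act A (c.2 x)).2 => v.
  by rewrite /g [LHS]surjective_pairing.
pose S := [set q | [/\ c.1 q, d.1 (phi q) & d.2 (phi q) = g (c.2 q)]].
suff oS : open S.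
  have Sx : S x by split=> //; rewrite /g addrC subrK.
  by apply: filterS (open_nbhs_nbhs (conj oS Sx)) => q [].
apply/open_XP => p Dp [cp dp e].
suff /nbhs_planeP[r r0 rP] : nbhs p [set q | Dstar q -> S (Xp q)] by exists r.
have : \forall q \near p, forall i, (Dstar q -> P i q -> S (Xp q) : Prop).
  apply: (@filter_forall _ _ (fun i => [set q | Dstar q -> P i q -> S (Xp q)])
    (nbhs p)) => i; have [Pp|nPp] := pselect (P i p); last first.
    by apply: filterS (piece_closed pw nPp) => q nP _ /nP.
  have Df := piece_Dstar Dp Pp.
  have [k [r r0 rP]] := chart_local cc Dp cp.
  have df : d.1 (Xp (f i p)) by rewrite -phiE.
  have [k' [r' r'0 r'P]] := chart_local cd Df df.
  have [s s0 sP] := act_small A r'0.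
  apply/nbhs_planeP; exists (Num.min r s); first by rewrite lt_min r0.
  move=> w /square_min[wr ws] Dw Pw; have [cw cwE] := rP _ wr Dw.
  have Dfw := piece_Dstar Dw Pw; have fE : f i (p + w) = f i p + act A w.
    by rewrite {1}/f (act_translate _ p) (addrC p) addrK.
  rewrite fE in Dfw; have [dw dwE] := r'P _ (sP _ ws) Dfw.
  split=> //; rewrite (phiE i)// fE//.
  have [_ c0] := rP _ (square0 r0) ltac:(by rewrite addr0); rewrite addr0 in c0.
  have [_ d0] := r'P _ (square0 r'0) ltac:(by rewrite addr0); rewrite addr0 in d0.
  rewrite dwE cwE addrAC -d0 -(phiE _ _ Dp Pp) e c0 /g.
  by rewrite (addrAC p w) (actD _ (p + k)) addrAC.
apply: filterS => q qP Dq; have [i Pq] := piece_cover pw (Dstar_D Dq).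
exact: qP Pq.
Qed.

End OneMap.

Lemma piecewise_homeo (I : finType) (P P' : I -> set (plane R)) A A' t t' :
  piecewise P A t -> piecewise P' A' t' ->
  (forall i p, P i p -> P' i (act A p + t i) /\ act A' (act A p + t i) + t' i = p) ->
  (forall i p, P' i p -> P i (act A' p + t' i) /\ act A (act A' p + t' i) + t i = p) ->
  exists phi : homeo X, [/\ Aff R phi, Aff R (homeoV phi), induces P A t phi &
    induces P' A' t' (homeoV phi)].
Proof.
move=> pw pw' PP' P'P; have [f cf fE] := piecewise_map pw.
have [f' cf' f'E] := piecewise_map pw'.
have fK : cancel f f'.
  move=> x; have [p Dp ->] := Xp_surj x; have [i Pp] := piece_cover pw (Dstar_D Dp).
  have [P'p e] := PP' _ _ Pp.
  by rewrite (fE i)// (f'E i) ?e//; exact: piece_Dstar pw _ _ Dp Pp.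
have f'K : cancel f' f.
  move=> x; have [p Dp ->] := Xp_surj x; have [i Pp] := piece_cover pw' (Dstar_D Dp).
  have [P'p e] := P'P _ _ Pp.
  by rewrite (f'E i)// (fE i) ?e//; exact: piece_Dstar pw' _ _ Dp Pp.
have hf : `[< homeomorphism f >] by apply/asboolP; exists f'.
pose phi : homeo X := Homeo hf.
have phiV : (homeoV phi) =1 f'.
  have [k1 k2 _ _] := homeo_inv_funP phi => x.
  by rewrite -[in LHS](f'K x); exact: k1.
have iphi' : induces P' A' t' (homeoV phi) by move=> i p Dp Pp; rewrite phiV; exact: f'E.
exists phi; split=> //; first exact: (piecewise_Aff pw).
exact: (piecewise_Aff pw').
Qed.

End Piecewise.

(** * The generators *)

Section Generators.
Variable R : realType.
Notation X := (Xinf R).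
Notation matrix := (plane R * plane R)%type.
Implicit Types (e r s : R) (p q w v z h : plane R) (A B : matrix).

(* [x] is irrelevant to the box of [i]; clearing it makes [lin] faster. *)
Ltac boxes x i bi j bj :=
  destruct i; destruct bi; try (exfalso; clear dependent x; lin);
  destruct j; destruct bj; try (exfalso; lin).

Ltac pieces x i bi j bj :=
  destruct i as [[]|]; destruct bi; try (exfalso; clear dependent x; lin);
  destruct j as [[]|]; destruct bj; try (exfalso; lin).

Lemma inD_left p : inD p -> p.1 < 0 -> - 2^-1 < p.1 /\ 0 < p.2 < 2^-1.
Proof. by case=> -[]; lin. Qed.
Lemma inD_right p : inD p -> 2^-1 < p.1 -> p.1 < 1 /\ 2^-1 < p.2 < 1.
Proof. by case=> -[]; lin. Qed.
Lemma inD_low p : inD p -> p.2 < 2^-1 -> 0 < p.2 /\ - 2^-1 < p.1 < 2^-1.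
Proof. by case=> -[]; lin. Qed.
Lemma inD_high p : inD p -> 2^-1 < p.2 -> p.2 < 1 /\ 0 < p.1 < 1.
Proof. by case=> -[]; lin. Qed.
Lemma inD_bounds p : inD p -> - 2^-1 < p.1 < 1 /\ 0 < p.2 < 1.
Proof. by case=> -[]; lin. Qed.

Lemma twinD_side p q : side p q -> twinD p q.
Proof. by move=> s; split; [exact: sidel_Dstar s|exact: sider_Dstar s|exact: Or32]. Qed.

Lemma twinD_sym p q : twinD p q -> twinD q p.
Proof. by move=> [? ? /twin_sym]; split. Qed.

Lemma twinD_l p q : twinD p q -> twinD p p.
Proof. by case=> ? _ _; split=> //; exact: Or31. Qed.

Lemma twinD_inD p q : inD p -> p.1 = q.1 -> p.2 = q.2 -> twinD p q.
Proof.
move=> iD e1 e2; have <- : p = q by rewrite [p]surjective_pairing e1 e2 -surjective_pairing.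
by split; [exact: inD_Dstar|exact: inD_Dstar|exact: Or31].
Qed.

Lemma dyadic_half_cases b e : dyadic b e ->
  (b /\ e = 2^-1) \/ [/\ dyadic (~~ b) (2 * e), e <= 4^-1 & b -> e <= 8^-1].
Proof.
move=> d; have [|d2] := dyadic_double d; [by left|right; split=> //].
  by have := dyadic_le d2; lin.
by move=> bt; rewrite bt in d2; have := dyadicF_le d2; lin.
Qed.

Definition psi_mx : matrix := ((2, 0), (0, 2^-1)).
Definition psi_box (i : option bool) : set (plane R) :=
  match i with None => box 0 2^-1 0 1 | Some true => box (- 2^-1) 0 0 2^-1
  | Some false => box 2^-1 1 2^-1 1 end.
Definition psi_shift (i : option bool) : plane R :=
  match i with None => (- 2^-1, 0) | Some true => (1, 2^-1) | Some false => (- 1, 2^-1) end.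

(** The inverse of [psi]: its pieces are the images of the pieces of [psi_box], with the same
    indices. *)
Definition psiV_mx : matrix := ((2^-1, 0), (0, 2)).
Definition psiV_box (i : option bool) : set (plane R) :=
  match i with None => box (- 2^-1) 2^-1 0 2^-1 | Some true => box 0 1 2^-1 (3 / 4)
  | Some false => box 0 1 (3 / 4) 1 end.
Definition psiV_shift (i : option bool) : plane R :=
  match i with None => (4^-1, 0) | Some true => (- 2^-1, - 1) | Some false => (2^-1, - 1) end.

Definition rho_mx : matrix := ((1, 0), (0, - 1)).
Definition rho_box (i : bool) : set (plane R) :=
  if i then box 0 1 2^-1 1 else box (- 2^-1) 2^-1 0 2^-1.
Definition rho_shift (i : bool) : plane R := if i then (- 2^-1, 1) else (2^-1, 1).

(** The reflection exchanges [A_n] with [B_n] and [C'_n] with [C''_n]; the slit [side_H] goes to the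
    common segment of the two squares, and that segment, where the pieces meet, goes to the slit. *)
Lemma rho_piecewise : piecewise rho_box rho_mx rho_shift.
Proof.
split.
- by move=> p [?|?]; [exists true|exists false].
- by move=> [] p /box_closed.
- have K p : 0 < p.1 < 2^-1 -> p.2 = 2^-1 ->
     twinD (act rho_mx p + rho_shift true) (act rho_mx p + rho_shift false).
    by move=> ? ?; apply/twinD_side/(uncurry4 (@side_H _ _ _)) => /=; lin.
  have L p : inD p -> p.2 = 2^-1 -> 0 < p.1 < 2^-1 by case=> -[]; lin.
  move=> [] [] p iD /= [b1 b2] [b3 b4].
  + have [?|?] := eqVneq p.2 2^-1; first by apply: twinD_l (K _ (L _ _ _) _).
    by have [|? ?] := inD_high iD; [lin|apply: twinD_inD => //; apply: Or32 => /=; lin].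
  + by apply: K; [apply: L => //|]; lin.
  + by apply/twinD_sym/K; [apply: L => //|]; lin.
  + have [?|?] := eqVneq p.2 2^-1; first by apply: twinD_l (twinD_sym (K _ (L _ _ _) _)).
    by have [|? ?] := inD_low iD; [lin|apply: twinD_inD => //; apply: Or31 => /=; lin].
- move=> i j p q s bi bj.
  case: s => [px e1 e2 e3|b e d px e1 e2 e3|b e d px e1 e2 e3|e d e1 py e2 e3|
        e d e1 py e2 e3|e d e1 py e2 e3|e d e1 py e2 e3]; dyb; boxes q i bi j bj.
  + by apply: twinD_inD => /=; [apply: Or33; split=> /=|..]; lin.
  + by apply/twinD_sym/twinD_side/(uncurry4 (side_C'' d)) => /=; lin.
  + by apply/twinD_sym/twinD_side/(uncurry4 (side_C' d)) => /=; lin.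
  + by apply/twinD_side/(uncurry4 (side_Bo d)) => /=; lin.
  + by apply/twinD_side/(uncurry4 (side_Be d)) => /=; lin.
  + by apply/twinD_side/(uncurry4 (side_Ao d)) => /=; lin.
  + by apply/twinD_side/(uncurry4 (side_Ae d)) => /=; lin.
Qed.

(** Halving heights sends [A_n] and [B_n] to [A_(n+1)] and [B_(n+1)]; doubling widths sends [C'_n]
    and [C''_n] to the edges of index [n - 1], while [C'_1] becomes the slit [side_H] and [C''_1]
    and the slit become interior. The two cuts between the pieces supply [A_1] and [B_1]. *)
Lemma psi_piecewise : piecewise psi_box psi_mx psi_shift.
Proof.
split.
- move=> p [[/= x y]|[/= x y]]; have [?|?] := leP p.1 2^-1; have [?|?] := leP 0 p.1;
  first [by exists None; split=> /=; lin|by exists (Some true); split=> /=; lin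
        |by exists (Some false); split=> /=; lin].
- by move=> [[]|] p /box_closed.
- have d1 := @dyadicT R.
  have K1 p : p.1 = 0 -> 0 < p.2 < 2^-1 ->
     twinD (act psi_mx p + psi_shift (Some true)) (act psi_mx p + psi_shift None).
    by move=> ? ?; apply/twinD_side/(uncurry4 (side_Ao d1)) => /=; lin.
  have K2 p : p.1 = 2^-1 -> 2^-1 < p.2 < 1 ->
     twinD (act psi_mx p + psi_shift None) (act psi_mx p + psi_shift (Some false)).
    by move=> ? ?; apply/twinD_side/(uncurry4 (side_Bo d1)) => /=; lin.
  have L1 p : inD p -> p.1 = 0 -> 0 < p.2 < 2^-1 by case=> -[]; lin.
  have L2 p : inD p -> p.1 = 2^-1 -> 2^-1 < p.2 < 1 by case=> -[]; lin.
  move=> i j p iD bi bj; have [p0|p0] := eqVneq p.1 0.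
    have K := K1 _ p0 (L1 _ iD p0).
    pieces bj i bi j bj.
    + exact: twinD_l K.
    + exact: K.
    + exact: twinD_sym.
    + exact: twinD_l (twinD_sym K).
  have [p1|p1] := eqVneq p.1 2^-1.
    have K := K2 _ p1 (L2 _ iD p1).
    pieces bj i bi j bj.
    + exact: twinD_l (twinD_sym K).
    + exact: twinD_sym.
    + exact: K.
    + exact: twinD_l K.
  pieces bj i bi j bj;
    apply: twinD_inD => //.
  + by have [|? ?] := inD_left iD; [lin|apply: Or31 => /=; lin].
  + by have [|? ?] := inD_right iD; [lin|apply: Or31 => /=; lin].
  + by have [? ?] := inD_bounds iD; apply: Or32 => /=; lin.
- move=> i j p q s bi bj.
  case: s => [px e1 e2 e3|b e d px e1 e2 e3|b e d px e1 e2 e3|e d e1 py e2 e3|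
        e d e1 py e2 e3|e d e1 py e2 e3|e d e1 py e2 e3].
  + pieces q i bi j bj.
    by apply: twinD_inD => /=; [apply: Or31; split=> /=|..]; lin.
  + dyb; case: (dyadic_half_cases d) => [[_ eE]|[d2 e4 _]];
    pieces q i bi j bj.
      by apply/twinD_side/(uncurry4 (@side_H _ _ _)) => /=; lin.
    by apply/twinD_side/(uncurry4 (side_C' d2)) => /=; lin.
  + dyb; case: (dyadic_half_cases d) => [[_ eE]|[d2 e4 _]];
    pieces q i bi j bj.
      by apply: twinD_inD => /=; [apply: Or33; split=> /=|..]; lin.
    by apply/twinD_side/(uncurry4 (side_C'' d2)) => /=; lin.
  + dyb; pieces q i bi j bj.
    by apply/twinD_side/(uncurry4 (side_Ae (dyadic_half d))) => /=; lin.
  + dyb; pieces q i bi j bj.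
    by apply/twinD_side/(uncurry4 (side_Ao (dyadic_half d))) => /=; lin.
  + dyb; pieces q i bi j bj.
    by apply/twinD_side/(uncurry4 (side_Be (dyadic_half d))) => /=; lin.
  + dyb; pieces q i bi j bj.
    by apply/twinD_side/(uncurry4 (side_Bo (dyadic_half d))) => /=; lin.
Qed.

(** The same correspondence of edges backwards: [A_1] and [B_1] become interior, the slit becomes
    [C'_1], and the cuts at heights 1/2 and 3/4 supply [C''_1] and the slit. *)
Lemma psiV_piecewise : piecewise psiV_box psiV_mx psiV_shift.
Proof.
split.
- move=> p [[/= x y]|[/= x y]]; have [?|?] := leP p.2 (3 / 4);
  first [by exists None; split=> /=; lin|by exists (Some true); split=> /=; lin
        |by exists (Some false); split=> /=; lin].
- by move=> [[]|] p /box_closed.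
- have d1 := @dyadicT R.
  have K1 p : 0 < p.1 < 2^-1 -> p.2 = 2^-1 ->
     twinD (act psiV_mx p + psiV_shift None) (act psiV_mx p + psiV_shift (Some true)).
    by move=> ? ?; apply/twinD_side/(uncurry4 (side_C'' d1)) => /=; lin.
  have K2 p : 0 < p.1 < 1 -> p.2 = 3 / 4 ->
     twinD (act psiV_mx p + psiV_shift (Some true)) (act psiV_mx p + psiV_shift (Some false)).
    by move=> ? ?; apply/twinD_side/(uncurry4 (@side_H _ _ _)) => /=; lin.
  have L1 p : inD p -> p.2 = 2^-1 -> 0 < p.1 < 2^-1 by case=> -[]; lin.
  have L2 p : inD p -> p.2 = 3 / 4 -> 0 < p.1 < 1 by case=> -[]; lin.
  move=> i j p iD bi bj; have [p0|p0] := eqVneq p.2 2^-1.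
    have K := K1 _ (L1 _ iD p0) p0.
    pieces bj i bi j bj.
    + exact: twinD_l (twinD_sym K).
    + exact: twinD_sym.
    + exact: K.
    + exact: twinD_l K.
  have [p1|p1] := eqVneq p.2 (3 / 4).
    have K := K2 _ (L2 _ iD p1) p1.
    pieces bj i bi j bj.
    + exact: twinD_l K.
    + exact: K.
    + exact: twinD_sym.
    + exact: twinD_l (twinD_sym K).
  pieces bj i bi j bj;
    apply: twinD_inD => //.
  + by have [|? ?] := inD_high iD; [lin|apply: Or32 => /=; lin].
  + by have [|? ?] := inD_high iD; [lin|apply: Or31 => /=; lin].
  + by have [|? ?] := inD_low iD; [lin|apply: Or33 => /=; lin].
- move=> i j p q s bi bj.
  case: s => [px e1 e2 e3|b e d px e1 e2 e3|b e d px e1 e2 e3|e d e1 py e2 e3|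
        e d e1 py e2 e3|e d e1 py e2 e3|e d e1 py e2 e3].
  + pieces q i bi j bj.
    by apply/twinD_side/(uncurry4 (side_C' (@dyadicT R))) => /=; lin.
  + dyb; pieces q i bi j bj.
    by apply/twinD_side/(uncurry4 (side_C' (dyadic_half d))) => /=; lin.
  + dyb; pieces q i bi j bj.
    by apply/twinD_side/(uncurry4 (side_C'' (dyadic_half d))) => /=; lin.
  + dyb; case: (dyadic_half_cases d) => [[_ eE]|[d2 e4 e8]]; rewrite ?eE in py e3 *;
    pieces q i bi j bj.
      by apply: twinD_inD => /=; [apply: Or32; split=> /=|..]; lin.
    by apply/twinD_side/(uncurry4 (side_Ae d2)) => /=; lin.
  + dyb; have d2 := dyadicF_double d;
    pieces q i bi j bj.
    by apply/twinD_side/(uncurry4 (side_Ao d2)) => /=; lin.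
  + dyb; case: (dyadic_half_cases d) => [[_ eE]|[d2 e4 /(_ isT) e8]]; rewrite ?eE in py e3 *;
    pieces q i bi j bj.
      by apply: twinD_inD => /=; [apply: Or31; split=> /=|..]; lin.
    by apply/twinD_side/(uncurry4 (side_Be d2)) => /=; lin.
  + dyb; have d2 := dyadicF_double d;
    pieces q i bi j bj.
    by apply/twinD_side/(uncurry4 (side_Bo d2)) => /=; lin.
Qed.

Lemma exists_psi : exists psi : homeo X, [/\ is_psi psi, Aff R psi, Aff R (homeoV psi) &
   induces psi_box psi_mx psi_shift psi].
Proof.
have [psi [a aV i iV]] : exists phi : homeo X, [/\ Aff R phi, Aff R (homeoV phi),
    induces psi_box psi_mx psi_shift phi & induces psiV_box psiV_mx psiV_shift (homeoV phi)].
  apply: piecewise_homeo psi_piecewise psiV_piecewise _ _.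
    move=> i p; rewrite [RHS]surjective_pairing.
    case: i => [[]|] [/= b1 b2]; (split; [split=> /=; lin|]);
    by rewrite [LHS]surjective_pairing; congr pair => /=; lin.
  move=> i p; rewrite [RHS]surjective_pairing.
  case: i => [[]|] [/= b1 b2]; (split; [split=> /=; lin|]);
  by rewrite [LHS]surjective_pairing; congr pair => /=; lin.
exists psi; split=> //.
have ind j (F : plane R -> plane R) : (forall p, act psi_mx p + psi_shift j = F p) ->
    induced_on psi (psi_box j) F.
  move=> FE p Pp; have Dp := Dstar_val p; rewrite XpE (i j)// FE.
  have := piece_Dstar psi_piecewise Dp Pp; rewrite FE => DF.
  by exists (Dpt (F (val p))); [exact: val_Dpt|].
split; [apply: (ind None)|apply: (ind (Some true))|apply: (ind (Some false))] => p;
  rewrite [LHS]surjective_pairing; congr pair => /=; lin.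
Qed.

Lemma exists_rho : exists rho : homeo X, [/\ is_rho rho, Aff R rho &
   induces rho_box rho_mx rho_shift rho].
Proof.
have [rho [a _ i _]] : exists phi : homeo X, [/\ Aff R phi, Aff R (homeoV phi),
    induces rho_box rho_mx rho_shift phi &
    induces (rho_box \o negb) rho_mx (rho_shift \o negb) (homeoV phi)].
  (* Since [rho] exchanges the two boxes, its inverse on the image of piece [i] is the formula of
     the other piece. *)
  have pw : piecewise (rho_box \o negb) rho_mx (rho_shift \o negb).
    case: rho_piecewise => c cl pI pS; split=> /=.
    - by move=> p /c[b ?]; exists (~~ b); rewrite /= negbK.
    - by move=> b p; exact: cl.
    - by move=> b b' p; exact: pI.
    - by move=> b b' p q; exact: pS.
  apply: piecewise_homeo rho_piecewise pw _ _.
    move=> b p; rewrite [RHS]surjective_pairing.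
    case: b => [] [/= b1 b2]; (split; [split=> /=; lin|]);
    by rewrite [LHS]surjective_pairing; congr pair => /=; lin.
  move=> b p; rewrite [RHS]surjective_pairing.
  case: b => [] [/= b1 b2]; (split; [split=> /=; lin|]);
  by rewrite [LHS]surjective_pairing; congr pair => /=; lin.
exists rho; split=> //.
have ind j (F : plane R -> plane R) : (forall p, act rho_mx p + rho_shift j = F p) ->
    induced_on rho (rho_box j) F.
  move=> FE p Pp; have Dp := Dstar_val p; rewrite XpE (i j)// FE.
  have := piece_Dstar rho_piecewise Dp Pp; rewrite FE => DF.
  by exists (Dpt (F (val p))); [exact: val_Dpt|].
split; [apply: (ind true)|apply: (ind false)] => p;
  rewrite [LHS]surjective_pairing; congr pair => /=; lin.
Qed.

End Generators.

(** * Geodesics leaving the end (0, 2/3) *)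

Section Rays.
Variable R : realType.
Notation X := (Xinf R).
Notation matrix := (plane R * plane R)%type.
Implicit Types (e r s t S : R) (p q w v z h m : plane R) (A B : matrix).

Lemma limit_eq (phi : X -> X) q v q' v' e : continuous phi -> 0 < e -> Dstar q -> Dstar q' ->
  (forall s, 0 < s < e -> [/\ Dstar (q + sc s v), Dstar (q' + sc s v') &
     phi (Xp (q + sc s v)) = Xp (q' + sc s v')]) -> phi (Xp q) = Xp q'.
Proof.
move=> cphi e0 Dq Dq' H; apply: contrapT => /X_sep[U [V [oU oV Uq Vq UV]]].
have [r r0 rP] := open_preimage_Xp cphi Dq oU Uq.
have nV := open_nbhs_nbhs (conj oV Vq); have [r' r'0 r'P] := nbhs_Xp Dq' nV.
have [d d0 dP] := sc_small v r0; have [d' d'0 d'P] := sc_small v' r'0.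
have [s [s0 sd sd' se]] : exists s, [/\ 0 < s, s < d, s < d' & s < e].
  exists (Num.min (Num.min d d') e / 2).
  have [md md' me] : [/\ Num.min (Num.min d d') e <= d, Num.min (Num.min d d') e <= d'
     & Num.min (Num.min d d') e <= e] by rewrite !ge_min !lexx !orbT.
  have m0 : 0 < Num.min (Num.min d d') e by rewrite !lt_min d0 d'0 e0.
  by split; lin.
have [Ds Ds' Es] := H s ltac:(lin).
apply: (UV (phi (Xp (q + sc s v)))); first by apply: rP => //; apply: dP; lin.
by rewrite Es; apply: r'P => //; apply: d'P; lin.
Qed.

Definition q0 : plane R := (0, 2 / 3).

Definition inU p := 0 < p.1 < 1 /\ 2^-1 < p.2 < 1.

Lemma inU_inD p : inU p -> inD p. Proof. exact: Or31. Qed.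

Lemma segment_between (a b x y s : R) : 0 <= s <= 1 -> a < x < b -> a < y < b ->
  a < x + s * (y - x) < b.
Proof.
move=> s01 xab yab; have [->|s1] := eqVneq s 1; first lin.
have s1' : 0 < 1 - s by rewrite subr_gt0 lt_neqAle s1; lin.
have : 0 < (1 - s) * (x - a) by apply: mulr_gt0; lin.
have : 0 < (1 - s) * (b - x) by apply: mulr_gt0; lin.
have s0 : 0 <= s by lin.
have : 0 <= s * (y - a) by apply: mulr_ge0; lin.
have : 0 <= s * (b - y) by apply: mulr_ge0; lin.
by rewrite !mulrBr !mulrBl; lin.
Qed.

Lemma Aff_matrix_inU (phi : homeo X) : Aff R phi ->
  exists A, forall p, inU p -> affine_at phi p A.
Proof.
move=> aff; have U0 : inU (2^-1, 3 / 4) by split=> /=; lin.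
have [A aA] := Aff_affine_at aff (inU_inD U0); exists A => p Up.
have pE : p = (2^-1, 3 / 4) + sc 1 (p - (2^-1, 3 / 4)).
  by rewrite [LHS]surjective_pairing [RHS]surjective_pairing; congr pair => /=; ring.
rewrite pE; apply: affine_at_segment => // s s01.
case: Up U0 => /= p1 p2 [u1 u2].
by apply/inU_inD; split; apply: segment_between.
Qed.

Lemma affine_at_intro (phi : homeo X) p z A r : 0 < r -> Dstar z ->
  (forall w, square r w -> Dstar (z + act A w) /\ phi (Xp (p + w)) = Xp (z + act A w)) ->
  affine_at phi p A.
Proof.
move=> r0 Dz H; have [d cd dz] := chart_exists (Xp z).
have [k [r1 r10 rP]] := chart_local cd Dz dz.
have [r2 r20 r2P] := act_small A r10.
exists d, (z + k), (Num.min r r2); split=> //; first by rewrite lt_min r0.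
move=> w /square_min[wr w2]; have [Dw ->] := H _ wr.
by have [? ->] := rP _ (r2P _ w2) Dw; split=> //; rewrite addrAC.
Qed.

(** The margins add up to the distance from [q0] to the bottom of the upper square: 1/24 + 1/8 = 2/3
    - 1/2. *)
Lemma inU_near_q0 (x u g : R) (h : plane R) : 0 < x * h.1 < 24^-1 ->
  - 24^-1 < x * h.2 < 24^-1 -> - 8^-1 <= u * g <= 8^-1 ->
  inU (q0 + sc x h + sc u (0, g)).
Proof. by move=> ? ? ?; split=> /=; rewrite ?mulr0 ?addr0; lin. Qed.

Section OneRay.
Variables (phi : homeo X) (A : matrix) (h m : plane R).
Hypotheses (aA : forall p, inU p -> affine_at phi p A) (h0 : 0 < h.1)
  (hm : act A h = sc (- 1) m) (q0_removed : ~ Dstar q0).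

Let cphi : continuous phi. Proof. by have [] := homeo_inv_funP phi. Qed.
Let cphiV : continuous (homeo_inv_fun phi). Proof. by have [] := homeo_inv_funP phi. Qed.
Let phiK : cancel phi (homeo_inv_fun phi). Proof. by have [] := homeo_inv_funP phi. Qed.

(** The start [t = 0] is the removed point [q0]. By [hm] the image of the ray has direction [- m],
    so [m] follows that image back towards its start. *)
Definition ray t0 := 0 < t0 /\ forall t, 0 < t <= t0 -> inU (q0 + sc t h).

Lemma ray_le t0 t : ray t0 -> 0 < t <= t0 -> ray t.
Proof.
move=> [_ H] /andP[t_gt0 tt0]; split=> // s /andP[s_gt0 st].
by apply: H; rewrite s_gt0 (le_trans st).
Qed.

Lemma ray_exists : exists2 t0, t0 <= 8^-1 & ray t0.
Proof.
have [d d0 dP] := @sc_small R 8^-1 h ltac:(lin).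
have [m1 m2] : Num.min (d / 2) 8^-1 <= d / 2 /\ Num.min (d / 2) 8^-1 <= 8^-1.
  by rewrite !ge_min !lexx orbT.
exists (Num.min (d / 2) 8^-1) => //; split; first by rewrite lt_min; lin.
move=> t tm; have [/= h1 h2] := dP t ltac:(lin).
have ? : 0 < t * h.1 by apply: mulr_gt0 => //; lin.
by split=> /=; lin.
Qed.

Lemma ray_path t0 z S : ray t0 -> phi (Xp (q0 + sc t0 h)) = Xp z -> 0 <= S < t0 ->
  (forall s, 0 <= s <= S -> Dstar (z + sc s m)) ->
  phi (Xp (q0 + sc (t0 - S) h)) = Xp (z + sc S m).
Proof.
move=> [t00 U0] e S0 H.
have mE : m = act A (sc (- 1) h).
  by rewrite act_sc hm [m]surjective_pairing /sc /= !mulN1r !opprK.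
have pE s : q0 + sc (t0 - s) h = q0 + sc t0 h + sc s (sc (- 1) h).
  by rewrite scD addrA /sc /=; congr (_ + (_, _)); ring.
rewrite pE mE; apply: path_image => //; first lin.
move=> s sS; rewrite -pE -mE; have Us := U0 (t0 - s) ltac:(lin).
by split; [exact: inU_inD|exact: aA|apply: H].
Qed.

(* The ray starts at the removed point [q0], so its image, run backwards from time
   [t0], must die exactly at time [t0]. *)
Lemma ray_dies t0 z : ray t0 -> phi (Xp (q0 + sc t0 h)) = Xp z ->
  (forall s, 0 <= s < t0 -> Dstar (z + sc s m)) -> ~ Dstar (z + sc t0 m).
Proof.
move=> rt e H Dq; apply: q0_removed.
apply: (@limit_Dstar _ (homeo_inv_fun phi) (z + sc t0 m) (sc (- 1) m) q0 h t0) => //.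
  by case: rt.
move=> s st; have zE : z + sc t0 m + sc s (sc (- 1) m) = z + sc (t0 - s) m.
  by rewrite scD addrA /sc /=; congr (_ + (_, _)); ring.
rewrite zE; split.
- by apply: H; lin.
- by apply/inD_Dstar/inU_inD; apply: rt.2; lin.
- rewrite -(@ray_path t0 z (t0 - s)) ?subKr ?phiK//; first lin.
  by move=> u ut; apply: H; lin.
Qed.

(** Dying earlier than [S] is impossible because the image is still on the surface; dying later
    would make [z + sc S m] the limit of images around an existing point of the ray. *)
Lemma ray_dies_at t0 z S : ray t0 -> phi (Xp (q0 + sc t0 h)) = Xp z -> 0 < S ->
  (forall s, 0 <= s < S -> Dstar (z + sc s m)) -> ~ Dstar (z + sc S m) -> t0 = S.
Proof.
move=> rt e S0 H nD; have [tS|St|//] := ltgtP t0 S.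
  exfalso; apply: (ray_dies rt e); first by move=> s st; apply: H; lin.
  by apply: H; case: rt => ? _; lin.
exfalso; apply: nD.
have Ut := rt.2 (t0 - S) ltac:(lin).
apply: (@limit_Dstar _ phi (q0 + sc (t0 - S) h) h (z + sc S m) (sc (- 1) m) S) => //.
  exact/inD_Dstar/inU_inD.
move=> s sS; have zE : z + sc S m + sc s (sc (- 1) m) = z + sc (S - s) m.
  by rewrite scD addrA /sc /=; congr (_ + (_, _)); ring.
have qE : q0 + sc (t0 - S) h + sc s h = q0 + sc (t0 - (S - s)) h.
  by rewrite -addrA -scD; congr (_ + sc _ _); ring.
rewrite zE qE; split.
- by apply/inD_Dstar/inU_inD; apply: rt.2; lin.
- by apply: H; lin.
- by apply: ray_path => //; [lin|move=> u us; apply: H; lin].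
Qed.

(* If the ray ends at a removed point [q] next to which the surface continues
   regularly in the direction of the image of the left edge of [inU], then the
   removed points of that edge accumulating at [q0] would have regular images. *)
Lemma ray_stop (dir : set (plane R)) (sg : R) t0 z S delta :
  (forall eps, 0 < eps -> exists t, [/\ 0 < t, t < eps & ~ Dstar (q0 + sc t (0, sg))]) ->
  `|sg| = 1 ->
  (forall t v, 0 < t -> dir v -> dir (sc t v)) -> dir (act A (0, sg)) -> 0 < delta ->
  ray t0 -> phi (Xp (q0 + sc t0 h)) = Xp z -> 0 < S ->
  (forall s, 0 <= s < S -> Dstar (z + sc s m)) -> ~ Dstar (z + sc S m) ->
  (forall v eps, square delta v -> 0 <= eps < delta -> dir v \/ v = 0 /\ 0 < eps ->
     Dstar (z + sc S m + v + sc (- eps) m)) -> False.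
Proof.
move=> removed sg1 dir_sc dirA delta0 rt e S0 H nD quad.
have tS := ray_dies_at rt e S0 H nD; subst S.
set q := z + sc t0 m in nD quad.
have [d d0 dP] := sc_small (act A (0, sg)) delta0.
have [t [t_gt0 t_lt nDt]] := removed (Num.min d 8^-1) ltac:(by rewrite lt_min d0; lin).
have [m1 m2] : Num.min d 8^-1 <= d /\ Num.min d 8^-1 <= 8^-1 by rewrite !ge_min !lexx orbT.
apply: nDt; have [d' d'0 d'P] := @sc_small R 24^-1 h ltac:(lin).
have tsg u : 0 <= u <= t -> - 8^-1 <= u * sg <= 8^-1.
  by move=> ut; rewrite -ler_norml normrM sg1 mulr1 ger0_norm; lin.
pose eps := Num.min (Num.min d' delta) t0.
have [me1 me2 me3] : [/\ eps <= d', eps <= delta & eps <= t0].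
  by rewrite /eps !ge_min !lexx !orbT.
have eps0 : 0 < eps by rewrite !lt_min d'0 delta0 S0.
(* The vertical segment of length [t] above or below [q0] is pushed off the left side by [sc s h];
   [quad] keeps its image on the surface. *)
have key s : 0 < s < eps -> phi (Xp (q0 + sc s h + sc t (0, sg))) =
    Xp (q + sc (- s) m + sc t (act A (0, sg))).
  move=> seps; have [/= h1 h2] := d'P s ltac:(lin).
  have sh : 0 < s * h.1 by apply: mulr_gt0 => //; lin.
  have b u : 0 <= u <= t -> inU (q0 + sc s h + sc u (0, sg)).
    by move=> /tsg ut; apply: inU_near_q0 => //; rewrite sh; case/andP: h1.
  apply: path_image => //; first lin.
    move=> u ut; split; [exact/inU_inD/b|exact/aA/b|].
    rewrite addrAC; apply: quad; [apply: dP; lin|lin|].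
    have [->|u0] := eqVneq u 0; first by right; rewrite sc0; split=> //; lin.
    by left; apply: dir_sc => //; rewrite lt_neqAle eq_sym u0; lin.
  rewrite /q -addrA -scD -(@ray_path t0 z) ?subKr//; first lin.
  by move=> u us; apply: H; lin.
(* Letting [s] tend to 0, the inverse map carries the regular image point to the removed point at
   height [t], which is absurd. *)
apply: (@limit_Dstar _ (homeo_inv_fun phi) (q + sc t (act A (0, sg))) (sc (- 1) m)
   (q0 + sc t (0, sg)) h eps) => //.
  have := quad (sc t (act A (0, sg))) 0; rewrite oppr0 sc0 addr0; apply.
  - by apply: dP; lin.
  - by lin.
  - by left; exact: dir_sc.
move=> s seps; have scN : sc s (sc (- 1) m) = sc (- s) m by rewrite /sc /=; congr pair; ring.
rewrite scN; split.
- apply: quad; [apply: dP; lin|lin|left; exact: dir_sc].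
- have [/= h1 h2] := d'P s ltac:(lin).
  have sh : 0 < s * h.1 by apply: mulr_gt0 => //; lin.
  have ut := tsg t ltac:(lin); rewrite addrAC; apply/inD_Dstar/inU_inD; apply: inU_near_q0 => //.
  by rewrite sh; case/andP: h1.
- rewrite (addrAC q) -key//; first by rewrite phiK addrAC.
Qed.

End OneRay.
End Rays.

(** * The removed points and the regular points beside them *)

Section Vertices.
Variable R : realType.
Implicit Types (e r s t : R) (p q : plane R).

Lemma Dstar_A b e p : dyadic b e -> p.1 = 1 -> 1 - e < p.2 < 1 - e / 2 -> Dstar p.
Proof.
case: b => d p1 p2.
  by apply: (@sidel_Dstar _ _ (- 2^-1, p.2 - (2 - e) / 3)); exact: (side_Ao d).
by apply: (@sidel_Dstar _ _ (0, p.2 - (1 - e) / 3)); exact: (side_Ae d).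
Qed.

Lemma Dstar_B b e p : dyadic b e -> p.1 = 2^-1 -> e / 2 < p.2 < e -> Dstar p.
Proof.
case: b => d p1 p2.
  by apply: (@sidel_Dstar _ _ (0, p.2 + (2 - e) / 3)); exact: (side_Bo d).
by apply: (@sidel_Dstar _ _ (- 2^-1, p.2 + (1 - e) / 3)); exact: (side_Be d).
Qed.

Lemma Dstar_C' b e p : dyadic b e -> 1 - 2 * e < p.1 < 1 - 3 / 2 * e -> p.2 = 1 -> Dstar p.
Proof.
move=> d p1 p2; apply: (@sidel_Dstar _ _ (p.1 - 2^-1 + e / 2, 0)).
exact: (side_C' d).
Qed.

Lemma Dstar_C'' b e p : dyadic b e -> 1 - 3 / 2 * e < p.1 < 1 - e -> p.2 = 1 -> Dstar p.
Proof.
move=> d p1 p2; apply: (@sidel_Dstar _ _ (p.1 - 2^-1 - e / 2, 0)).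
exact: (side_C'' d).
Qed.

Lemma Dstar_H p : - 2^-1 < p.1 < 0 -> p.2 = 2^-1 -> Dstar p.
Proof. by move=> p1 p2; apply: (@sidel_Dstar _ _ (p.1 + 1, 2^-1)); exact: side_H. Qed.

(** Above height 2/3 the left side carries the partners of the odd [B_n], below it those of the even
    [A_n]; measured from 2/3, each fills an interval of ratio 4. *)
Lemma Dstar_left0 b e p : dyadic b e -> p.1 = 0 ->
  e / 6 < (if b then p.2 - 2 / 3 else 2 / 3 - p.2) < 2 / 3 * e -> Dstar p.
Proof.
case: b => d p1 p2.
  by apply: (@sider_Dstar _ (2^-1, p.2 - (2 - e) / 3)); apply: (side_Bo d) => /=; lin.
by apply: (@sider_Dstar _ (1, p.2 + (1 - e) / 3)); apply: (side_Ae d) => /=; lin.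
Qed.

Lemma Dstar_left1 b e p : dyadic b e -> p.1 = - 2^-1 ->
  e / 6 < (if b then 3^-1 - p.2 else p.2 - 3^-1) < 2 / 3 * e -> Dstar p.
Proof.
case: b => d p1 p2.
  by apply: (@sider_Dstar _ (1, p.2 + (2 - e) / 3)); apply: (side_Ao d) => /=; lin.
by apply: (@sider_Dstar _ (2^-1, p.2 - (1 - e) / 3)); apply: (side_Be d) => /=; lin.
Qed.

Lemma right_inv p : Dstar p -> p.1 = 1 ->
  exists b e, dyadic b e /\ 1 - e < p.2 < 1 - e / 2.
Proof.
move=> /DstarP[[] []|[q []]|[q []]] *; dyb; try (by do 2!eexists; split; eassumption);
  exfalso; lin.
Qed.

Lemma mid_inv p : Dstar p -> p.1 = 2^-1 -> p.2 <= 2^-1 ->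
  exists b e, dyadic b e /\ e / 2 < p.2 < e.
Proof.
move=> /DstarP[[] []|[q []]|[q []]] *; dyb; try (by do 2!eexists; split; eassumption);
  exfalso; lin.
Qed.

Lemma top_inv p : Dstar p -> p.2 = 1 -> exists b e, dyadic b e /\
  (1 - 2 * e < p.1 < 1 - 3 / 2 * e \/ 1 - 3 / 2 * e < p.1 < 1 - e).
Proof.
move=> /DstarP[[] []|[q []]|[q []]] *; dyb;
  try (by do 2!eexists; split; [eassumption|left]);
  try (by do 2!eexists; split; [eassumption|right]);
  exfalso; lin.
Qed.

Lemma left0_inv p : Dstar p -> p.1 = 0 -> 2^-1 <= p.2 -> exists b e, dyadic b e /\
  e / 6 < (if b then p.2 - 2 / 3 else 2 / 3 - p.2) < 2 / 3 * e.
Proof.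
move=> /DstarP[[] []|[q []]|[q []]] *; dyb; first [by exfalso; lin|
  match goal with H : dyadic ?b ?e |- _ => by exists b, e; split=> //; lin end].
Qed.

Lemma left1_inv p : Dstar p -> p.1 = - 2^-1 -> exists b e, dyadic b e /\
  e / 6 < (if b then 3^-1 - p.2 else p.2 - 3^-1) < 2 / 3 * e.
Proof.
move=> /DstarP[[] []|[q []]|[q []]] *; dyb; first [by exfalso; lin|
  match goal with H : dyadic ?b ?e |- _ => by exists b, e; split=> //; lin end].
Qed.

Lemma removed_right b e p : dyadic b e -> p.1 = 1 -> p.2 = 1 - e / 2 -> ~ Dstar p.
Proof.
move=> d p1 p2 /right_inv[//|b' [e' [d' e'p]]].
by have [e1 _] := dyadic_eq d d' ltac:(lin) ltac:(lin); lin.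
Qed.

Lemma removed_mid b e p : dyadic b e -> p.1 = 2^-1 -> p.2 = e -> ~ Dstar p.
Proof.
move=> d p1 p2 /mid_inv[//||b' [e' [d' e'p]]]; first by have := dyadic_le d; lin.
by have [e1 _] := dyadic_eq d d' ltac:(lin) ltac:(lin); lin.
Qed.

Lemma removed_top b e p : dyadic b e -> p.2 = 1 ->
  [\/ p.1 = 1 - 2 * e, p.1 = 1 - 3 / 2 * e | p.1 = 1 - e] -> ~ Dstar p.
Proof.
move=> d p2 p1 /top_inv[//|b' [e' [d' e'p]]].
have [d0 d'0] := (dyadic_gt0 d, dyadic_gt0 d').
case: p1 => p1.
- have [[_ e2]|d2] := dyadic_double d; first by have := dyadic_le d'; lin.
  by have [e1 _] := dyadic_eq d2 d' ltac:(lin) ltac:(lin); lin.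
- by have [e1 _] := dyadic_eq d d' ltac:(lin) ltac:(lin); lin.
- by have [e1 _] := dyadic_eq d d' ltac:(lin) ltac:(lin); lin.
Qed.

Lemma removed_left0 b e p : dyadic b e -> p.1 = 0 ->
  (if b then p.2 - 2 / 3 else 2 / 3 - p.2) = 2 / 3 * e -> ~ Dstar p.
Proof.
move=> d p1 p2 /left0_inv[//||b' [e' [d' e'p]]].
  by have := dyadic_gt0 d; case: b d p2 => d; [lin|have := dyadicF_le d; lin].
have [d0 d'0] := (dyadic_gt0 d, dyadic_gt0 d').
have bb : b = b' by case: b b' p2 e'p {d d'} => [] [] //; lin.
rewrite -bb p2 in d' e'p.
by have e1 := dyadic_eq4 d d' ltac:(lin) ltac:(lin); lin.
Qed.

Lemma removed_q0 : ~ Dstar (@q0 R).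
Proof.
move=> Dq; have [|[] [e [d]]] := left0_inv Dq erefl; rewrite /q0 /=; first lin.
all: by have := dyadic_gt0 d; lin.
Qed.

Lemma removed_q1 : ~ Dstar (- 2^-1, 3^-1 : R).
Proof.
by move=> Dq; have [[] [e [d]]] := left1_inv Dq erefl => /=; have := dyadic_gt0 d; lin.
Qed.

Lemma removed_corner p : p.1 = 0 \/ p.1 = - 2^-1 -> p.2 = 2^-1 -> ~ Dstar p.
Proof.
move=> p1 p2 Dp; case: p1 => p1.
  have [|[] [e [d]]] := left0_inv Dp p1; first lin; have := dyadic_gt0 d; first lin.
  by have := dyadicF_le d; lin.
have [[] [e [d]]] := left1_inv Dp p1; have := dyadic_gt0 d; first lin.
by have := dyadicF_le d; lin.
Qed.

Lemma dyadic_small b (eps : R) : 0 < eps -> exists2 e, dyadic b e & e < eps.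
Proof.
move=> eps0; pose t := Num.min eps 4^-1 / 2.
have [m1 m2] : Num.min eps 4^-1 <= eps /\ Num.min eps 4^-1 <= 4^-1.
  by rewrite !ge_min !lexx orbT.
have m0 : 0 < Num.min eps 4^-1 by rewrite lt_min eps0; lin.
have [||b' [e [d et]]] := @dyadic_bracket R t; rewrite /t; try lin.
have [bb|bb] := eqVneq b b'; first by exists (e / 2 / 2);
  [|rewrite /t in et; lin]; rewrite bb -(negbK b'); do 2!apply: dyadic_half.
exists (e / 2); last by rewrite /t in et; lin.
by have := dyadic_half d; case: (b) (b') bb => [] [].
Qed.

(** Brackets by values of a single parity. The bounds 1/3 and 1/6 are [2 / 3 * e] for the largest
    odd and even values, 1/2 and 1/4. *)
Lemma dyadic_bracket4 b s : 0 < s -> s < (if b then 3^-1 else 6^-1) ->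
  exists2 e, dyadic b e & e / 6 <= s < 2 / 3 * e.
Proof.
move=> s0 sb; have [||b' [e [d et]]] := @dyadic_bracket R (3 / 2 * s); [lin|by case: (b) sb; lin|].
have [bb|bb] := eqVneq b b'; first by exists e; [rewrite bb|lin].
have [[b't e2]|d2] := dyadic_double d.
  by move: bb sb; rewrite b't; case: (b) => //; lin.
exists (2 * e); last lin.
by move: d2 bb; case: (b) (b') => [] [].
Qed.

(** The edges of one parity fill the side up to their endpoints, and the inner endpoint [e / 6] of
    one is the outer endpoint of the next, with parameter [e / 4]. *)
Lemma removed_left0_inv b s : 0 < s -> s < (if b then 3^-1 else 6^-1) ->
  ~ Dstar (@q0 R + sc s (0, (if b then 1 else -1))) -> exists2 e, dyadic b e & s = 2 / 3 * e.
Proof.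
move=> s0 sb nD; have [e d es] := dyadic_bracket4 s0 sb.
have [e6|e6] := eqVneq s (e / 6).
  exists (e / 2 / 2); last lin.
  by rewrite -(negbK b); do 2!apply: dyadic_half.
exfalso; apply/nD/(Dstar_left0 d); first by rewrite /= mulr0 addr0.
by move: sb; case: (b) => /= _; rewrite /q0 /=; lin.
Qed.

Lemma removed_near_q0 b (eps : R) : 0 < eps ->
  exists t, [/\ 0 < t, t < eps & ~ Dstar (@q0 R + sc t (0, (if b then 1 else -1)))].
Proof.
move=> eps0; have [e d ee] := @dyadic_small b eps eps0; have := dyadic_gt0 d.
exists (2 / 3 * e); split; try lin.
apply: (removed_left0 d); first by rewrite /= mulr0 addr0.
by case: (b) => /=; lin.
Qed.

Lemma top_regular_right x : 0 < x < 1 ->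
  exists2 r, 0 < r & forall p, x < p.1 < x + r -> p.2 = 1 -> Dstar p.
Proof.
move=> x01; have [||b [e [d ex]]] := @dyadic_bracket R ((1 - x) / 2); [lin|lin|].
have [x1|x1] := ltP x (1 - 3 / 2 * e).
  by exists (1 - 3 / 2 * e - x) => [|p px]; [lin|apply: (Dstar_C' d); lin].
have [x2|x2] := ltP x (1 - e).
  by exists (1 - e - x) => [|p px]; [lin|apply: (Dstar_C'' d); lin].
have := dyadic_gt0 d.
by exists (e / 4) => [|p px]; [lin|apply: (Dstar_C' (dyadic_half d)); lin].
Qed.

Lemma right_regular_below y : 2^-1 < y < 1 ->
  exists2 r, 0 < r & forall p, y - r < p.2 < y -> p.1 = 1 -> Dstar p.
Proof.
move=> y01; have [||b [e [d ey]]] := @dyadic_bracket R (1 - y); [lin|lin|].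
by exists (y - 1 + e) => [|p py]; [lin|move=> p1; apply: (Dstar_A d p1); lin].
Qed.

Lemma mid_regular_below y : 0 < y < 2^-1 ->
  exists2 r, 0 < r & forall p, y - r < p.2 < y -> p.1 = 2^-1 -> Dstar p.
Proof.
move=> y01; have [||b [e [d ey]]] := @dyadic_bracket R y; [lin|lin|].
have := dyadic_gt0 d.
have [y1|y1] := eqVneq y (e / 2).
  by exists (e / 4) => [|p py]; [lin|move=> p1; apply: (Dstar_B (dyadic_half d) p1); lin].
by exists (y - e / 2) => [|p py]; [lin|move=> p1; apply: (Dstar_B d p1); lin].
Qed.

(** The regular direction chosen is the one away from height 2/3, where the edges accumulate. *)
Lemma left0_regular y : 2^-1 < y < 1 -> y != 2 / 3 -> exists (b : bool) r, 0 < r /\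
  forall p, p.1 = 0 -> 0 < (if b then p.2 - y else y - p.2) < r -> Dstar p.
Proof.
move=> y01 y23; exists (2 / 3 < y).
have s0 : 0 < (if 2 / 3 < y then y - 2 / 3 else 2 / 3 - y).
  by case: (ltP (2 / 3) y) => /= ?; lin.
have [|e d es] := dyadic_bracket4 (b := 2 / 3 < y) s0.
  by case: (ltP (2 / 3) y) => /= _; lin.
exists (2 / 3 * e - (if 2 / 3 < y then y - 2 / 3 else 2 / 3 - y)); split; first lin.
move=> p p1 pr; apply: (Dstar_left0 d p1).
by move: es pr; case: (ltP (2 / 3) y) => /= _; lin.
Qed.

Lemma left1_regular y : 0 < y < 2^-1 -> y != 3^-1 -> exists (b : bool) r, 0 < r /\
  forall p, p.1 = - 2^-1 -> 0 < (if b then p.2 - y else y - p.2) < r -> Dstar p.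
Proof.
move=> y01 y3; exists (3^-1 < y).
have s0 : 0 < (if ~~ (3^-1 < y) then 3^-1 - y else y - 3^-1).
  by case: (ltP 3^-1 y) => /= ?; lin.
have [|e d es] := dyadic_bracket4 (b := ~~ (3^-1 < y)) s0.
  by case: (ltP 3^-1 y) => /= _; lin.
exists (2 / 3 * e - (if ~~ (3^-1 < y) then 3^-1 - y else y - 3^-1)); split; first lin.
move=> p p1 pr; apply: (Dstar_left1 d p1).
by move: es pr; case: (ltP 3^-1 y) => /= _; lin.
Qed.

End Vertices.

(** * Rays whose image is vertical *)

Section Vertical.
Variable R : realType.
Notation X := (Xinf R).
Notation matrix := (plane R * plane R)%type.
Implicit Types (e r s t S : R) (p q w v z m : plane R).

Definition sign b : R := if b then 1 else -1.

Lemma normr_sign b : `|sign b| = 1.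
Proof. by case: b; rewrite /sign ?normrN normr1. Qed.

Definition leftward : set (plane R) := [set v | v.1 < 0].
(** A half plane with half of its boundary: any vector that is not zero, or its opposite, belongs to
    it, also when the image of the vertical is horizontal. *)
Definition downward : set (plane R) := [set v | v.2 < 0 \/ v.2 = 0 /\ 0 < v.1].
Definition upright (b : bool) : set (plane R) := [set v | v.1 = 0 /\ 0 < sign b * v.2].

Lemma leftward_sc t v : 0 < t -> leftward v -> leftward (sc t v).
Proof. by move=> t0; rewrite /leftward /= pmulr_rlt0. Qed.

Lemma downward_sc t v : 0 < t -> downward v -> downward (sc t v).
Proof.
move=> t0; rewrite /downward /= pmulr_rlt0// => -[|[-> v1]]; first by left.
by right; rewrite mulr0 mulr_gt0.
Qed.

Lemma upright_sc b t v : 0 < t -> upright b v -> upright b (sc t v).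
Proof. by move=> t0 [v1 v2]; split; rewrite /= ?v1 ?mulr0// mulrCA mulr_gt0. Qed.

(* Following [m] from [z] one runs into a removed point next to which the surface
   is regular in the directions of the cone [dir]. *)
Definition dead_end (dir : set (plane R)) m z := exists S e1, [/\ 0 < S, 0 < e1,
  forall s, 0 <= s < S -> Dstar (z + sc s m), ~ Dstar (z + sc S m) &
  forall v eps, square e1 v -> 0 <= eps < e1 -> dir v ->
    Dstar (z + sc S m + v + sc (- eps) m)].

(** Upwards along a vertical edge one reaches its upper endpoint, which has interior points of [D]
    to its left. *)
Lemma up_from_side z q : side z q ->
  (z.2 = 1 \/ z.2 = 2^-1 /\ z.1 < 0) \/ dead_end leftward (0, 1) z.
Proof.
case=> [? ? ? ?|b e1 d1 ? ? ? ?|b e1 d1 ? ? ? ?|e1 d1 z1 z2 ? ?|e1 d1 z1 z2 ? ?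
  |e1 d1 z1 z2 ? ?|e1 d1 z1 z2 ? ?].
1-3: by left; lin.
1,2: right; have := dyadic_gt0 d1 => e10; have e12 := dyadic_le d1;
  exists (1 - e1 / 2 - z.2), (e1 / 4); split; [lin|lin
  |move=> s sS; apply: (Dstar_A d1) => /=; lin
  |apply: (removed_right d1) => /=; lin
  |move=> v eps [v1 v2] ee; rewrite /leftward /= => vl; apply/inD_Dstar/Or31 => /=; lin].
1,2: right; have := dyadic_gt0 d1 => e10; have e12 := dyadic_le d1;
  exists (e1 - z.2), (e1 / 2); split; [lin|lin
  |move=> s sS; apply: (Dstar_B d1) => /=; lin
  |apply: (removed_mid d1) => /=; lin
  |move=> v eps [v1 v2] ee; rewrite /leftward /= => vl; apply/inD_Dstar/Or33 => /=; lin].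
Qed.

Lemma up_from_inD z : inD z ->
  (exists S, [/\ 0 < S, forall s, 0 <= s <= S -> Dstar (z + sc s (0, 1)) &
     z.2 + S = 1 \/ z.2 + S = 2^-1 /\ z.1 < 0]) \/ dead_end downward (0, 1) z.
Proof.
move=> iD; have [zl|zl|zl] := ltgtP z.1 0.
- have [? ?] := inD_left iD zl; left; exists (2^-1 - z.2); split; [lin| |lin].
  move=> s sS; have [sE|sE] := eqVneq s (2^-1 - z.2); first by apply: Dstar_H => /=; lin.
  by apply/inD_Dstar/Or32 => /=; lin.
- have [z1 z2] := inD_bounds iD.
  have z3 : z.1 < 2^-1 \/ 2^-1 < z.2 by case: iD => -[]; lin.
  have zD s : 0 <= s < 1 - z.2 -> Dstar (z + sc s (0, 1)).
    move=> sz; apply: inD_Dstar.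
    by case: z3 => ?; [apply: Or33|apply: Or31]; split=> /=; lin.
  have [Dt|nDt] := pselect (Dstar (z + sc (1 - z.2) (0, 1))).
    left; exists (1 - z.2); split; [lin| |lin].
    by move=> s sS; have [->//|sE] := eqVneq s (1 - z.2); apply: zD; lin.
  have [r r0 rP] := @top_regular_right R z.1 ltac:(lin).
  pose e1 := Num.min r (Num.min z.1 (Num.min (1 - z.1) 8^-1)).
  have [m1 m2 m3 m4] : [/\ e1 <= r, e1 <= z.1, e1 <= 1 - z.1 & e1 <= 8^-1].
    by rewrite !ge_min !lexx !orbT.
  right; exists (1 - z.2), e1; split=> //; [lin|by rewrite !lt_min r0 zl; lin|].
  move=> v eps [v1 v2] ee [vd|[vd vr]]; first by apply/inD_Dstar/Or31 => /=; lin.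
  have [E|E] := eqVneq eps 0; last by apply/inD_Dstar/Or31 => /=; lin.
  by apply: rP => /=; lin.
(* On the axis [z.1 = 0] the geodesic runs into the removed corner (0, 1/2). *)
- have z2 : 0 < z.2 < 2^-1 by case: iD => -[]; lin.
  right; exists (2^-1 - z.2), 4^-1; split; [lin|lin| | |].
  + by move=> s sS; apply/inD_Dstar/Or32 => /=; lin.
  + by apply: removed_corner; [left|] => /=; lin.
  + move=> v eps [v1 v2] ee [vd|[vd vr]]; first by apply/inD_Dstar/Or32 => /=; lin.
    have [E|E] := eqVneq eps 0; last by apply/inD_Dstar/Or32 => /=; lin.
    by apply/inD_Dstar/Or33 => /=; lin.
Qed.

Section Ray.
Variables (phi : homeo X) (A : matrix) (h : plane R).
Hypotheses (aA : forall p, inU p -> affine_at phi p A) (h0 : 0 < h.1).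

Lemma sign_leftward : A.2.1 != 0 -> exists b, leftward (act A (0, sign b)).
Proof.
move=> /lt_total/orP[?|?]; [exists true|exists false]; rewrite /leftward /sign /=; lin.
Qed.

Lemma sign_downward : A.2.1 != 0 -> exists b, downward (act A (0, sign b)).
Proof.
move=> A1; have [A2|A2|A2] := ltgtP A.2.2 0.
- by exists true; left; rewrite /sign /=; lin.
- by exists false; left; rewrite /sign /=; lin.
- by case/lt_total/orP: A1 => ?; [exists false|exists true]; right; rewrite /sign /= A2; lin.
Qed.

Lemma dead_end_no_ray m (dir : set (plane R)) t0 z : act A h = sc (- 1) m ->
  (forall t v, 0 < t -> dir v -> dir (sc t v)) ->
  (exists b, dir (act A (0, sign b))) ->
  ray h t0 -> phi (Xp (q0 R + sc t0 h)) = Xp z -> ~ dead_end dir m z.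
Proof.
move=> hm dir_sc [b dirb] rt ez [S [e1 [S0 e10 H nD quad]]].
(* The radius is cut down to [S] so that, for the zero displacement, [z + sc (S - eps) m] lies on
   the path already known to be on the surface. *)
apply: (ray_stop aA h0 hm (@removed_q0 R) (removed_near_q0 b) (normr_sign b) dir_sc dirb
  (delta := Num.min e1 S) _ rt ez S0 H nD); first by rewrite lt_min e10.
have [m1 m2] : Num.min e1 S <= e1 /\ Num.min e1 S <= S by rewrite !ge_min !lexx orbT.
move=> v eps ve epse [vl|[-> eps0]]; first by apply: quad => //; [exact: square_le ve|lin].
by rewrite addr0 -addrA -scD; apply: H; lin.
Qed.

Section Upwards.
Let m : plane R := (0, 1).
Hypotheses (hm : act A h = sc (- 1) m) (A21 : A.2.1 != 0).
Let dies := ray_dies aA h0 hm (@removed_q0 R).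

(** After crossing, the geodesic starts at the bottom of a square and has vertical room 1/2, more
    than the remaining time of at most 1/8. *)
Lemma up_cross t0 z q : t0 <= 8^-1 -> ray h t0 -> phi (Xp (q0 R + sc t0 h)) = Xp z ->
  side z q -> z.2 = 1 \/ z.2 = 2^-1 /\ z.1 < 0 -> False.
Proof.
move=> t08 rt e sz z2; have t00 := rt.1.
have {}e : phi (Xp (q0 R + sc t0 h)) = Xp q.
  rewrite e; apply/Xp_eqP; [exact: sidel_Dstar sz|exact: sider_Dstar sz|exact: Or32].
suff H s : 0 <= s <= t0 -> Dstar (q + sc s m).
  by apply: (dies rt e) => [s st|]; apply: H; lin.
move=> st; have [->|s0] := eqVneq s 0.
  by rewrite sc0 addr0; exact: sider_Dstar sz.
apply: inD_Dstar; case: sz => *; dyb; try (exfalso; clear - z2; lin).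
- by apply: Or31 => /=; lin.
- by apply: Or32 => /=; lin.
- by apply: Or32 => /=; lin.
all: exfalso; lin.
Qed.

Lemma up_reach t0 z S : t0 <= 8^-1 -> ray h t0 -> phi (Xp (q0 R + sc t0 h)) = Xp z ->
  0 < S -> (forall s, 0 <= s <= S -> Dstar (z + sc s m)) ->
  z.2 + S = 1 \/ z.2 + S = 2^-1 /\ z.1 < 0 -> False.
Proof.
move=> t08 rt e S0 H zS; have t00 := rt.1; have [tS|tS] := leP t0 S.
  by apply: (dies rt e) => [s st|]; apply: H; lin.
have e' : phi (Xp (q0 R + sc (t0 - S) h)) = Xp (z + sc S m).
  by apply: (ray_path aA h0 hm) => //; lin.
have [q sz] : exists q, side (z + sc S m) q.
  have /DstarP[iD|//|[p sp]] : Dstar (z + sc S m) by apply: H; lin.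
    by case: iD zS => -[/= ? ?]; lin.
  by case: sp zS => /= *; dyb; lin.
apply: (up_cross (t0 := t0 - S) _ _ e' sz) => /=; [lin|apply: ray_le rt _; lin|lin].
Qed.

Lemma no_upward_ray : False.
Proof.
have [t0 t08 rt] := ray_exists h0.
have [z Dz e] := Xp_surj (phi (Xp (q0 R + sc t0 h))).
have dom z' q : phi (Xp (q0 R + sc t0 h)) = Xp z' -> side z' q -> False.
  move=> ez sz; case: (up_from_side sz); first exact: (up_cross t08 rt ez sz).
  exact: dead_end_no_ray hm leftward_sc (sign_leftward A21) rt ez.
case/DstarP: (Dz) => [iD|[q sz]|[q sz]].
- case: (up_from_inD iD) => [[S [S0 zD zS]]|]; first exact: (up_reach t08 rt e S0 zD zS).
  exact: dead_end_no_ray hm downward_sc (sign_downward A21) rt e.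
- exact: dom e sz.
(* A point on a lower or left side is replaced by its twin, the left member of the pair. *)
- apply: (dom q z) => //; rewrite e; apply/Xp_eqP => //; [exact: sidel_Dstar sz|exact: Or33].
Qed.

End Upwards.
End Ray.
End Vertical.

(** * Rays whose image is horizontal *)

Section Horizontal.
Variable R : realType.
Notation X := (Xinf R).
Notation matrix := (plane R * plane R)%type.
Implicit Types (e r s t S : R) (p q w v z m : plane R).

Lemma upright_down v : upright false v -> v.1 = 0 /\ v.2 < 0.
Proof. by rewrite /upright /sign /= => -[? ?]; split; lin. Qed.

Lemma right_from_side z q : side z q ->
  (z.1 = 1 \/ z.1 = 2^-1 /\ z.2 < 2^-1) \/ dead_end (upright false) (1, 0) z.
Proof.
case=> [? ? ? ?|b e1 d1 ? ? ? ?|b e1 d1 ? ? ? ?|e1 d1 z1 z2 ? ?|e1 d1 z1 z2 ? ?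
  |e1 d1 z1 z2 ? ?|e1 d1 z1 z2 ? ?].
4-7: by left; have := dyadic_le d1; lin.
- right; exists (- z.1), 4^-1; split; [lin|lin| | |].
  + by move=> s sS; apply: Dstar_H => /=; lin.
  + by apply: removed_corner; [left|] => /=; lin.
  + by move=> v eps [v1 v2] ee /upright_down[? ?]; apply/inD_Dstar/Or32 => /=; lin.
- have := dyadic_gt0 d1 => e10; have e12 := dyadic_le d1.
  right; exists (1 - 3 / 2 * e1 - z.1), (e1 / 4); split; [lin|lin| | |].
  + by move=> s sS; apply: (Dstar_C' d1) => /=; lin.
  + by apply: (removed_top d1) => /=; [lin|apply: Or32; lin].
  + by move=> v eps [v1 v2] ee /upright_down[? ?]; apply/inD_Dstar/Or31 => /=; lin.
- have := dyadic_gt0 d1 => e10; have e12 := dyadic_le d1.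
  right; exists (1 - e1 - z.1), (e1 / 4); split; [lin|lin| | |].
  + by move=> s sS; apply: (Dstar_C'' d1) => /=; lin.
  + by apply: (removed_top d1) => /=; [lin|apply: Or33; lin].
  + by move=> v eps [v1 v2] ee /upright_down[? ?]; apply/inD_Dstar/Or31 => /=; lin.
Qed.

Lemma right_from_inD z : inD z ->
  (exists S, [/\ 0 < S, forall s, 0 <= s <= S -> Dstar (z + sc s (1, 0)) &
     z.1 + S = 1 \/ z.1 + S = 2^-1 /\ z.2 < 2^-1]) \/ dead_end (upright false) (1, 0) z.
Proof.
move=> iD; have [zl|zl|zl] := ltgtP z.2 2^-1.
- have [? ?] := inD_low iD zl.
  have zD s : 0 <= s < 2^-1 - z.1 -> Dstar (z + sc s (1, 0)).
    by move=> sz; apply/inD_Dstar/Or32 => /=; lin.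
  have [Dt|nDt] := pselect (Dstar (z + sc (2^-1 - z.1) (1, 0))).
    left; exists (2^-1 - z.1); split; [lin| |lin].
    by move=> s sS; have [->//|sE] := eqVneq s (2^-1 - z.1); apply: zD; lin.
  have [r r0 rP] := @mid_regular_below R z.2 ltac:(lin).
  have [m1 m2] : Num.min r z.2 <= r /\ Num.min r z.2 <= z.2 by rewrite !ge_min !lexx orbT.
  right; exists (2^-1 - z.1), (Num.min r z.2); split=> //; [lin|by rewrite lt_min r0; lin|].
  move=> v eps [v1 v2] ee /upright_down[? ?]; have [E|E] := eqVneq eps 0.
    by apply: rP => /=; lin.
  by apply/inD_Dstar/Or32 => /=; lin.
- have [? ?] := inD_high iD zl.
  have zD s : 0 <= s < 1 - z.1 -> Dstar (z + sc s (1, 0)).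
    by move=> sz; apply/inD_Dstar/Or31 => /=; lin.
  have [Dt|nDt] := pselect (Dstar (z + sc (1 - z.1) (1, 0))).
    left; exists (1 - z.1); split; [lin| |lin].
    by move=> s sS; have [->//|sE] := eqVneq s (1 - z.1); apply: zD; lin.
  have [r r0 rP] := @right_regular_below R z.2 ltac:(lin).
  pose e1 := Num.min r (z.2 - 2^-1).
  have [m1 m2] : e1 <= r /\ e1 <= z.2 - 2^-1 by rewrite !ge_min !lexx orbT.
  right; exists (1 - z.1), e1; split=> //; [lin|by rewrite lt_min r0; lin|].
  move=> v eps [v1 v2] ee /upright_down[? ?]; have [E|E] := eqVneq eps 0.
    by apply: rP => /=; lin.
  by apply/inD_Dstar/Or31 => /=; lin.
- have z1 : 0 < z.1 < 2^-1 by case: iD => -[]; lin.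
  right; exists (2^-1 - z.1), 4^-1; split; [lin|lin| | |].
  + by move=> s sS; apply/inD_Dstar/Or33 => /=; lin.
  + by apply: (removed_mid (@dyadicT R)) => /=; lin.
  + move=> v eps [v1 v2] ee /upright_down[? ?]; have [E|E] := eqVneq eps 0.
      by apply: (Dstar_B (@dyadicT R)) => /=; lin.
    by apply/inD_Dstar/Or32 => /=; lin.
Qed.

Lemma left_from_side z q : side z q ->
  (z.1 = 1 \/ z.1 = 2^-1 /\ z.2 < 2^-1) \/ dead_end (upright false) (- 1, 0) z.
Proof.
case=> [? ? ? ?|b e1 d1 ? ? ? ?|b e1 d1 ? ? ? ?|e1 d1 z1 z2 ? ?|e1 d1 z1 z2 ? ?
  |e1 d1 z1 z2 ? ?|e1 d1 z1 z2 ? ?].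
4-7: by left; have := dyadic_le d1; lin.
(* The slit ends at the corner (-1/2, 1/2). Below it lies the partner of [B_2], of length 1/8, which
   dictates the radius. *)
- right; exists (z.1 + 2^-1), 8^-1; split; [lin|lin| | |].
  + by move=> s sS; apply: Dstar_H => /=; lin.
  + by apply: removed_corner; [right|] => /=; lin.
  + move=> v eps [v1 v2] ee /upright_down[? ?]; have [E|E] := eqVneq eps 0.
      by apply: (Dstar_left1 (dyadic_half (@dyadicT R))) => /=; lin.
    by apply/inD_Dstar/Or32 => /=; lin.
- have := dyadic_gt0 d1 => e10; have e12 := dyadic_le d1.
  right; exists (z.1 - (1 - 2 * e1)), (e1 / 4); split; [lin|lin| | |].
  + by move=> s sS; apply: (Dstar_C' d1) => /=; lin.
  + by apply: (removed_top d1) => /=; [lin|apply: Or31; lin].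
  (* For [C'_1] and [eps = 0] the left endpoint is the corner (0, 1), and the points below it lie on
     the partner of [B_1], not in the interior. *)
  + move=> v eps [v1 v2] ee /upright_down[? ?]; have [E|E] := eqVneq (1 - 2 * e1 + eps) 0.
      by apply: (Dstar_left0 (@dyadicT R)) => /=; lin.
    by apply/inD_Dstar/Or31 => /=; lin.
- have := dyadic_gt0 d1 => e10; have e12 := dyadic_le d1.
  right; exists (z.1 - (1 - 3 / 2 * e1)), (e1 / 4); split; [lin|lin| | |].
  + by move=> s sS; apply: (Dstar_C'' d1) => /=; lin.
  + by apply: (removed_top d1) => /=; [lin|apply: Or32; lin].
  + by move=> v eps [v1 v2] ee /upright_down[? ?]; apply/inD_Dstar/Or31 => /=; lin.
Qed.

(** On a left side every point other than the two accumulation points has a regular vertical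
    direction, so only at these two can the end of the geodesic resemble [q0]. *)
Lemma left_from_inD z : inD z ->
  [\/ exists S q, [/\ 0 < S, forall s, 0 <= s < S -> Dstar (z + sc s (- 1, 0)),
         q = z + sc S (- 1, 0) & q = q0 R \/ q = (- 2^-1, 3^-1)],
      exists S, [/\ 0 < S, forall s, 0 <= s <= S -> Dstar (z + sc s (- 1, 0)) &
         z.1 - S = - 2^-1 \/ z.1 - S = 0 /\ 2^-1 < z.2] |
      exists b, dead_end (upright b) (- 1, 0) z].
Proof.
move=> iD; have [zl|zl|zl] := ltgtP z.2 2^-1.
- have [? ?] := inD_low iD zl.
  have zD s : 0 <= s < z.1 + 2^-1 -> Dstar (z + sc s (- 1, 0)).
    by move=> sz; apply/inD_Dstar/Or32 => /=; lin.
  have [z3|z3] := eqVneq z.2 3^-1.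
    apply: Or31; exists (z.1 + 2^-1), (- 2^-1, 3^-1); split=> //; [lin| |by right].
    by rewrite [RHS]surjective_pairing; congr pair => /=; lin.
  have [Dt|nDt] := pselect (Dstar (z + sc (z.1 + 2^-1) (- 1, 0))).
    apply: Or32; exists (z.1 + 2^-1); split; [lin| |lin].
    by move=> s sS; have [->//|sE] := eqVneq s (z.1 + 2^-1); apply: zD; lin.
  have [b [r [r0 rP]]] := @left1_regular R z.2 ltac:(lin) z3.
  pose e1 := Num.min r (Num.min z.2 (2^-1 - z.2)).
  have [m1 m2 m3] : [/\ e1 <= r, e1 <= z.2 & e1 <= 2^-1 - z.2] by rewrite !ge_min !lexx !orbT.
  apply: Or33; exists b, (z.1 + 2^-1), e1; split=> //; [lin|by rewrite !lt_min r0; lin|].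
  move=> v eps [v1 v2] ee [? vb]; have [E|E] := eqVneq eps 0.
    by apply: rP => /=; first lin; case: (b) vb => /=; rewrite /sign; lin.
  by apply/inD_Dstar/Or32 => /=; lin.
- have [? ?] := inD_high iD zl.
  have zD s : 0 <= s < z.1 -> Dstar (z + sc s (- 1, 0)).
    by move=> sz; apply/inD_Dstar/Or31 => /=; lin.
  have [z3|z3] := eqVneq z.2 (2 / 3).
    apply: Or31; exists z.1, (q0 R); split=> //; [lin| |by left].
    by rewrite [RHS]surjective_pairing /q0; congr pair => /=; lin.
  have [Dt|nDt] := pselect (Dstar (z + sc z.1 (- 1, 0))).
    apply: Or32; exists z.1; split; [lin| |lin].
    by move=> s sS; have [->//|sE] := eqVneq s z.1; apply: zD; lin.
  have [b [r [r0 rP]]] := @left0_regular R z.2 ltac:(lin) z3.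
  pose e1 := Num.min r (Num.min (1 - z.2) (z.2 - 2^-1)).
  have [m1 m2 m3] : [/\ e1 <= r, e1 <= 1 - z.2 & e1 <= z.2 - 2^-1].
    by rewrite !ge_min !lexx !orbT.
  apply: Or33; exists b, z.1, e1; split=> //; [lin|by rewrite !lt_min r0; lin|].
  move=> v eps [v1 v2] ee [? vb]; have [E|E] := eqVneq eps 0.
    by apply: rP => /=; first lin; case: (b) vb => /=; rewrite /sign; lin.
  by apply/inD_Dstar/Or31 => /=; lin.
- have z1 : 0 < z.1 < 2^-1 by case: iD => -[]; lin.
  apply: Or33; exists false, z.1, 4^-1; split; [lin|lin| | |].
  + by move=> s sS; apply/inD_Dstar/Or33 => /=; lin.
  + by apply: removed_corner; [left|] => /=; lin.
  + by move=> v eps [v1 v2] ee /upright_down[? ?]; apply/inD_Dstar/Or32 => /=; lin.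
Qed.

Section Ray.
Variables (phi : homeo X) (A : matrix) (h : plane R).
Hypotheses (aA : forall p, inU p -> affine_at phi p A) (h0 : 0 < h.1).
Hypotheses (A21 : A.2.1 = 0) (A22 : A.2.2 != 0).

Lemma sign_upright c : exists b, upright c (act A (0, sign R b)).
Proof.
exists (c (+) (A.2.2 < 0)); rewrite /upright /sign /= A21; split; first lin.
by case: (ltgtP A.2.2 0) A22 c => // ? _ []; rewrite /=; lra.
Qed.

Section Rightwards.
Let m : plane R := (1, 0).
Hypothesis hm : act A h = sc (- 1) m.
Let dies := ray_dies aA h0 hm (@removed_q0 R).

Lemma right_cross t0 z q : t0 <= 8^-1 -> ray h t0 -> phi (Xp (q0 R + sc t0 h)) = Xp z ->
  side z q -> z.1 = 1 \/ z.1 = 2^-1 /\ z.2 < 2^-1 -> False.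
Proof.
move=> t08 rt e sz z1; have t00 := rt.1.
have {}e : phi (Xp (q0 R + sc t0 h)) = Xp q.
  rewrite e; apply/Xp_eqP; [exact: sidel_Dstar sz|exact: sider_Dstar sz|exact: Or32].
suff H s : 0 <= s <= t0 -> Dstar (q + sc s m).
  by apply: (dies rt e) => [s st|]; apply: H; lin.
move=> st; have [->|s0] := eqVneq s 0.
  by rewrite sc0 addr0; exact: sider_Dstar sz.
apply: inD_Dstar; case: sz => *; dyb; try (exfalso; lin).
- by apply: Or32 => /=; lin.
- by apply: Or31 => /=; lin.
- by apply: Or31 => /=; lin.
- by apply: Or32 => /=; lin.
Qed.

Lemma right_reach t0 z S : t0 <= 8^-1 -> ray h t0 -> phi (Xp (q0 R + sc t0 h)) = Xp z ->
  0 < S -> (forall s, 0 <= s <= S -> Dstar (z + sc s m)) ->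
  z.1 + S = 1 \/ z.1 + S = 2^-1 /\ z.2 < 2^-1 -> False.
Proof.
move=> t08 rt e S0 H zS; have t00 := rt.1; have [tS|tS] := leP t0 S.
  by apply: (dies rt e) => [s st|]; apply: H; lin.
have e' : phi (Xp (q0 R + sc (t0 - S) h)) = Xp (z + sc S m).
  by apply: (ray_path aA h0 hm) => //; lin.
have [q sz] : exists q, side (z + sc S m) q.
  have /DstarP[iD|//|[p sp]] : Dstar (z + sc S m) by apply: H; lin.
    by case: iD zS => -[/= ? ?]; lin.
  by case: sp zS => /= *; dyb; lin.
apply: (right_cross (t0 := t0 - S) _ _ e' sz) => /=; [lin|apply: ray_le rt _; lin|lin].
Qed.

Lemma no_rightward_ray : False.
Proof.
have [t0 t08 rt] := ray_exists h0.
have [z Dz e] := Xp_surj (phi (Xp (q0 R + sc t0 h))).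
have stop z' : phi (Xp (q0 R + sc t0 h)) = Xp z' -> ~ dead_end (upright false) m z'.
  exact: (@dead_end_no_ray R phi A h aA h0 m (upright false) t0 z' hm
    (@upright_sc R false) (sign_upright false) rt).
have dom z' q : phi (Xp (q0 R + sc t0 h)) = Xp z' -> side z' q -> False.
  move=> ez sz; case: (right_from_side sz); last exact: stop.
  exact: (right_cross t08 rt ez sz).
case/DstarP: (Dz) => [iD|[q sz]|[q sz]].
- case: (right_from_inD iD) => [[S [S0 zD zS]]|]; last exact: stop.
  exact: (right_reach t08 rt e S0 zD zS).
- exact: dom e sz.
- apply: (dom q z) => //; rewrite e; apply/Xp_eqP => //; [exact: sidel_Dstar sz|exact: Or33].
Qed.

End Rightwards.

Section Leftwards.
Let m : plane R := (- 1, 0).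
Hypothesis hm : act A h = sc (- 1) m.
Let dies := ray_dies aA h0 hm (@removed_q0 R).

(** Here [z] is on a right side, where a geodesic arriving at the partner left side continues;
    moving left from it enters [D] with ample room. *)
Lemma left_cross t0 z q : t0 <= 8^-1 -> ray h t0 -> phi (Xp (q0 R + sc t0 h)) = Xp z ->
  side z q -> z.1 = 1 \/ z.1 = 2^-1 /\ z.2 < 2^-1 -> False.
Proof.
move=> t08 rt e sz z1; have t00 := rt.1.
suff H s : 0 <= s <= t0 -> Dstar (z + sc s m).
  by apply: (dies rt e) => [s st|]; apply: H; lin.
move=> st; have [->|s0] := eqVneq s 0.
  by rewrite sc0 addr0; exact: sidel_Dstar sz.
apply: inD_Dstar; case: sz => *; dyb; try (exfalso; lin).
- by apply: Or31 => /=; lin.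
- by apply: Or31 => /=; lin.
- by apply: Or32 => /=; lin.
- by apply: Or32 => /=; lin.
Qed.

Lemma left_reach t0 z S : t0 <= 8^-1 -> ray h t0 -> phi (Xp (q0 R + sc t0 h)) = Xp z ->
  0 < S -> (forall s, 0 <= s <= S -> Dstar (z + sc s m)) ->
  z.1 - S = - 2^-1 \/ z.1 - S = 0 /\ 2^-1 < z.2 -> False.
Proof.
move=> t08 rt e S0 H zS; have t00 := rt.1; have [tS|tS] := leP t0 S.
  by apply: (dies rt e) => [s st|]; apply: H; lin.
have e' : phi (Xp (q0 R + sc (t0 - S) h)) = Xp (z + sc S m).
  by apply: (ray_path aA h0 hm) => //; lin.
have DS : Dstar (z + sc S m) by apply: H; lin.
have [p sp] : exists p, side p (z + sc S m).
  case/DstarP: (DS) => [iD|[q sz]|//].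
    by case: iD zS => -[/= ? ?]; lin.
  by case: sz zS => /= *; dyb; lin.
have {}e' : phi (Xp (q0 R + sc (t0 - S) h)) = Xp p.
  by rewrite e'; apply/Xp_eqP => //; [exact: sidel_Dstar sp|exact: Or33].
apply: (left_cross (t0 := t0 - S) _ _ e' sp) => /=; [lin|apply: ray_le rt _; lin|].
by case: sp zS => /= *; dyb; lin.
Qed.

(** The two exceptional outcomes yield no contradiction but determine the image: it leaves [q0] or
    (-1/2, 1/3) horizontally. *)
Lemma leftward_ray : exists t0 q, [/\ ray h t0, q = q0 R \/ q = (- 2^-1, 3^-1) &
  forall t, 0 < t <= t0 -> phi (Xp (q0 R + sc t h)) = Xp (q + sc t (1, 0))].
Proof.
have [t0 t08 rt] := ray_exists h0.
have [z Dz e] := Xp_surj (phi (Xp (q0 R + sc t0 h))).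
have stop b z' : phi (Xp (q0 R + sc t0 h)) = Xp z' -> ~ dead_end (upright b) m z'.
  exact: (@dead_end_no_ray R phi A h aA h0 m (upright b) t0 z' hm
    (@upright_sc R b) (sign_upright b) rt).
have dom z' q : phi (Xp (q0 R + sc t0 h)) = Xp z' -> side z' q -> False.
  move=> ez sz; case: (left_from_side sz); last exact: stop.
  exact: (left_cross t08 rt ez sz).
case/DstarP: (Dz) => [iD|[q sz]|[q sz]]; first last.
- exfalso; apply: (dom q z) => //; rewrite e; apply/Xp_eqP => //; [exact: sidel_Dstar sz|exact: Or33].
- by case: (dom _ _ e sz).
case: (left_from_inD iD) => [[S [q [S0 zD qE q01]]]|[S [S0 zD zS]]|[b zb]]; first last.
- by case: (stop b z e zb).
- by case: (left_reach t08 rt e S0 zD zS).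
exists t0, q; split=> // t tt.
have nD : ~ Dstar (z + sc S m).
  by rewrite -qE; case: q01 => ->; [exact: removed_q0|exact: removed_q1].
have tS := ray_dies_at aA h0 hm (@removed_q0 R) rt e S0 zD nD.
have -> : q + sc t (1, 0) = z + sc (S - t) m.
  by rewrite qE -addrA /sc /=; congr (_ + _); rewrite [LHS]surjective_pairing /=; congr pair; ring.
rewrite -{1}(subKr t0 t) (ray_path aA h0 hm rt e) -?tS//; first lin.
by move=> s st; apply: zD; lin.
Qed.

End Leftwards.
End Ray.
End Horizontal.

(** * Homeomorphisms fixing the end (0, 2/3) *)

Section LocalForm.
Variable R : realType.
Notation X := (Xinf R).
Notation matrix := (plane R * plane R)%type.
Implicit Types (e r s t S : R) (p q w v z m : plane R) (phi : homeo X).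

Definition lower a c d : matrix := ((a, c), (0, d)).

(* [phi] fixes the end [q0] of the surface and is given by the lower triangular
   matrix with columns [(a, c)] and [(0, d)] on a half disc ending there. *)
Definition fixes_q0 phi (a c d : R) := exists2 r, 0 < r <= 8^-1 &
  forall v, 0 < v.1 < r -> - r < v.2 < r ->
    inU (q0 R + act (lower a c d) v) /\ phi (Xp (q0 R + v)) = Xp (q0 R + act (lower a c d) v).

Lemma inU_q0 v : 0 < v.1 < 8^-1 -> - 8^-1 < v.2 < 8^-1 -> inU (q0 R + v).
Proof. by move=> ? ?; split=> /=; lin. Qed.

Lemma affine_at_injective phi p A h : inD p -> affine_at phi p A -> act A h = 0 -> h = 0.
Proof.
move=> iD [d [k [r [cd r0 H]]]] Ah.
have [s s0 sP] := inD_open iD.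
have [e e0 eP] := @sc_small R (Num.min r s) h ltac:(by rewrite lt_min r0).
have /square_min[er es] := eP (e / 2) ltac:(lin).
have [dp dE] := H _ (square0 r0); have [dp' dE'] := H _ er.
have [phiK _ _ _] := homeo_inv_funP phi.
have /(can_inj phiK) : phi (Xp (p + sc (e / 2) h)) = phi (Xp (p + 0)).
  have [[_ _ dinj _] _] := cd; apply: dinj; rewrite ?inE//.
  by rewrite dE dE' act_sc Ah act0 /sc /= !mulr0.
have iD' := sP _ es; rewrite addr0.
move=> /(Xp_eqP (inD_Dstar iD') (inD_Dstar iD))/(twin_inD iD') pE.
have : sc (e / 2) h = 0 by apply: (addrI p); rewrite addr0 -pE.
move=> /(f_equal (fun v => (v.1, v.2)))/= [h1 h2].
have e2 : e / 2 != 0 by lin.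
rewrite [h]surjective_pairing; congr pair; apply: (mulfI e2); rewrite ?mulr0 //.
Qed.

Lemma affine_at_det phi p A : inD p -> affine_at phi p A ->
  A.1.1 * A.2.2 - A.2.1 * A.1.2 != 0.
Proof.
move=> iD aA; apply/eqP => det0.
have inj := affine_at_injective iD aA.
have [h1 h2] : A.2.1 = 0 /\ - A.1.1 = 0.
  have /(f_equal (fun v => (v.1, v.2))) : (A.2.1, - A.1.1) = 0 :> plane R.
    apply: inj; rewrite /act /=; congr pair; first ring.
    by rewrite -[RHS]oppr0 -[in RHS]det0; ring.
  by case.
have [h3 h4] : A.2.2 = 0 /\ - A.1.2 = 0.
  have /(f_equal (fun v => (v.1, v.2))) : (A.2.2, - A.1.2) = 0 :> plane R.
    apply: inj; rewrite /act /=; congr pair; last ring.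
    by rewrite -[RHS]det0; ring.
  by case.
have /(f_equal fst)/= : (1, 0) = 0 :> plane R.
  apply: inj; rewrite /act /=; congr pair; lin.
by move=> /eqP; rewrite oner_eq0.
Qed.

Variable rho : homeo X.
Hypotheses (aff_rho : Aff R rho) (rhoE : induces (@rho_box R) (@rho_mx R) (@rho_shift R) rho).

Lemma rho_upper p : Dstar p -> 0 <= p.1 <= 1 -> 2^-1 <= p.2 <= 1 ->
  rho (Xp p) = Xp (p.1 - 2^-1, 1 - p.2).
Proof.
move=> Dp p1 p2; rewrite (rhoE (i := true))//; congr Xp.
by rewrite [LHS]surjective_pairing; congr pair => /=; lin.
Qed.

Lemma rho_lower p : Dstar p -> - 2^-1 <= p.1 <= 2^-1 -> 0 <= p.2 <= 2^-1 ->
  rho (Xp p) = Xp (p.1 + 2^-1, 1 - p.2).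
Proof.
move=> Dp p1 p2; rewrite (rhoE (i := false))//; congr Xp.
by rewrite [LHS]surjective_pairing; congr pair => /=; lin.
Qed.

Lemma rhoK : homeoM rho rho = homeo1 _.
Proof.
apply: homeo_inj => x; have [p Dp ->] := Xp_surj x.
change (rho (rho (Xp p)) = Xp p).
case: (Dstar_D Dp) => -[p1 p2].
  rewrite rho_upper//; have D1 : Dstar (p.1 - 2^-1, 1 - p.2).
    have := piece_Dstar (@rho_piecewise R) (i := true) Dp (conj p1 p2).
    congr Dstar; rewrite [LHS]surjective_pairing; congr pair => /=; lin.
  rewrite rho_lower/=; [|exact: D1|lin|lin].
  by rewrite [in RHS](surjective_pairing p); congr (Xp (_, _)); lin.
rewrite rho_lower//; have D1 : Dstar (p.1 + 2^-1, 1 - p.2).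
  have := piece_Dstar (@rho_piecewise R) (i := false) Dp (conj p1 p2).
  congr Dstar; rewrite [LHS]surjective_pairing; congr pair => /=; lin.
rewrite rho_upper/=; [|exact: D1|lin|lin].
by rewrite [in RHS](surjective_pairing p); congr (Xp (_, _)); lin.
Qed.

(** Provides a point near whose image [rho] is given by a single formula: interior and off the line
    where its two pieces meet. *)
Lemma generic_image phi A : (forall p, inU p -> affine_at phi p A) ->
  A.1.1 * A.2.2 - A.2.1 * A.1.2 != 0 ->
  exists p z, [/\ inU p, inD z, z.2 != 2^-1 & phi (Xp p) = Xp z].
Proof.
move=> aA det0; have [_ _ cphi _] := homeo_inv_funP phi.
pose p : plane R := (2^-1, 3 / 4).
have [z Dz pz] := Xp_surj (phi (Xp p)).
(* At a glued pair, [D] lies on the negative side of the left member and on the positive side of the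
   right one, whichever coordinate is normal; a diagonal displacement of suitable sign therefore
   enters the interior. *)
have [sg [r [sg0 r0 rP]]] : exists sg r, [/\ sg = 1 \/ sg = - 1, 0 < r &
    forall s, 0 < s < r -> inD (z + sc s (sg, sg))].
  case/DstarP: Dz => [iD|[q s]|[q s]].
  - have [r r0 rP] := inD_open iD; exists 1, r; split=> //; first by left.
    by move=> s sr; apply: rP; split=> /=; lin.
  - have [pr [r [prE r0 rP]]] := side_local s; exists (- 1), r; split=> //; first by right.
    move=> t tr; have [|+ _ _] := rP (sc t (- 1, - 1)); first by split=> /=; lin.
    by move=> H; case: H => //; case: prE => -> /=; lin.
  - have [pr [r [prE r0 rP]]] := side_local s; exists 1, r; split=> //; first by left.
    move=> t tr; have [|_ + _] := rP (sc t (1, 1)); first by split=> /=; lin.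
    by move=> H; case: H => //; case: prE => -> /=; lin.
have [h hE] : exists h, act A h = (sg, sg).
  exists ((A.2.2 * sg - A.2.1 * sg) / (A.1.1 * A.2.2 - A.2.1 * A.1.2),
    (A.1.1 * sg - A.1.2 * sg) / (A.1.1 * A.2.2 - A.2.1 * A.1.2)).
  by rewrite /act /=; congr pair; field.
have [d d0 dP] := @sc_small R 4^-1 h ltac:(lin).
pose m := Num.min d r; have m0 : 0 < m by rewrite lt_min d0.
have [m1 m2] : m <= d /\ m <= r by rewrite !ge_min !lexx orbT.
have key s : 0 < s < m -> [/\ inU (p + sc s h), inD (z + sc s (sg, sg)) &
    phi (Xp (p + sc s h)) = Xp (z + sc s (sg, sg))].
  move=> sm; have U t : 0 <= t <= s -> inU (p + sc t h).
    by move=> ts; have [/= h1 h2] := dP t ltac:(lin); split=> /=; lin.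
  split; [apply: U; lin|apply: rP; lin|].
  rewrite -hE; apply: path_image => //; first lin.
  move=> t ts; have Ut := U t ts; split; [exact: inU_inD|exact: aA|rewrite hE].
  have [->|t0] := eqVneq t 0; first by rewrite sc0 addr0.
  by apply/inD_Dstar/rP; lin.
(* Of two points of a diagonal at most one has height 1/2. *)
have [U1 D1 e1] := key (m / 2) ltac:(lin); have [U2 D2 e2] := key (m / 3) ltac:(lin).
have [z1|z1] := eqVneq (z + sc (m / 2) (sg, sg)).2 2^-1; last first.
  by exists (p + sc (m / 2) h), (z + sc (m / 2) (sg, sg)).
exists (p + sc (m / 3) h), (z + sc (m / 3) (sg, sg)); split=> //.
by move: z1 => /=; case: sg0 => -> ?; apply/eqP; lin.
Qed.

Lemma Aff_mul phi psi : Aff R phi -> Aff R psi -> Aff R (homeoM phi psi).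
Proof.
move=> aphi apsi x; have [c [d [cc cd cx dx [g [a1 [b1 [c1 [d1 [e1 [f1 gE]]]]]] near1]]]] := apsi x.
have [c' [d' [cc' cd' cx' dx' [g' [a2 [b2 [c2 [d2 [e2 [f2 gE']]]]]] near2]]]] := aphi (psi x).
exists c, d'; split=> //.
have [k near3] := canonical_charts_translation cd cc' dx cx'.
exists (fun v => g' (g v + k)).
  exists (a2 * a1 + b2 * c1), (a2 * b1 + b2 * d1), (c2 * a1 + d2 * c1), (c2 * b1 + d2 * d1),
    (a2 * (e1 + k.1) + b2 * (f1 + k.2) + e2), (c2 * (e1 + k.1) + d2 * (f1 + k.2) + f2) => v.
  by rewrite gE' gE /=; congr pair; ring.
have [_ _ cpsi _] := homeo_inv_funP psi.
have near2' := cpsi x _ near2; have near3' := cpsi x _ near3.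
near=> y.
change (d'.2 (phi (psi y)) = g' (g (c.2 y) + k)).
rewrite (_ : d'.2 _ = g' (c'.2 (psi y))); last by near: y.
rewrite (_ : c'.2 _ = d.2 (psi y) + k); last by near: y.
by rewrite (_ : d.2 _ = g (c.2 y)) //; near: y.
Unshelve. all: by end_near.
Qed.

Definition flip A : matrix := ((A.1.1, - A.1.2), (A.2.1, - A.2.2)).

Lemma act_flip A v : act (flip A) v = ((act A v).1, - (act A v).2).
Proof. by rewrite /act /=; congr pair; ring. Qed.

(** The matrix is constant on [inU], so it can be computed at the one point given by
    [generic_image]. *)
Lemma rho_matrix phi A : Aff R phi -> (forall p, inU p -> affine_at phi p A) ->
  A.1.1 * A.2.2 - A.2.1 * A.1.2 != 0 ->
  forall p, inU p -> affine_at (homeoM rho phi) p (flip A).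
Proof.
move=> aff aA det0; have [B aB] := Aff_matrix_inU (Aff_mul aff_rho aff).
suff <- : B = flip A by [].
have [p [z [Up Dz z2 pz]]] := generic_image aA det0.
have [_ _ cphi _] := homeo_inv_funP (homeoM rho phi).
apply: (affine_at_uniq cphi (inU_inD Up) (aB _ Up)).
have [r1 r10 r1P] : exists2 r, 0 < r & forall w, square r w -> inU (p + w).
  case: (Up) => /interval_room[s s0 sP] /interval_room[t t0 tP].
  exists (Num.min s t) => [|w /square_min[[w1 _] [_ w2]]]; first by rewrite lt_min; lin.
  by split; [exact: sP|exact: tP].
have [r2 r20 r2P] := inD_open Dz.
have [sd [r3 r30 r3P]] : exists sd : bool, exists2 r, 0 < r & forall w, square r w ->
    if sd then 2^-1 < z.2 + w.2 else z.2 + w.2 < 2^-1.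
  case/lt_total/orP: z2 => z2; [exists false, (2^-1 - z.2)|exists true, (z.2 - 2^-1)]
    => [|w [_ w2]||w [_ w2]]; lin.
have [r4 r40 r4P] := @act_small _ A (Num.min r2 r3) ltac:(by rewrite lt_min r20).
pose r := Num.min r1 r4.
have r0 : 0 < r by rewrite lt_min r10.
have phiE w : square r w -> phi (Xp (p + w)) = Xp (z + act A w).
  move=> wr; have sc1 v : sc 1 v = v by rewrite /sc !mul1r -surjective_pairing.
  rewrite -{1}(sc1 w) -{1}(sc1 (act A w)); have [_ _ cphi' _] := homeo_inv_funP phi.
  apply: path_image => // s s01; have sr : square r (sc s w).
    have [s0 s1] := andP s01; case: wr; rewrite -!ltr_norml => w1 w2.
    split; rewrite /= -ltr_norml normrM (ger0_norm s0).
      by apply: le_lt_trans w1; apply: ler_piMl.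
    by apply: le_lt_trans w2; apply: ler_piMl.
  have [s1 /r4P/square_min[s2 s3]] := square_min sr.
  have Us := r1P _ s1; split; [exact: inU_inD|exact: aA|].
  by rewrite -act_sc; exact/inD_Dstar/r2P.
pose z' : plane R := (z.1 + (if sd then - 2^-1 else 2^-1), 1 - z.2).
have key w : square r w -> Dstar (z' + act (flip A) w) /\
    homeoM rho phi (Xp (p + w)) = Xp (z' + act (flip A) w).
  move=> wr; have [_ /r4P/square_min[w2 w3]] := square_min wr.
  have iD := r2P _ w2; have Dw := inD_Dstar iD.
  have E : act (@rho_mx R) (z + act A w) + rho_shift R sd = z' + act (flip A) w.
    rewrite act_flip [LHS]surjective_pairing [RHS]surjective_pairing.
    by case: (sd) @z'; congr pair => /=; ring.
  have bx : rho_box sd (z + act A w).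
    have := r3P _ w3; case: (sd) => /= ?.
      by have [] := inD_high iD _ => //= *; split=> /=; lin.
    by have [] := inD_low iD _ => //= *; split=> /=; lin.
  split; first by rewrite -E; exact: (piece_Dstar (@rho_piecewise R)).
  change (rho (phi (Xp (p + w))) = Xp (z' + act (flip A) w)).
  by rewrite phiE// (rhoE Dw bx) E.
apply: (affine_at_intro r0 _ key).
by have [] := key _ (square0 r0); rewrite act0 addr0.
Qed.

End LocalForm.

(** * Reduction to maps that fix q0 *)

Section Classification.
Variable R : realType.
Notation X := (Xinf R).
Notation matrix := (plane R * plane R)%type.
Implicit Types (a c d e r s t S : R) (p q w v z m : plane R) (phi : homeo X).

Lemma act_surj (A : matrix) v : A.1.1 * A.2.2 - A.2.1 * A.1.2 != 0 ->
  act A ((A.2.2 * v.1 - A.2.1 * v.2) / (A.1.1 * A.2.2 - A.2.1 * A.1.2),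
    (A.1.1 * v.2 - A.1.2 * v.1) / (A.1.1 * A.2.2 - A.2.1 * A.1.2)) = v.
Proof.
by move=> det0; rewrite [RHS]surjective_pairing /act /=; congr pair; field.
Qed.

Section WithRho.
Variable rho : homeo X.
Hypotheses (aff_rho : Aff R rho) (rhoE : induces (@rho_box R) (@rho_mx R) (@rho_shift R) rho).

(** If [A.2.1 <> 0], one of the two preimage directions of the vertical points into the upper
    square. When its image points down, [no_upward_ray] applies to [phi]; when it points up, it
    applies to [rho] after [phi], whose matrix is [flip A]. *)
Lemma matrix_vertical phi (A : matrix) : Aff R phi ->
  (forall p, inU p -> affine_at phi p A) ->
  A.1.1 * A.2.2 - A.2.1 * A.1.2 != 0 -> A.2.1 = 0.
Proof.
move=> aff aA det0; apply/eqP; apply: contrapT => /negP A21.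
pose dt := A.1.1 * A.2.2 - A.2.1 * A.1.2.
have K : (- A.2.1) / dt != 0 by rewrite mulf_neq0 ?oppr_eq0 ?invr_eq0.
have act01 y := act_surj (0, y) det0.
case/lt_total/orP: K => K.
- have := act01 (- 1); set h := (X in act A X) => hE.
  apply: (@no_upward_ray R phi A h aA) => //.
    by rewrite /h /= mulr0 sub0r mulrN1 opprK; move: K; rewrite mulNr oppr_lt0.
  by rewrite hE /sc /=; congr pair; ring.
- have := act01 1; set h := (X in act A X) => hE.
  apply: (@no_upward_ray R _ (flip A) h (rho_matrix aff_rho rhoE aff aA det0)) => //.
    by rewrite /h /= mulr0 sub0r mulr1.
  by rewrite act_flip hE /sc /=; congr pair; ring.
Qed.

(** A negative [A.1.1] would give a ray with image direction (-1, 0), which [no_rightward_ray]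
    forbids. *)
Lemma matrix_horizontal phi (A : matrix) : Aff R phi ->
  (forall p, inU p -> affine_at phi p A) ->
  A.1.1 * A.2.2 - A.2.1 * A.1.2 != 0 -> exists a c d, [/\ 0 < a, d != 0, A = lower a c d &
    exists h t0 q, [/\ 0 < t0, act A h = (1, 0), q = q0 R \/ q = (- 2^-1, 3^-1) &
      forall t, 0 < t <= t0 -> phi (Xp (q0 R + sc t h)) = Xp (q + sc t (1, 0))]].
Proof.
move=> aff aA det0; have A21 := matrix_vertical aff aA det0.
have [A11 A22] : A.1.1 != 0 /\ A.2.2 != 0.
  by move: det0; rewrite A21 mul0r subr0 mulf_eq0 negb_or => /andP.
have actx x := act_surj (x, 0) det0.
have hx x : (A.2.2 * x - A.2.1 * 0) / (A.1.1 * A.2.2 - A.2.1 * A.1.2) = x / A.1.1.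
  by rewrite A21; field; rewrite A11 A22.
case/lt_total/orP: A11 => A11.
- have := actx (- 1); set h := (X in act A X) => hE; exfalso.
  apply: (@no_rightward_ray R phi A h aA) => //.
    by rewrite /h /= hx -invrN1 -invfM mulN1r invr_gt0 oppr_gt0.
  by rewrite hE /sc /=; congr pair; ring.
exists A.1.1, A.1.2, A.2.2; split=> //.
  by rewrite /lower -A21 -!surjective_pairing.
have := actx 1; set h := (X in act A X) => hE.
have h0 : 0 < h.1 by rewrite /h /= hx mul1r invr_gt0.
have [|t0 [q [rt qE H]]] := @leftward_ray R phi A h aA h0 A21 A22.
  by rewrite hE /sc /=; congr pair; ring.
by exists h, t0, q; split=> //; case: rt.
Qed.

Lemma inD_near_end q x w u : q = q0 R \/ q = (- 2^-1, 3^-1) -> 0 < x < 24^-1 ->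
  w.1 = 0 -> - 24^-1 < w.2 < 24^-1 -> 0 <= u <= 1 -> inD (q + sc x (1, 0) + sc u w).
Proof.
move=> qE x0 w1 w2 u01.
have := @segment_between R (- 24^-1) 24^-1 0 w.2 u u01 ltac:(lin) ltac:(lin).
rewrite add0r subr0 => ub.
by case: qE => ->; [apply: Or31|apply: Or32]; rewrite /= w1 !mulr0; lin.
Qed.

Lemma inU_near_end x h s u : 0 < x * h.1 < 24^-1 -> - 24^-1 < x * h.2 + s < 24^-1 ->
  - 24^-1 < s < 24^-1 -> 0 <= u <= 1 -> inU (q0 R + sc x h + sc u (0, s)).
Proof.
move=> x1 x2 s0 u01.
have := @segment_between R (- 12^-1) 12^-1 (x * h.2) (x * h.2 + s) u u01 ltac:(lin) ltac:(lin).
by rewrite addrAC subrr add0r; split; rewrite /= ?mulr0; lin.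
Qed.

(** The horizontal image of one ray spreads to a half disc: each point near [q0] is reached from the
    ray by a vertical segment, whose image is again vertical because [A.2.1 = 0]. *)
Lemma fixes_q0_exists phi : Aff R phi -> exists a c d, [/\ 0 < a, d != 0 &
  fixes_q0 phi a c d \/ fixes_q0 (homeoM rho phi) a c d].
Proof.
move=> aff; have [A aA] := Aff_matrix_inU aff.
have U1 : inU (2^-1 : R, 3 / 4) by split=> /=; lin.
have det0 := affine_at_det (inU_inD U1) (aA _ U1).
have [a [c [d [a0 d0 AE [h [t0 [q [t00 hE qE H]]]]]]]] := matrix_horizontal aff aA det0.
have /(f_equal (fun v => (v.1, v.2)))/= [e1 e2] := hE; rewrite AE /= in e1 e2.
have [r1 r10 r1P] := @act_small _ A (Num.min t0 24^-1) ltac:(by rewrite lt_min t00; lin).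
(* The second coordinate of this auxiliary matrix applied to [v] is the height [s] of [v] above the
   ray, so [act_small] bounds [s]. *)
have [r2 r20 r2P] := @act_small _ ((a, - (a * h.2)), (0, 1)) 24^-1 ltac:(lin).
pose r := Num.min (Num.min r1 r2) 24^-1.
have r0 : 0 < r by rewrite !lt_min r10 r20; lin.
have rr : r <= 24^-1 by rewrite ge_min lexx orbT.
have key v : 0 < v.1 < r -> - r < v.2 < r ->
    [/\ 0 < (act A v).1 < 24^-1, - 24^-1 < (act A v).2 < 24^-1,
      inD (q + act A v) & phi (Xp (q0 R + v)) = Xp (q + act A v)].
  move=> v1 v2; have vr : square r v by split; lin.
  have [/square_min[/r1P s1 /r2P s2] [_ _]] := square_min vr.
  have [[t1 _] [t2 y2]] := square_min s1.
  have av1 : (act A v).1 = a * v.1 by rewrite AE /=; ring.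
  have av0 : 0 < a * v.1 by case/andP: v1 => ? _; exact: mulr_gt0.
  case: s2 => /= _ s2; set s := v.2 - a * v.1 * h.2.
  have sb : - 24^-1 < s < 24^-1 by move: s2; rewrite /s; clear - R; lin.
  (* From [act A h = (1, 0)] one has [h.1 = 1 / a], so time [a * v.1] on the ray lies vertically
     below or above [v]. *)
  have vE : v = sc (a * v.1) h + sc 1 (0, s).
    rewrite [LHS]surjective_pairing [RHS]surjective_pairing; congr pair => /=.
      by rewrite mulr0 addr0 mulrAC; move: e1; rewrite mul0r addr0 => ->; rewrite mul1r.
    by rewrite /s; ring.
  have av : act A v = sc (a * v.1) (1, 0) + sc 1 (act A (0, s)) by rewrite {1}vE actD !act_sc hE.
  have avs : (act A (0, s)).1 = 0 by rewrite AE /=; ring.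
  have avs2 : (act A v).2 = (act A (0, s)).2 by rewrite av /=; ring.
  have avE : 0 < a * v.1 < 24^-1 by move: t2; rewrite av1; clear - av0; lin.
  have qU u : 0 <= u <= 1 -> inD (q + sc (a * v.1) (1, 0) + sc u (act A (0, s))).
    by apply: inD_near_end => //; rewrite -avs2.
  have v1E : a * v.1 * h.1 = v.1.
    by rewrite mulrAC; move: e1; rewrite mul0r addr0 => ->; rewrite mul1r.
  have Uu u : 0 <= u <= 1 -> inU (q0 R + sc (a * v.1) h + sc u (0, s)).
    by apply: inU_near_end => //; rewrite ?v1E ?/s; clear - v1 v2 rr; lin.
  have phiv : phi (Xp (q0 R + v)) = Xp (q + act A v).
    rewrite av {1}vE !addrA; have [_ _ cphi _] := homeo_inv_funP phi.
    apply: path_image => //; last by apply: H; move: t1; rewrite av1; clear - av0; lin.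
    by move=> u u01; split; [exact/inU_inD/Uu|exact/aA/Uu|exact/inD_Dstar/qU].
  have g1 : 0 < (act A v).1 < 24^-1 by rewrite av1.
  by split=> //; rewrite av addrA; apply: qU; rewrite ler01 lexx.
exists a; case: qE => qE; subst q.
  exists c, d; split=> //; left; exists r; first by rewrite r0; lin.
  move=> v v1 v2; have [k1 k2 _ k4] := key v v1 v2.
  by rewrite -AE; split=> //; apply: inU_q0; clear - k1 k2; lin.
(* If the image ends at (-1/2, 1/3), composing with [rho] moves it to [q0] and changes the sign of
   the second row. *)
exists (- c), (- d); split; rewrite ?oppr_eq0//; right; exists r; first by rewrite r0; lin.
move=> v v1 v2; have [k1 k2 k3 k4] := key v v1 v2.
have E : (((- 2^-1, 3^-1) + act A v).1 + 2^-1, 1 - ((- 2^-1, 3^-1) + act A v).2) =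
    q0 R + act (lower a (- c) (- d)) v.
  by rewrite AE [RHS]surjective_pairing /=; congr pair; field.
split.
  by rewrite -E; rewrite /act /= in k1 k2; clear - k1 k2; split=> /=; lin.
change (rho (phi (Xp (q0 R + v))) = Xp (q0 R + act (lower a (- c) (- d)) v)).
rewrite k4 -E (rho_lower rhoE (inD_Dstar k3))//=; clear - k1 k2; rewrite /act /= in k1 k2; lin.
Qed.

End WithRho.
End Classification.

(** * Rigidity of maps that fix q0 *)

Section Rigidity.
Variable R : realType.
Notation X := (Xinf R).
Notation matrix := (plane R * plane R)%type.
Implicit Types (a c d e r s t S : R) (p q w v z m : plane R) (phi psi : homeo X).

Lemma fixes_q0_gt0 phi a c d : fixes_q0 phi a c d -> 0 < a.
Proof.
move=> [r r0 rP]; have [|| [/= + _] _] := rP (r / 2, 0); [rewrite /=; lin|rewrite /=; lin|].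
rewrite !mulr0 addr0 add0r => /andP[+ _].
by rewrite pmulr_lgt0; lin.
Qed.

Lemma fixes_q0_mul phi psi a c d a' c' d' :
  fixes_q0 phi a c d -> fixes_q0 psi a' c' d' ->
  fixes_q0 (homeoM phi psi) (a * a') (c * a' + d * c') (d * d').
Proof.
move=> [r r0 rP] F'; have a'0 := fixes_q0_gt0 F'; case: F' => r' r'0 r'P.
have [e e0 eP] := @act_small _ (lower a' c' d') r ltac:(lin).
exists (Num.min e r').
  by rewrite lt_min e0 ge_min; lin.
have [m1 m2] : Num.min e r' <= e /\ Num.min e r' <= r' by rewrite !ge_min !lexx orbT.
move=> v v1 v2; have [||U' E'] := r'P v; [lin|lin|].
have [b1 b2] := eP v ltac:(split; lin).
have avE : act (lower (a * a') (c * a' + d * c') (d * d')) v =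
    act (lower a c d) (act (lower a' c' d') v).
  by rewrite /act /=; congr pair; ring.
have g1 : 0 < (act (lower a' c' d') v).1.
  by rewrite /= mul0r addr0 mulr_gt0//; lin.
have [||U E] := rP (act (lower a' c' d') v); [lin|exact: b2|].
rewrite avE; split=> //.
change (phi (psi (Xp (q0 R + v))) = Xp (q0 R + act (lower a c d) (act (lower a' c' d') v))).
by rewrite E' E.
Qed.

Lemma fixes_q0_inv phi a c d : d != 0 -> fixes_q0 phi a c d ->
  fixes_q0 (homeoV phi) a^-1 (- c / (a * d)) d^-1.
Proof.
move=> d0 F; have a0 := fixes_q0_gt0 F; case: F => r r0 rP.
have an0 : a != 0 by rewrite gt_eqF.
pose L := lower a^-1 (- c / (a * d)) d^-1; rewrite /fixes_q0 -/L.
have [e e0 eP] := @act_small _ L r ltac:(lin).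
exists (Num.min e 8^-1); first by rewrite lt_min e0 ge_min lexx orbT; lin.
have [m1 m2] : Num.min e 8^-1 <= e /\ Num.min e 8^-1 <= 8^-1 by rewrite !ge_min !lexx orbT.
move=> v v1 v2; have [b1 b2] := eP v ltac:(split; lin).
have g1 : 0 < (act L v).1 by rewrite /= mul0r addr0 mulr_gt0// ?invr_gt0//; lin.
have [||U E] := rP (act L v); [lin|exact: b2|].
have LE : act (lower a c d) (act L v) = v.
  by rewrite [RHS]surjective_pairing /act /=; congr pair; field; rewrite ?an0 ?d0.
split; first by apply: inU_q0; move: b1 b2 g1 => /=; lin.
have [phiK _ _ _] := homeo_inv_funP phi.
change (homeo_inv_fun phi (Xp (q0 R + v)) = Xp (q0 R + act L v)).
by rewrite -{1}LE -E; exact: phiK.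
Qed.

Fixpoint iterate phi n : homeo X := if n is k.+1 then homeoM phi (iterate phi k) else homeo1 _.

Lemma fixes_q0_1 : fixes_q0 (homeo1 X) 1 0 1.
Proof.
exists 8^-1; first lin.
move=> v v1 v2; have -> : act (lower 1 0 1) v = v.
  by rewrite [RHS]surjective_pairing /act /=; congr pair; ring.
by split; [exact: inU_q0|].
Qed.

Lemma fixes_q0_iterate phi a d n : fixes_q0 phi a 0 d ->
  fixes_q0 (iterate phi n) (a ^+ n) 0 (d ^+ n).
Proof.
move=> F; elim: n => [|n IH]; first exact: fixes_q0_1.
by rewrite !exprS; have := fixes_q0_mul F IH; rewrite mul0r mulr0 addr0.
Qed.

Lemma Aff_iterate phi n : Aff R phi -> Aff R (homeo1 X) -> Aff R (iterate phi n).
Proof. by move=> aff aff1; elim: n => // n IH; exact: Aff_mul. Qed.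

(* The removed points of the line [x = 0] accumulating at [q0] lie at the
   signed distances [(1/3) (-1/2)^k]; a homeomorphism fixing [q0] permutes them. *)
Lemma fixes_q0_ratio phi a c d : d != 0 -> fixes_q0 phi a c d ->
  exists n, d = (- 2^-1) ^+ n \/ d * (- 2^-1) ^+ n = 1.
Proof.
move=> d0 [r r0 rP].
have nd0 : 0 < `|d| by rewrite normr_gt0.
(* With this bound [d * t] stays within 1/6 of [q0], where [removed_left0_inv] applies on both
   sides. *)
pose eps := Num.min r (6^-1 / `|d|).
have eps0 : 0 < eps by rewrite lt_min divr_gt0//; lin.
have [m1 m2] : eps <= r /\ eps <= 6^-1 / `|d| by rewrite !ge_min !lexx orbT.
have [t [t0 te nDt]] := @removed_near_q0 R true eps eps0.
have [e de tE] : exists2 e, dyadic true e & t = 2 / 3 * e.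
  by apply: (removed_left0_inv (b := true)) => //; lin.
have td : `|d| * t < 6^-1.
  by rewrite mulrC -ltr_pdivlMr//; lin.
(* The removed point at signed height [t] goes to a removed one at height [d * t]: otherwise the
   inverse map along horizontal approach would make the former regular. *)
have nDdt : ~ Dstar (q0 R + (0, d * t)).
  move=> Dq; apply: nDt; have [_ _ _ cphiV] := homeo_inv_funP phi.
  apply: (@limit_Dstar _ (homeo_inv_fun phi) (q0 R + (0, d * t)) (a, c) _ (1, 0) r) => //; first lin.
  move=> s sr; have vE : q0 R + sc t (0, 1) + sc s (1, 0) = q0 R + (s, t).
    by rewrite [LHS]surjective_pairing [RHS]surjective_pairing; congr pair => /=; ring.
  have avE : q0 R + (0, d * t) + sc s (a, c) = q0 R + act (lower a c d) (s, t).
    by rewrite [LHS]surjective_pairing [RHS]surjective_pairing; congr pair => /=; ring.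
  have [|| U E] := rP (s, t); [rewrite /=; lin|rewrite /=; lin|].
  rewrite vE avE; split; [exact/inD_Dstar/inU_inD| |].
    by apply/inD_Dstar/inU_inD/inU_q0 => /=; lin.
  by rewrite -E; have [phiK _ _ _] := homeo_inv_funP phi; exact: phiK.
have [k [ke kE]] : exists k, odd k = true /\ e = 2 ^- k.
  by case: de => k [? _] ?; exists k.
have pow n : (- 2^-1) ^+ n = (if odd n then -1 else 1) * 2 ^- n :> R.
  by rewrite exprNn -signr_odd exprVn; case: (odd n).
(* The side on which the image lies fixes the parity of its exponent: [k] is odd, and [k'] is odd
   exactly when [d > 0]. So [d] has the sign of the power of -1/2 with exponent the difference. *)
have ratio (b : bool) e' : dyadic b e' -> `|d| * e = e' -> b = (0 < d) ->
    exists n, d = (- 2^-1) ^+ n \/ d * (- 2^-1) ^+ n = 1.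
  move=> [k' [ok' _] ->] E bd; rewrite kE in E.
  have dE : d = (if b then 1 else -1) * `|d|.
    rewrite bd; have [dp|dn] := ltP 0 d; first by rewrite mul1r gtr0_norm.
    by rewrite ler0_norm// mulN1r opprK.
  have nz (j : nat) : 2 ^+ j != 0 :> R by rewrite expf_neq0.
  have nE : `|d| = 2 ^+ k / 2 ^+ k' by rewrite mulrC -E mulfVK// mulrC.
  have [kk|/ltnW kk] := leqP k k'.
    have nE' : `|d| = 2 ^+ k / (2 ^+ (k' - k) * 2 ^+ k) by rewrite nE -exprD subnK.
    exists (k' - k)%N; left; rewrite pow oddB// ok' ke dE nE'.
    by case: (b) => /=; field; rewrite ?nz.
  have nE' : `|d| = (2 ^+ (k - k') * 2 ^+ k') / 2 ^+ k' by rewrite nE -exprD subnK.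
  exists (k - k')%N; right; rewrite pow oddB// ok' ke dE nE'.
  by case: (b) => /=; field; rewrite ?nz.
have [dn|dp|/eqP] := ltgtP d 0; last by rewrite (negPf d0).
- have [|||e' de' E'] := @removed_left0_inv R false (`|d| * t).
  + exact: mulr_gt0.
  + lin.
  + rewrite ltr0_norm// (_ : sc _ _ = (0, d * t))// /sc /=; congr pair; ring.
  apply: (ratio false e') => //; last by apply/esym/negbTE; rewrite -leNgt ltW.
  by move: E'; rewrite tE; lin.
- have [|||e' de' E'] := @removed_left0_inv R true (`|d| * t).
  + exact: mulr_gt0.
  + lin.
  + rewrite gtr0_norm// (_ : sc _ _ = (0, d * t))// /sc /=; congr pair; ring.
  apply: (ratio true e') => //.
  by move: E'; rewrite tE; lin.
Qed.

Lemma fixes_q0_affine_at phi a c d : Aff R phi -> fixes_q0 phi a c d ->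
  forall p, inU p -> affine_at phi p (lower a c d).
Proof.
move=> aff [r r0 rP]; have [A aA] := Aff_matrix_inU aff.
suff <- : A = lower a c d by [].
have Up : inU (q0 R + (r / 2, 0)) by apply: inU_q0 => /=; lin.
have [_ _ cphi _] := homeo_inv_funP phi.
apply: (affine_at_uniq cphi (inU_inD Up) (aA _ Up)).
have key w : square (r / 2) w -> Dstar (q0 R + act (lower a c d) (r / 2, 0) + act (lower a c d) w) /\
    phi (Xp (q0 R + (r / 2, 0) + w)) = Xp (q0 R + act (lower a c d) (r / 2, 0) + act (lower a c d) w).
  move=> [w1 w2]; rewrite -!addrA -actD.
  have [||U E] := rP ((r / 2, 0) + w); [rewrite /=; lin|rewrite /=; lin|].
  by split=> //; exact/inD_Dstar/inU_inD.
apply: (affine_at_intro _ _ key); first lin.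
by have [||U _] := rP (r / 2, 0); [rewrite /=; lin|rewrite /=; lin|exact/inD_Dstar/inU_inD].
Qed.

(** The formula valid near [q0] is continued along segments in the upper square and reaches points
    of its top side as limits from below, so removed points of the top side can be compared. *)
Lemma fixes_q0_Dstar phi a c x y : Aff R phi -> fixes_q0 phi a c 1 ->
  0 < x < 1 -> 2^-1 < y <= 1 -> a * x < 2^-1 -> 2^-1 < y + c * x <= 1 ->
  Dstar (x, y) <-> Dstar (a * x, y + c * x).
Proof.
move=> aff F x01 y01 ax cx; have a0 := fixes_q0_gt0 F.
have aA := fixes_q0_affine_at aff F; case: F => r r0 rP.
pose x0 := Num.min r x / 2.
have [mr mx] : Num.min r x <= r /\ Num.min r x <= x by rewrite !ge_min !lexx orbT.
have m0 : 0 < Num.min r x by rewrite lt_min; lin.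
have x00 : 0 < x0 < r by rewrite /x0; lin.
have x0x : x0 < x by rewrite /x0; lin.
have ax0 : 0 < a * x0 by apply: mulr_gt0; lin.
have axx : a * x0 < a * x by rewrite ltr_pM2l.
pose S := Num.min (y - 2^-1) (y + c * x - 2^-1).
have S0 : 0 < S by rewrite lt_min; lin.
have [S1 S2] : S <= y - 2^-1 /\ S <= y + c * x - 2^-1 by rewrite !ge_min !lexx orbT.
have [||U0 E0] := rP (x0, 0); [rewrite /=; lin|rewrite /=; lin|].
have c01 : 2^-1 < 2 / 3 + c * x0 < 1 by case: U0 => /= _; lin.
have [_ _ cphi cphiV] := homeo_inv_funP phi; have [phiK _ _ _] := homeo_inv_funP phi.
have key s : 0 < s < S -> [/\ Dstar ((x, y) + sc s (0, -1)),
   Dstar ((a * x, y + c * x) + sc s (0, -1)) &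
   phi (Xp ((x, y) + sc s (0, -1))) = Xp ((a * x, y + c * x) + sc s (0, -1))].
  move=> sS; pose h : plane R := (x - x0, y - s - 2 / 3).
  have tE : (x, y) + sc s (0, -1) = q0 R + (x0, 0) + sc 1 h.
    by rewrite [LHS]surjective_pairing [RHS]surjective_pairing; congr pair => /=; ring.
  have tE' : (a * x, y + c * x) + sc s (0, -1) =
      q0 R + act (lower a c 1) (x0, 0) + sc 1 (act (lower a c 1) h).
    by rewrite [LHS]surjective_pairing [RHS]surjective_pairing; congr pair => /=; ring.
  have Uu u : 0 <= u <= 1 -> inU (q0 R + (x0, 0) + sc u h).
    move=> u01; clear - u01 x01 x00 x0x y01 sS S1.
    have b1 := @segment_between R 0 1 x0 x u u01 ltac:(lin) ltac:(lin).
    have b2 := @segment_between R 2^-1 1 (2 / 3) (y - s) u u01 ltac:(lin) ltac:(lin).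
    by split=> /=; clear - b1 b2; lin.
  have Du u : 0 <= u <= 1 -> inD (q0 R + act (lower a c 1) (x0, 0) + sc u (act (lower a c 1) h)).
    move=> u01; clear - u01 ax ax0 axx c01 cx sS S2.
    have b1 := @segment_between R 0 2^-1 (a * x0) (a * x) u u01 ltac:(lin) ltac:(lin).
    have b2 := @segment_between R 0 1 (2 / 3 + c * x0) (y - s + c * x) u u01 ltac:(lin) ltac:(lin).
    by apply: Or33 => /=; clear - b1 b2; lin.
  rewrite tE tE'; split; [apply/inD_Dstar/inU_inD/Uu; lin|apply/inD_Dstar/Du; lin|].
  apply: path_image => // u u01.
  by split; [exact/inU_inD/Uu|exact/aA/Uu|exact/inD_Dstar/Du].
split=> Dq.
  exact: (limit_Dstar cphi S0 Dq key).
apply: (@limit_Dstar _ (homeo_inv_fun phi) _ (0, -1) _ (0, -1) S cphiV S0 Dq) => s sS.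
have [? ? <-] := key s sS.
by split=> //; exact: phiK.
Qed.

(** The removed point (1/4, 1) is the common endpoint of [C'_1] and [C''_1]. A small shear of the
    excluded sign moves it, or its preimage, to an interior point; without shear, [a <> 1] moves it
    or its preimage into [C'_1]. *)
Lemma fixes_q0_small_shear phi a c : Aff R phi -> fixes_q0 phi a c 1 ->
  [/\ a <= 1 -> ~ - 2^-1 < c < 0, 1 <= a -> ~ 0 < c < 2^-1 & c = 0 -> a = 1].
Proof.
move=> aff F; have a0 := fixes_q0_gt0 F; have K := fixes_q0_Dstar aff F.
have nD x : x = 4^-1 -> ~ Dstar (x, 1 : R).
  by move=> ->; apply: (removed_top (@dyadicT R)) => //=; apply: Or32; lin.
have yD x : 0 < x < 4^-1 -> Dstar (x, 1 : R).
  by move=> x4; apply: (Dstar_C' (@dyadicT R)) => //=; lin.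
have a4 : a * (4 * a)^-1 = 4^-1 by field; lin.
split=> [a1 c0|a1 c0|c0].
- apply: (nD 4^-1) => //; apply/K; [lin|lin|lin|lin|].
  by apply/inD_Dstar/Or31 => /=; lin.
- have i0 : 0 < (4 * a)^-1 by rewrite invr_gt0; lin.
  have i4 : (4 * a)^-1 <= 4^-1 by rewrite lef_pV2 ?posrE; lin.
  have ci0 : 0 < c * (4 * a)^-1 by rewrite mulr_gt0//; lin.
  have ci : c * (4 * a)^-1 < 8^-1.
    apply: (@lt_le_trans _ _ (2^-1 * (4 * a)^-1)); last lin.
    by rewrite ltr_pM2r//; lin.
  have [|||| + _] := K (4 * a)^-1 (1 - c * (4 * a)^-1); rewrite ?a4 ?subrK; [lin|lin|lin|lin|].
  move=> H; apply: (nD 4^-1) => //; apply: H.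
  by apply/inD_Dstar/Or31 => /=; lin.
- have [a1|a1|//] := ltgtP a 1.
    exfalso; apply: (nD 4^-1) => //; apply/K; rewrite ?c0 ?mul0r ?addr0; [lin|lin|lin|lin|].
    by apply: yD; lin.
  have i0 : 0 < (4 * a)^-1 by rewrite invr_gt0; lin.
  have i4 : (4 * a)^-1 < 4^-1 by rewrite ltf_pV2 ?posrE; lin.
  have [|||| + _] := K (4 * a)^-1 1; rewrite ?c0 ?mul0r ?addr0 ?a4; [lin|lin|lin|lin|].
  move=> H; exfalso; apply: (nD 4^-1) => //; apply: H.
  by apply: yD; lin.
Qed.

(** The powers of -1/4 tend to 0 with alternating signs: take a large exponent, or the next one. *)
Lemma quarter_power_sign (b : bool) c : c != 0 ->
  exists n, 0 < (if b then 1 else -1) * (c * (- 4^-1) ^+ n) < 2^-1.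
Proof.
move=> c0; pose x n := c * (- 4^-1) ^+ n.
have xS n : x n.+1 = - x n / 4 by rewrite /x exprS; field.
have x0 n : x n != 0 by rewrite mulf_neq0// expf_neq0.
have [N xN] : exists N, `|x N| < 2^-1.
  have [N cN] : exists N, 2 * `|c| < 2 ^+ N.
    have [N N1] : exists N : nat, 2 * `|c| < N%:R.
      exists (Num.bound (2 * `|c|)); apply: archi_boundP; rewrite mulr_ge0//; lin.
    exists N; apply: lt_trans N1 _; rewrite -natrX ltr_nat; exact: ltn_expl.
  exists N; rewrite /x normrM normrX normrN (ger0_norm (x := 4^-1)); last lin.
  apply: (@le_lt_trans _ _ (`|c| * 2^-1 ^+ N)).
    by apply: ler_wpM2l => //; apply: lerXn2r; rewrite ?nnegrE; lin.
  by rewrite exprVn -ltr_pdivlMr ?invr_gt0 ?exprn_gt0// invrK; lin.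
have xN' : - 2^-1 < x N < 2^-1 by rewrite -ltr_norml.
have [sgn|sgn] := ltP 0 ((if b then 1 else -1) * x N).
  by exists N; rewrite -/(x N); case: (b) sgn; lin.
exists N.+1; rewrite -/(x N.+1) xS; move: (x0 N) sgn; case: (b); lin.
Qed.

Lemma affine_id_extends phi a b c d p q : Aff R phi ->
  (forall v, a < v.1 < b -> c < v.2 < d -> inD v) ->
  a < p.1 < b -> c < p.2 < d -> a < q.1 < b -> c < q.2 < d ->
  affine_at phi p (lower 1 0 1) /\ phi (Xp p) = Xp p ->
  affine_at phi q (lower 1 0 1) /\ phi (Xp q) = Xp q.
Proof.
move=> aff box p1 p2 q1 q2 [aA pp]; have [_ _ cphi _] := homeo_inv_funP phi.
have lE v : act (lower 1 0 1) v = v.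
  by rewrite [RHS]surjective_pairing /act /=; congr pair; ring.
have qE : q = p + sc 1 (q - p).
  by rewrite [LHS]surjective_pairing [RHS]surjective_pairing; congr pair => /=; ring.
have seg t u : 0 <= t <= 1 -> 0 <= u <= 1 -> inD (p + sc t (sc u (q - p))).
  move=> t01 u01; have tu : 0 <= t * u <= 1.
    by have [? ?] := andP t01; have [? ?] := andP u01; rewrite mulr_ge0// mulr_ile1.
  by apply: box => /=; rewrite !mulrA; apply: segment_between.
have sc1 v : sc 1 v = v by rewrite /sc !mul1r -surjective_pairing.
have aS u : 0 <= u <= 1 -> affine_at phi (p + sc u (q - p)) (lower 1 0 1).
  move=> u01; rewrite -(sc1 (sc u (q - p))); apply: affine_at_segment => // t t01.
  exact: seg.
split; first by rewrite qE; apply: aS; lin.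
rewrite qE -{2}(lE (q - p)); apply: path_image => // u u01; rewrite lE.
have iD : inD (p + sc u (q - p)) by have := seg 1 u; rewrite sc1; apply; lin.
by split; [|exact: aS|exact: inD_Dstar].
Qed.

(** The identity spreads from the germ at [q0] through three overlapping convex pieces: the upper
    square, the middle column and the lower square; edge points follow as limits. *)
Lemma fixes_q0_id phi : Aff R phi -> fixes_q0 phi 1 0 1 -> phi = homeo1 X.
Proof.
move=> aff F; have aA := fixes_q0_affine_at aff F; case: F => r r0 rP.
have [_ _ cphi _] := homeo_inv_funP phi.
pose p0 : plane R := q0 R + (r / 2, 0).
have U0 : inU p0 by apply: inU_q0 => /=; lin.
have H0 : affine_at phi p0 (lower 1 0 1) /\ phi (Xp p0) = Xp p0.
  split; first exact: aA.
  have [||_ ->] := rP (r / 2, 0); [rewrite /=; lin|rewrite /=; lin|].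
  by congr Xp; rewrite /p0 [LHS]surjective_pairing [RHS]surjective_pairing; congr pair => /=; ring.
have HU p : inU p -> affine_at phi p (lower 1 0 1) /\ phi (Xp p) = Xp p.
  move=> Up; apply: (@affine_id_extends phi 0 1 2^-1 1 p0) => //;
    [|exact: U0.1|exact: U0.2|exact: Up.1|exact: Up.2].
  by move=> v ? ?; exact: Or31.
have HM p : 0 < p.1 < 2^-1 -> 0 < p.2 < 1 -> affine_at phi p (lower 1 0 1) /\ phi (Xp p) = Xp p.
  have [b1 b2] : 0 < (4^-1 : R) < 2^-1 /\ 0 < (3 / 4 : R) < 1 by split; lin.
  move=> p1 p2; apply: (@affine_id_extends phi 0 2^-1 0 1 (4^-1, 3 / 4)) => //.
    by move=> v ? ?; exact: Or33.
  by apply: HU; split=> /=; lin.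
have HL p : - 2^-1 < p.1 < 2^-1 -> 0 < p.2 < 2^-1 ->
    affine_at phi p (lower 1 0 1) /\ phi (Xp p) = Xp p.
  have [b1 b2 b3] : [/\ - 2^-1 < (4^-1 : R) < 2^-1, 0 < (4^-1 : R) < 2^-1 &
    0 < (4^-1 : R) < 1] by split; lin.
  move=> p1 p2; apply: (@affine_id_extends phi (- 2^-1) 2^-1 0 2^-1 (4^-1, 4^-1)) => //.
    by move=> v ? ?; exact: Or32.
  exact: HM.
have HD p : inD p -> phi (Xp p) = Xp p.
  by case=> -[? ?]; [apply: (HU p _).2|apply: (HL p _ _).2|apply: (HM p _ _).2].
apply: homeo_inj => x; have [p Dp ->] := Xp_surj x; change (phi (Xp p) = Xp p).
have side_id p' q' : side p' q' -> phi (Xp p') = Xp p'.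
  move=> s; have Dp' := sidel_Dstar s.
  have [pr [r1 [prE r10 r1P]]] := side_local s.
  (* The direction (-1, -1) enters the interior from every left member, whichever coordinate is
     normal to its edge. *)
  apply: (@limit_eq _ phi p' (- 1, - 1) p' (- 1, - 1) r1) => // u ur.
  have [|+ _ _] := r1P (sc u (- 1, - 1)); first by split=> /=; lin.
  move=> H; have [|iD _] := H; first by case: prE => -> /=; lin.
  by split; [exact: inD_Dstar..|exact: HD].
case/DstarP: (Dp) => [/HD//|[q s]|[q s]]; first exact: side_id s.
have -> : Xp p = Xp q by apply/Xp_eqP => //; [exact: sidel_Dstar s|exact: Or33].
exact: side_id s.
Qed.

End Rigidity.

(** * The group *)

Section IntegerPower.
Variables (G : groupType) (g : G).
Local Open Scope group_scope.

Definition zpow (k : int) : G := if k is Posz n then g ^+ n else g^-1 ^+ `|k|%N.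

Lemma zpowS k : zpow (k + 1)%R = zpow k * g.
Proof.
case: k => [n|[|n]].
- have -> : (Posz n + 1)%R = Posz n.+1 by rewrite -addn1 PoszD.
  by rewrite /= expgSr.
- by have -> : (Negz 0 + 1)%R = Posz 0 by []; rewrite /= expg1 mulVg.
- have -> : (Negz n.+1 + 1)%R = Negz n by rewrite !NegzE -[in LHS]addn1 PoszD opprD subrK.
  by rewrite /= [in RHS]expgSr mulgVK.
Qed.

Lemma zpow_posD k n : zpow (k + Posz n)%R = zpow k * g ^+ n.
Proof.
elim: n => [|n IH]; first by rewrite addr0 mulg1.
by rewrite -addn1 PoszD addrA zpowS IH addn1 expgSr mulgA.
Qed.

Lemma zpowD k l : zpow (k + l)%R = zpow k * zpow l.
Proof.
case: l => n; first exact: zpow_posD.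
apply: (mulIg (g ^+ n.+1)); rewrite -zpow_posD -mulgA /= expVgn mulVg mulg1.
by rewrite NegzE subrK.
Qed.

End IntegerPower.

Section Group.
Variable R : realType.
Notation X := (Xinf R).
Implicit Types (phi : homeo X).
Variables psi rho : homeo X.
Hypotheses (psi_Aff : Aff R psi) (psiV_Aff : Aff R (homeoV psi)) (rho_Aff : Aff R rho).
Hypotheses (psiE : induces (@psi_box R) (@psi_mx R) (@psi_shift R) psi)
  (rhoE : induces (@rho_box R) (@rho_mx R) (@rho_shift R) rho).

Lemma psi_rhoC : homeoM psi rho = homeoM rho psi.
Proof.
apply: homeo_inj => x; have [p Dp ->] := Xp_surj x.
change (psi (rho (Xp p)) = rho (psi (Xp p))).
(* The pieces [i], [k] are those met by [rho] after [psi], and [j], [l] those met by [psi] after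
   [rho]. *)
have K i j k l : psi_box i p -> rho_box j p -> rho_box k (act (psi_mx R) p + psi_shift R i) ->
   psi_box l (act (rho_mx R) p + rho_shift R j) ->
   act (psi_mx R) (act (rho_mx R) p + rho_shift R j) + psi_shift R l =
   act (rho_mx R) (act (psi_mx R) p + psi_shift R i) + rho_shift R k ->
   psi (rho (Xp p)) = rho (psi (Xp p)).
  move=> bi bj bk bl e; rewrite (psiE Dp bi) (rhoE Dp bj).
  rewrite (psiE (piece_Dstar (@rho_piecewise R) Dp bj) bl).
  by rewrite (rhoE (piece_Dstar (@psi_piecewise R) Dp bi) bk) e.
case: (Dstar_D Dp) => -[/= p1 p2].
- have [x1|x1] := leP p.1 2^-1.
    apply: (K None true false (Some true)); try (split=> /=; lin).
    by rewrite [LHS]surjective_pairing [RHS]surjective_pairing; congr pair => /=; lin.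
  apply: (K (Some false) true true None); try (split=> /=; lin).
  by rewrite [LHS]surjective_pairing [RHS]surjective_pairing; congr pair => /=; lin.
- have [x1|x1] := leP 0 p.1.
    apply: (K None false false (Some false)); try (split=> /=; lin).
    by rewrite [LHS]surjective_pairing [RHS]surjective_pairing; congr pair => /=; lin.
  apply: (K (Some true) false true None); try (split=> /=; lin).
  by rewrite [LHS]surjective_pairing [RHS]surjective_pairing; congr pair => /=; lin.
Qed.

Let sigma : homeo X := homeoM rho psi.

Lemma sigma_fixes : fixes_q0 sigma 2 0 (- 2^-1).
Proof.
exists 8^-1; first lin.
move=> v v1 v2; have U : inU (q0 R + v) by apply: inU_q0; lin.
have Dv := inD_Dstar (inU_inD U).
have b1 : psi_box None (q0 R + v) by split=> /=; lin.
have b2 : rho_box false (act (psi_mx R) (q0 R + v) + psi_shift R None) by split=> /=; lin.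
have E : act (rho_mx R) (act (psi_mx R) (q0 R + v) + psi_shift R None) + rho_shift R false =
    q0 R + act (lower 2 0 (- 2^-1)) v.
  by rewrite [LHS]surjective_pairing [RHS]surjective_pairing; congr pair => /=; field.
split; first by split=> /=; lin.
change (rho (psi (Xp (q0 R + v))) = Xp (q0 R + act (lower 2 0 (- 2^-1)) v)).
by rewrite (psiE Dv b1) (rhoE (piece_Dstar (@psi_piecewise R) Dv b1) b2) E.
Qed.

Lemma Aff1 : Aff R (homeo1 X).
Proof.
move=> x; have [c cc cx] := chart_exists x; exists c, c; split=> //.
exists id; last by apply: filterE.
exists 1, 0, 0, 1, 0, 0 => v; rewrite [LHS]surjective_pairing; congr pair; ring.
Qed.

Lemma rhoV : homeoV rho = rho.
Proof.
have : (rho * rho = 1 :> homeo X)%g := rhoK rhoE.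
by move=> /(congr1 (fun g => rho^-1 * g)%g)/=; rewrite mulKg mulg1 => e; exact: esym e.
Qed.

Lemma sigmaV_Aff : Aff R (homeoV sigma).
Proof.
have -> : homeoV sigma = homeoM (homeoV psi) rho.
  have : ((rho * psi)^-1 = psi^-1 * rho^-1 :> homeo X)%g by rewrite invgM.
  by move=> e; rewrite -[X in homeoM _ X]rhoV; exact: e.
exact: Aff_mul.
Qed.

Lemma sigmaV_fixes : fixes_q0 (homeoV sigma) 2^-1 0 (- 2).
Proof.
have n2 : (- 2^-1 : R) != 0 by rewrite oppr_eq0 invr_eq0 pnatr_eq0.
have := fixes_q0_inv n2 sigma_fixes.
by rewrite oppr0 mul0r invrN invrK.
Qed.

Lemma sigma_Aff : Aff R sigma. Proof. exact: Aff_mul. Qed.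

Lemma iterateE phi n : iterate phi n = (phi ^+ n)%g.
Proof. by elim: n => // n IH; rewrite expgS -IH. Qed.

Lemma iterateV phi n : homeoV (iterate phi n) = iterate (homeoV phi) n.
Proof. by rewrite !iterateE; exact: esym (expVgn _ _). Qed.

Lemma fixes_q0_unit phi a c : Aff R phi -> fixes_q0 phi a c 1 -> a = 1 /\ c = 0.
Proof.
move=> aff F; suff c0 : c = 0 by split=> //; have [_ _] := fixes_q0_small_shear aff F; apply.
apply/eqP; apply: contrapT => /negP c0.
(* Conjugation by [sigma ^+ n], with matrix diagonal, keeps [a] and scales only the shear. *)
have conj n : exists phi', Aff R phi' /\ fixes_q0 phi' a (c * (- 4^-1) ^+ n) 1.
  exists (homeoM (iterate sigma n) (homeoM phi (iterate (homeoV sigma) n))); split.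
    apply: Aff_mul; first exact: Aff_iterate sigma_Aff Aff1.
    by apply: Aff_mul => //; exact: Aff_iterate sigmaV_Aff Aff1.
  have F1 := fixes_q0_iterate n sigma_fixes; have F2 := fixes_q0_iterate n sigmaV_fixes.
  have := fixes_q0_mul F1 (fixes_q0_mul F F2).
  have e1 : 2 ^+ n * (a * 2^-1 ^+ n) = a by rewrite mulrCA -exprMn divff ?expr1n ?mulr1 ?pnatr_eq0.
  have e2 : (- 2^-1) ^+ n * (1 * (- 2) ^+ n) = 1 :> R.
    by rewrite mul1r -exprMn mulrNN mulVf ?expr1n ?pnatr_eq0.
  have e3 : 0 * (a * 2^-1 ^+ n) + (- 2^-1) ^+ n * (c * 2^-1 ^+ n + 1 * 0) = c * (- 4^-1) ^+ n.
    by rewrite mul0r mulr0 addr0 add0r mulrCA -exprMn; congr (_ * _ ^+ _); field.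
  by rewrite e1 e2 e3.
(* The shear is made negative for [a <= 1] and positive for [a > 1], the signs excluded by
   [fixes_q0_small_shear]. *)
have [a1|a1] := leP a 1.
  have [n nP] := quarter_power_sign false c0; have [phi' [aff' F']] := conj n.
  by have [+ _ _] := fixes_q0_small_shear aff' F'; apply; [|move: nP; lin].
have [n nP] := quarter_power_sign true c0; have [phi' [aff' F']] := conj n.
by have [_ + _] := fixes_q0_small_shear aff' F'; apply; [lin|move: nP; lin].
Qed.

Lemma fixes_q0_power phi a c d : Aff R phi -> d != 0 -> fixes_q0 phi a c d ->
  exists k, phi = zpow sigma k.
Proof.
move=> aff d0 F; have [n [dn|dn]] := fixes_q0_ratio d0 F.
- have F' := fixes_q0_mul (fixes_q0_iterate n sigmaV_fixes) F.
  have e : (- 2) ^+ n * d = 1 by rewrite dn -exprMn mulrNN divff ?expr1n ?pnatr_eq0.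
  rewrite e in F'; have aff' := Aff_mul (Aff_iterate n sigmaV_Aff Aff1) aff.
  have [a1 c0] := fixes_q0_unit aff' F'; rewrite a1 c0 in F'.
  have /= E := fixes_q0_id aff' F'; exists (Posz n); rewrite /= -iterateE.
  rewrite -iterateV in E.
  have : ((iterate sigma n)^-1 * phi = 1 :> homeo X)%g by exact: E.
  by move=> /(congr1 (fun g => iterate sigma n * g)%g); rewrite mulVKg mulg1.
- have F' := fixes_q0_mul (fixes_q0_iterate n sigma_fixes) F.
  rewrite [_ * d]mulrC dn in F'; have aff' := Aff_mul (Aff_iterate n sigma_Aff Aff1) aff.
  have [a1 c0] := fixes_q0_unit aff' F'; rewrite a1 c0 in F'.
  have E := fixes_q0_id aff' F'; exists (- Posz n).
  have : (iterate sigma n * phi = 1 :> homeo X)%g by exact: E.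
  move=> /(congr1 (fun g => (iterate sigma n)^-1 * g)%g); rewrite mulKg mulg1 iterateE => ->.
  by apply: (mulIg (sigma ^+ n)%g); rewrite mulVg -zpow_posD addNr.
Qed.

Definition param (v : int * 'Z_2) : homeo X := (zpow psi v.1 * rho ^+ (v.2 : nat))%g.

Lemma Z2_cases (b : 'Z_2) : b = 0 \/ b = 1.
Proof. by case: b => [[|[|//]] i]; [left|right]; exact: val_inj. Qed.

Lemma psi_rho_commute : commute psi rho. Proof. exact: psi_rhoC. Qed.

Lemma zpow_commute k : commute (zpow psi k) rho.
Proof.
case: k => n; apply/commute_sym/commuteX/commute_sym; first exact: psi_rho_commute.
exact/commute_sym/commuteV/commute_sym/psi_rho_commute.
Qed.

Lemma rho2 : (rho * rho = 1)%g. Proof. exact: rhoK rhoE. Qed.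

Lemma paramD : {morph param : u v / u + v >-> (u * v)%g}.
Proof.
move=> [k b] [l b']; rewrite /param /= zpowD.
have -> : (rho ^+ (b + b')%R = rho ^+ b * rho ^+ b')%g.
  have e0 : (rho ^+ (0 : 'Z_2)%R = 1)%g by [].
  have e1 : (rho ^+ (1 : 'Z_2)%R = rho)%g by [].
  have e2 : (1 + 1)%R = 0 :> 'Z_2 by exact: val_inj.
  by case: (Z2_cases b) => ->; case: (Z2_cases b') => ->;
    rewrite ?add0r ?addr0 ?e2 ?e0 ?e1 ?mulg1 ?mul1g ?rho2.
rewrite -!mulgA; congr (_ * _)%g; rewrite !mulgA; congr (_ * _)%g.
by apply: commuteX; exact: zpow_commute.
Qed.

Lemma zpow_sigma k : exists b : 'Z_2, zpow sigma k = param (k, b).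
Proof.
have sE : sigma = (psi * rho)%g by rewrite /sigma -psi_rhoC.
have sVE : (sigma^-1 = psi^-1 * rho)%g.
  rewrite sE invgM (_ : rho^-1 = rho)%g; last exact: rhoV.
  exact/commuteV/commute_sym/psi_rho_commute.
have pw n : exists b : 'Z_2, (rho ^+ n = rho ^+ b)%g.
  exists (odd n)%:R; rewrite -{1}(odd_double_half n) expgnDr -muln2 mulnC expgnA expg2 rho2 expg1n mulg1.
  by case: (odd n).
case: k => n /=.
  rewrite sE expgMn; last exact: psi_rho_commute.
  by have [b ->] := pw n; exists b.
rewrite sVE expgMn; last exact/commute_sym/commuteV/commute_sym/psi_rho_commute.
by have [b ->] := pw n.+1; exists b.
Qed.

Lemma Aff_param phi : Aff R phi -> range param phi.
Proof.
move=> aff; have [a [c [d [a0 d0 F]]]] := fixes_q0_exists rho_Aff rhoE aff.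
case: F => F.
  have [k ->] := fixes_q0_power aff d0 F; have [b ->] := zpow_sigma k.
  by exists (k, b).
(* Here [rho] after [phi] is a power of [sigma]; since [rho] is an involution, [phi] differs from
   that power by one more factor [rho]. *)
have [k E] := fixes_q0_power (Aff_mul rho_Aff aff) d0 F; have [b Eb] := zpow_sigma k.
exists ((k, (b + 1 : 'Z_2)) : int * 'Z_2) => //.
have -> : (k, (b + 1 : 'Z_2)) = (0, 1) + (k, b) :> (int * 'Z_2)%type.
  by congr pair; [rewrite add0r|rewrite addrC].
rewrite paramD -Eb -E /param /= mul1g expg1.
have : (rho * (rho * phi) = phi :> homeo X)%g by rewrite mulgA rho2 mul1g.
exact.
Qed.

Lemma param_Aff v : Aff R (param v).
Proof.
have pw phi n : Aff R phi -> Aff R (phi ^+ n)%g.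
  by move=> a; rewrite -iterateE; exact: Aff_iterate a Aff1.
have : Aff R (homeoM (zpow psi v.1) (rho ^+ (v.2 : nat))%g); last exact.
apply: Aff_mul; last exact: pw.
by case: v.1 => n; exact: pw.
Qed.

Lemma fixes_q0_uniq phi a c d a' c' d' : fixes_q0 phi a c d -> fixes_q0 phi a' c' d' -> a = a'.
Proof.
move=> [r r0 rP] [r' r'0 r'P]; pose m := Num.min r r' / 2.
have [m1 m2] : Num.min r r' <= r /\ Num.min r r' <= r' by rewrite !ge_min !lexx orbT.
have m0 : 0 < Num.min r r' by rewrite lt_min; lin.
have [||U E] := rP (m, 0); [rewrite /= /m; lin|rewrite /=; lin|].
have [||U' E'] := r'P (m, 0); [rewrite /= /m; lin|rewrite /=; lin|].
have /Xp_eqP := etrans (esym E) E'.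
move=> /(_ (inD_Dstar (inU_inD U)) (inD_Dstar (inU_inD U')))/(twin_inD (inU_inD U)).
move=> /(f_equal fst)/=; rewrite !mulr0 !addr0 !add0r => /mulIf ->//.
by rewrite /m; lin.
Qed.

Lemma rho_neq1 : rho <> 1%g.
Proof.
move=> r1; have iD : inD (4^-1 : R, 4^-1) by apply: Or32 => /=; lin.
have := rho_lower rhoE (inD_Dstar iD) ltac:(rewrite /=; lin) ltac:(rewrite /=; lin).
rewrite r1 /= => E.
have iD' : inD (4^-1 + 2^-1 : R, 1 - 4^-1) by apply: Or31 => /=; lin.
have /(Xp_eqP (inD_Dstar iD) (inD_Dstar iD'))/(twin_inD iD) := E.
by move=> /(f_equal fst)/=; lin.
Qed.

(** Squaring an element of the kernel removes the factor [rho] and leaves a power of [psi]. Its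
    triviality is tested on [sigma], which fixes [q0] and has the same even powers:
    [sigma ^+ (n + n)] expands horizontally by [2 ^+ (n + n)]. *)
Lemma param_inj : injective param.
Proof.
have psi2 n : (psi ^+ n * psi ^+ n = 1)%g -> n = 0%N.
  move=> E; have : fixes_q0 (iterate sigma (n + n)) 1 0 1.
    have -> : iterate sigma (n + n) = homeo1 X; last exact: fixes_q0_1.
    rewrite iterateE /sigma -psi_rhoC.
    change (((psi * rho) ^+ (n + n))%g = 1%g).
    rewrite expgMn; last exact: psi_rho_commute.
    by rewrite !expgnDr E mul1g -expgMn ?rho2 ?expg1n.
  move=> /(fixes_q0_uniq (fixes_q0_iterate (n + n) sigma_fixes)) e2n.
  case: n {E} e2n => // n e2n.
  have : 1 < 2 ^+ (n.+1 + n.+1) :> R by apply: exprn_egt1 => //; rewrite ltr1n.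
  by rewrite e2n ltxx.
have ker v : param v = 1%g -> v = 0.
  case: v => k b; rewrite /param /= => E.
  have E2 : (zpow psi k * zpow psi k = 1)%g.
    have c1 : commute (zpow psi k) (rho ^+ b) by apply: commuteX; exact: zpow_commute.
    have := congr1 (fun g => g * g)%g E; rewrite mulg1 -mulgA (mulgA (rho ^+ b)%g) -c1 !mulgA -mulgA.
    have -> : (rho ^+ b * rho ^+ b = 1)%g.
      by case: (Z2_cases b) => -> /=; rewrite ?expg0 ?mulg1// expg1 rho2.
    by rewrite mulg1.
  have k0 : k = 0.
    case: k E2 {E} => n /= E2; first by rewrite (psi2 _ E2).
    have := congr1 (fun g => g^-1)%g E2; rewrite invgM -!expVgn !invgK invg1 => /psi2.
    by [].
  rewrite k0 /= mul1g in E *; congr pair.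
  case: (Z2_cases b) => // b1; move: E; rewrite b1 expg1 => /rho_neq1 [].
move=> u v E; apply/eqP; rewrite -subr_eq0; apply/eqP/ker.
apply: (mulIg (param v)); rewrite -paramD subrK mul1g. exact: E.
Qed.

Lemma generated_param v : generated_subgroup [set psi; rho] (param v).
Proof.
move=> H [gc sub]; have Hpsi : psi \in H by apply/mem_set/sub; left.
have Hrho : rho \in H by apply/mem_set/sub; right.
have HM := group_closedM gc; have HV := group_closedV gc.
have pw g n : g \in H -> (g ^+ n)%g \in H.
  by move=> Hg; elim: n => [|n IH]; [exact: gc.1|rewrite expgS; exact: HM].
apply: set_mem; rewrite /param; apply: HM; last exact: pw.
by case: v.1 => n; apply: pw => //; exact: HV.
Qed.

Lemma generated_sub_range : generated_subgroup [set psi; rho] `<=` range param.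
Proof.
apply: smallest_sub; first split.
- by apply/mem_set; exists 0 => //; rewrite /param /= mulg1.
- move=> _ _ /set_mem[u _ <-] /set_mem[v _ <-]; apply/mem_set; exists (u - v) => //.
  by apply: (mulIg (param v)); rewrite -paramD subrK mulgVK.
- move=> _ [->|->].
    by exists (Posz 1, 0) => //; rewrite /param /= expg1 mulg1.
  by exists (0, 1) => //; rewrite /param /= mul1g.
Qed.

End Group.

Theorem theorem4p1 (R : realType) :
  exists psi rho : homeo (Xinf R),
    [/\ is_psi psi,
        is_rho rho,
        Aff R = generated_subgroup [set psi; rho] &
        isomorphic_subgroup (int * 'Z_2)%type (Aff R)].
Proof.
have [psi [isP aP aPV iP]] := exists_psi R; have [rho [isR aR iR]] := exists_rho R.
have rangeE : range (param psi rho) = Aff R.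
  apply/seteqP; split=> [_ [v _ <-]|phi]; first exact: param_Aff.
  exact: Aff_param.
exists psi, rho; split=> //.
  rewrite -rangeE; apply/seteqP; split=> [_ [v _ <-]|].
    exact: generated_param.
  exact: generated_sub_range.
exists (param psi rho); split=> //; first exact: paramD.
exact: param_inj.
Qed.
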